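(* Let $m\ge 1$, $\kappa\ge 0$, $0<\alpha_j<1$ for $1\le j\le m$, $\alpha=\min_{1\le j\le m}\alpha_j$, $0<T<\infty$, and let $A,B_1,\dots,B_m$ be operators in the Hilbert space $\mathbf H$ as described in the context. Let $v$ be the solution of $$v'(t)+Av(t)+\sum_{j=1}^m\int_0^t\omega_{\alpha_j}(t-s)B_jv(s)\,ds-\kappa v(t)=g(t),\quad t>0,\qquad v(0)=u_0 ,$$ where $\omega_{\alpha_j}(t)=t^{\alpha_j-1}/\Gamma(\alpha_j)$. Suppose that for some positive constant $C$ $$\|Au_0-g(0)\|+\|g(t)\|\le C,\qquad \|E'(t)(Au_0-g(0))\|+\|g'(t)\|+t\|g''(t)\|\le Ct^{\alpha-1},\qquad 0<t\le T,$$ where $E(t)=\exp(-At)$. Then there is a positive constant $C$, independent of $t$, such that $$\|v'(t)\|+\|Av(t)\|\le C\|u_0\|,\qquad 0<t\le T.$$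
   Context: $\mathbf H$ is a Hilbert space with inner product $(\cdot,\cdot)$ and norm $\|\cdot\|$ (in the setting considered, $\mathbf H=L_2(\Omega)$ with $\Omega\subseteq\mathbb R^d$ a Lipschitz domain). $A$ is a self-adjoint positive-definite linear operator, not necessarily bounded, with compact inverse, defined on a dense subspace $D(A)\subset\mathbf H$. Set $\|w\|_q=\|A^{q/2}w\|=(A^qw,w)^{1/2}$. Each $B_j$ ($1\le j\le m$) is a self-adjoint linear operator in $\mathbf H$ with $D(B_j)\supset D(A)$, and $A$ dominates $B_j$ in the sense that $|(B_jw,v)|\le C\|w\|_q\|v\|_\vartheta$ for $\vartheta=0,1,2$ and $\vartheta+q=2$. $E(t)=\exp(-At)$ is the analytic semigroup generated by $-A$, and primes denote derivatives in $t$. $C$ denotes a generic positive constant, not necessarily the same at each occurrence.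
   Formalization: The initial value u_0 is assumed nonzero, since for u_0 = 0 the claim is false: with H = R, A = 1, B_j = 0, κ = 0, g = 1 the solution is v = 1 - exp(-t), so ‖v'‖ + ‖Av‖ = 1 while C‖u_0‖ = 0. *)

(* Defs.v *)
From Stdlib Require Export Reals.
From Coquelicot Require Export Coquelicot.

(** Real Hilbert spaces: a complete normed module over [R] whose norm comes
    from an inner product.  ([inner_norm] gives positivity and definiteness.) *)
Record HilbertSpace := {
  hilbert_carrier :> CompleteNormedModule R_AbsRing;
  inner : hilbert_carrier -> hilbert_carrier -> R;
  inner_sym : forall x y, inner x y = inner y x;
  inner_plus_l : forall x y z, inner (plus x y) z = inner x z + inner y z;
  inner_scal_l : forall (a : R) x y, inner (scal a x) y = a * inner x y;
  inner_norm : forall x, inner x x = norm x ^ 2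
}.
Arguments inner {h} x y.

(** A not necessarily everywhere defined operator: the value [op x] is
    meaningful only when [dom x] holds. *)
Record operator (H : HilbertSpace) := {
  dom : H -> Prop;
  op :> H -> H
}.
Arguments dom {H} o x.
Arguments op {H} o x.

Definition linear_operator {H : HilbertSpace} (A : operator H) : Prop :=
  dom A zero /\
  (forall x y, dom A x -> dom A y ->
     dom A (plus x y) /\ A (plus x y) = plus (A x) (A y)) /\
  (forall (a : R) x, dom A x -> dom A (scal a x) /\ A (scal a x) = scal a (A x)).

Definition densely_defined {H : HilbertSpace} (A : operator H) : Prop :=
  forall (x : H) (eps : R), 0 < eps ->
    exists y, dom A y /\ norm (minus y x) < eps.

(** [(y, z)] is in the graph of the adjoint of [A]. *)
Definition adjoint_graph {H : HilbertSpace} (A : operator H) (y z : H) : Prop :=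
  forall x, dom A x -> inner (A x) y = inner x z.

(** [A = A*], domains included. *)
Definition self_adjoint {H : HilbertSpace} (A : operator H) : Prop :=
  linear_operator A /\ densely_defined A /\
  (forall y z, adjoint_graph A y z <-> (dom A y /\ A y = z)).

Definition positive_definite {H : HilbertSpace} (A : operator H) : Prop :=
  forall w, dom A w -> w <> zero -> 0 < inner (A w) w.

Definition compact_map {H : HilbertSpace} (K : H -> H) : Prop :=
  forall x : nat -> H,
    (exists M, forall n, norm (x n) <= M) ->
    exists (phi : nat -> nat) (y : H),
      (forall n, (phi n < phi (S n))%nat) /\
      filterlim (fun n => K (x (phi n))) eventually (locally y).

Definition has_compact_inverse {H : HilbertSpace} (A : operator H) : Prop :=
  exists K : H -> H,
    is_linear K /\ compact_map K /\
    (forall y, dom A (K y) /\ A (K y) = y) /\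
    (forall x, dom A x -> K (A x) = x).

(** [||w||_q = ||A^(q/2) w|| = (A^q w, w)^(1/2)] for [w] in [D(A)] and
    [q = 0, 1, 2].  For [q = 2] the form [||A w||] is used, because
    [(A^2 w, w)] would require [A w] to be in [D(A)]. *)
Definition norm_A {H : HilbertSpace} (A : operator H) (q : nat) (w : H) : R :=
  match q with
  | 0%nat => norm w
  | 1%nat => sqrt (inner (A w) w)
  | _ => norm (A w)
  end.

(** [A] dominates [B].  It suffices to ask for the bound on [D(A)]: by density
    and symmetry of [B] it extends to all [w] and [v] for which both sides
    make sense. *)
Definition dominates {H : HilbertSpace} (A B : operator H) : Prop :=
  exists C : R, 0 < C /\
    forall theta q : nat, (theta + q = 2)%nat ->
      forall w v : H, dom A w -> dom A v ->
        Rabs (inner (B w) v) <= C * norm_A A q w * norm_A A theta v.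

(** [E] is the strongly continuous semigroup with infinitesimal generator [-A];
    this determines [E t] for [t >= 0].  For self-adjoint positive-definite [A]
    such a semigroup exists and is automatically analytic. *)
Record semigroup_exp_minus {H : HilbertSpace} (A : operator H)
    (E : R -> H -> H) : Prop := {
  sg_linear : forall t, 0 <= t -> is_linear (E t);
  sg_zero : forall x, E 0 x = x;
  sg_plus : forall s t x, 0 <= s -> 0 <= t -> E (s + t) x = E s (E t x);
  sg_cont : forall x, filterlim (fun t => E t x) (at_right 0) (locally x);
  sg_generator : forall x y,
    filterlim (fun h => scal (/ h) (minus (E h x) x)) (at_right 0) (locally y)
    <-> (dom A x /\ y = opp (A x))
}.

Definition Gamma (a : R) : R :=
  RInt_gen (fun x => Rpower x (a - 1) * exp (- x))
           (at_right 0) (Rbar_locally p_infty).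

Definition omega (a t : R) : R := Rpower t (a - 1) / Gamma a.

(** [int_0^t omega_a(t-s) B v(s) ds = l], as an improper vector-valued integral
    (the kernel is singular at [s = t]). *)
Definition is_memory_integral {H : HilbertSpace} (a : R) (B : operator H)
    (v : R -> H) (t : R) (l : H) : Prop :=
  is_RInt_gen (fun s => scal (omega a (t - s)) (B (v s)))
              (at_right 0) (at_left t) l.

(** [v], with derivative [v'], is a (strong) solution for [t > 0] with initial
    value [u0], attained continuously. *)
Definition is_solution {H : HilbertSpace} (m : nat) (kappa : R)
    (alphas : nat -> R) (A : operator H) (B : nat -> operator H)
    (g : R -> H) (u0 : H) (v v' : R -> H) : Prop :=
  v 0 = u0 /\
  filterlim v (at_right 0) (locally u0) /\
  (forall t, 0 < t ->
     is_derive v t (v' t) /\ dom A (v t) /\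
     exists I : nat -> H,
       (forall j, (1 <= j <= m)%nat ->
          is_memory_integral (alphas j) (B j) v t (I j)) /\
       minus (plus (plus (v' t) (A (v t))) (sum_n_m I 1 m)) (scal kappa (v t))
         = g t).

Definition is_min_of (m : nat) (alphas : nat -> R) (alpha : R) : Prop :=
  (exists j, (1 <= j <= m)%nat /\ alpha = alphas j) /\
  (forall j, (1 <= j <= m)%nat -> alpha <= alphas j).

(* Main.v *)
Require Import Defs.
From Stdlib Require Import Reals Lra Lia.
From Coquelicot Require Import Coquelicot.
Open Scope R_scope.

(** Let [K = A^-1] and [M_j = B_j K / (a_j Gamma(a_j))], which is bounded and
    satisfies [(K M_j x, y) = (K x, M_j y)]; the substitution
    [s -> s^(1/a_j)] turns the memory terms into integrals of continuous functions
    against bounded delays.  For [u = v - u0], extended by [0] to [t <= 0], nothing is known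
    about the integrability of [A u], so one works with [U = int_0^t u]: solving a
    Volterra equation with the operators [M_j] shows that [A U] exists and is continuous.
    Testing the equation of second differences [D_k D_h U] with [D_k D_h U] itself, and using
    only the form bound [|(B_j w, v)| <= C |w|_1 |v|_1], gives [|D_k D_h U| <= C h k], because
    the right-hand side has bounded variation in time.  Hence [u] is Lipschitz and [v'] is
    bounded.  The Volterra equation for [A U] then shows that [A U] is Lipschitz,
    so [A u] is bounded. *)

(** The conclusion asks for a constant independent of [t], so it may depend on [u0] and the data; as
    [u0] is nonzero, any bound uniform in [t] becomes a multiple of |u0|. The obstacle is that [B j]
    is as strong as [A], while a strong solution gives A v only pointwise in time, so the memory
    terms cannot be estimated in norm at the start. What is under control is K M_j z with z = A u:
    moving M_j to the test vector gives |K M_j z| <= C |K z| = C |u|. This is why K is applied to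
    the equation and why identities are tested against vectors K w, whose span is dense. Second
    differences of U are forced by the data: the right-hand side of the equation for u jumps at t =
    0 and afterwards has a derivative of size t^(alpha-1). Its differences of step h are therefore
    O(h) only after integration in time, not pointwise. Hence the energy estimate is arranged so
    that only the time integral of the right-hand side enters. All smallness comes from weights
    exp(-lam t): a delay integral of an exponential gains a factor that tends to 0 as lam grows. *)

Lemma inner_plus_r {H : HilbertSpace} (x y z : H) :
  inner x (plus y z) = inner x y + inner x z.
Proof.
  rewrite inner_sym, inner_plus_l, (inner_sym _ y), (inner_sym _ z). reflexivity.
Qed.

Lemma inner_scal_r {H : HilbertSpace} (a : R) (x y : H) :
  inner x (scal a y) = a * inner x y.
Proof. rewrite inner_sym, inner_scal_l, inner_sym. reflexivity. Qed.

Lemma inner_opp_l {H : HilbertSpace} (x y : H) : inner (opp x) y = - inner x y.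
Proof.
  replace (opp x) with (scal (-1) x) by apply (scal_opp_one x).
  rewrite inner_scal_l. ring.
Qed.

Lemma inner_opp_r {H : HilbertSpace} (x y : H) : inner x (opp y) = - inner x y.
Proof. rewrite inner_sym, inner_opp_l, inner_sym. reflexivity. Qed.

Lemma inner_minus_l {H : HilbertSpace} (x y z : H) :
  inner (minus x y) z = inner x z - inner y z.
Proof. unfold minus. rewrite inner_plus_l, inner_opp_l. ring. Qed.

Lemma inner_minus_r {H : HilbertSpace} (x y z : H) :
  inner x (minus y z) = inner x y - inner x z.
Proof. rewrite inner_sym, inner_minus_l, !(inner_sym _ _ x). reflexivity. Qed.

Lemma inner_zero_l {H : HilbertSpace} (x : H) : inner zero x = 0.
Proof.
  replace (zero : H) with (scal 0 x) by apply (scal_zero_l x).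
  rewrite inner_scal_l. ring.
Qed.

Lemma inner_zero_r {H : HilbertSpace} (x : H) : inner x zero = 0.
Proof. rewrite inner_sym. apply inner_zero_l. Qed.

(* Keyed [rewrite] misses occurrences whose algebraic structure is a different
   (convertible) projection of the Hilbert space, hence the explicit instances. *)
Ltac inner_simpl := repeat
  match goal with |- context [?t] =>
  lazymatch t with
  | @inner ?H (minus ?x ?y) ?z => rewrite (@inner_minus_l H x y z : t = inner x z - inner y z)
  | @inner ?H ?z (minus ?x ?y) => rewrite (@inner_minus_r H z x y : t = inner z x - inner z y)
  | @inner ?H (plus ?x ?y) ?z => rewrite (@inner_plus_l H x y z : t = inner x z + inner y z)
  | @inner ?H ?z (plus ?x ?y) => rewrite (@inner_plus_r H z x y : t = inner z x + inner z y)
  | @inner ?H (opp ?x) ?z => rewrite (@inner_opp_l H x z : t = - inner x z)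
  | @inner ?H ?z (opp ?x) => rewrite (@inner_opp_r H z x : t = - inner z x)
  | @inner ?H (scal ?a ?x) ?z => rewrite (@inner_scal_l H a x z : t = a * inner x z)
  | @inner ?H ?z (scal ?a ?x) => rewrite (@inner_scal_r H a z x : t = a * inner z x)
  | @inner ?H zero ?z => rewrite (@inner_zero_l H z : t = 0)
  | @inner ?H ?z zero => rewrite (@inner_zero_r H z : t = 0)
  end end.

(** From the nonnegativity of [|| ||y|| x -+ ||x|| y ||^2]. *)
Lemma cauchy_schwarz {H : HilbertSpace} (x y : H) :
  Rabs (inner x y) <= norm x * norm y.
Proof.
  assert (Hx := norm_ge_0 x). assert (Hy := norm_ge_0 y).
  destruct (Req_dec (norm x) 0) as [E | E].
  { apply norm_eq_zero in E. subst x. inner_simpl. rewrite Rabs_R0.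
    apply Rmult_le_pos; assumption. }
  destruct (Req_dec (norm y) 0) as [F | F].
  { apply norm_eq_zero in F. subst y. inner_simpl. rewrite Rabs_R0.
    apply Rmult_le_pos; assumption. }
  assert (P : 0 < norm x * norm y) by (apply Rmult_lt_0_compat; lra).
  assert (Q : forall s : R, s ^ 2 = 1 ->
    0 <= 2 * (norm x * norm y) * (norm x * norm y + s * inner x y)).
  { intros s Hs.
    assert (W := inner_norm _ (plus (scal (norm y) x) (scal (s * norm x) y))).
    assert (W2 := pow2_ge_0 (norm (plus (scal (norm y) x) (scal (s * norm x) y)))).
    rewrite <- W in W2.
    revert W2. inner_simpl. rewrite !inner_norm, (inner_sym _ y x). intros W2.
    replace (2 * (norm x * norm y) * (norm x * norm y + s * inner x y)) with
      (norm y ^ 2 * norm x ^ 2 + s ^ 2 * (norm x ^ 2 * norm y ^ 2)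
        + 2 * s * (norm x * norm y) * inner x y) by (rewrite Hs; ring).
    nra. }
  assert (Q1 := Q 1 ltac:(ring)). assert (Q2 := Q (-1) ltac:(ring)).
  apply Rabs_le. split; nra.
Qed.

Lemma inner_le_norm {H : HilbertSpace} (x y : H) : inner x y <= norm x * norm y.
Proof. eapply Rle_trans; [apply Rle_abs | apply cauchy_schwarz]. Qed.

Lemma inner_ext {H : HilbertSpace} (x y : H) :
  (forall w, inner x w = inner y w) -> x = y.
Proof.
  intros E. assert (Z : norm (minus x y) = 0).
  { assert (W := inner_norm _ (minus x y)). rewrite (inner_minus_l x y), E, Rminus_diag in W.
    assert (W2 := norm_ge_0 (minus x y)). nra. }
  apply norm_eq_zero in Z. apply (plus_reg_r (opp y)). rewrite plus_opp_r. exact Z.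
Qed.

Lemma norm_le_of_inner {H : HilbertSpace} (x : H) (M : R) :
  0 <= M -> (forall w, inner x w <= M * norm w) -> norm x <= M.
Proof.
  intros HM E. assert (W := E x). rewrite inner_norm in W.
  assert (W2 := norm_ge_0 x). nra.
Qed.

Lemma is_linear_inner_l {H : HilbertSpace} (w : H) :
  is_linear (fun x : H => inner x w : R_NormedModule).
Proof.
  split.
  - intros x y. apply inner_plus_l.
  - intros k x. apply inner_scal_l.
  - exists (norm w + 1). assert (W := norm_ge_0 w). split; [lra | intros x].
    apply Rle_trans with (norm x * norm w); [apply cauchy_schwarz | ].
    assert (W2 := norm_ge_0 x). nra.
Qed.

(** Linear identities between vectors hold if they hold after pairing with
    every vector, where [ring] applies. *)
Ltac hilbert_ring :=
  apply inner_ext; let w := fresh "w" in intros w; inner_simpl; ring.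

Lemma norm_minus_sym {H : HilbertSpace} (x y : H) :
  norm (minus x y) = norm (minus y x).
Proof. rewrite <- (norm_opp (minus x y)). f_equal. hilbert_ring. Qed.

Lemma norm_scal_eq {H : HilbertSpace} (a : R) (x : H) :
  norm (scal a x) = Rabs a * norm x.
Proof.
  assert (W := inner_norm _ (scal a x)).
  revert W. inner_simpl. rewrite inner_norm. intros W.
  assert (P := norm_ge_0 (scal a x)). assert (Q := norm_ge_0 x). assert (P2 := Rabs_pos a).
  assert (E : norm (scal a x) ^ 2 = (Rabs a * norm x) ^ 2).
  { rewrite <- W, Rpow_mult_distr, pow2_abs. ring. }
  assert (0 <= Rabs a * norm x) by (apply Rmult_le_pos; assumption).
  nra.
Qed.

Lemma norm_minus_le {H : HilbertSpace} (x y : H) :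
  norm (minus x y) <= norm x + norm y.
Proof.
  eapply Rle_trans; [apply (norm_triangle x (opp y)) | apply Rplus_le_compat_l; right; exact (@norm_opp R_AbsRing H y)].
Qed.

Lemma norm_le_minus {H : HilbertSpace} (x y : H) :
  norm x <= norm (minus x y) + norm y.
Proof.
  replace x with (plus (minus x y) y) at 1 by hilbert_ring.
  exact (@norm_triangle R_AbsRing H (minus x y) y).
Qed.

Lemma norm_minus_triangle {H : HilbertSpace} (x y z : H) :
  norm (minus x z) <= norm (minus x y) + norm (minus y z).
Proof.
  replace (minus x z) with (plus (minus x y) (minus y z)) by hilbert_ring.
  exact (@norm_triangle R_AbsRing H (minus x y) (minus y z)).
Qed.

(** * Limits, derivatives and integrals of Hilbert-space valued functions *)

Lemma filterlim_norm_minus {H : HilbertSpace} {T : Type} (F : (T -> Prop) -> Prop)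
  (FF : Filter F) (f : T -> H) (l : H) :
  filterlim f F (locally l) <->
  (forall eps : posreal, F (fun t => norm (minus (f t) l) < eps)).
Proof.
  split.
  - intros Hf eps. exact (proj1 (filterlim_locally_ball_norm f l) Hf eps).
  - intros Hf. exact (proj2 (filterlim_locally_ball_norm f l) Hf).
Qed.

Lemma continuous_norm_minus {H : HilbertSpace} (f : R -> H) (t : R) :
  continuous f t <->
  (forall eps : posreal, exists delta : posreal,
     forall s, Rabs (s - t) < delta -> norm (minus (f s) (f t)) < eps).
Proof.
  assert (W := filterlim_norm_minus (locally t) _ f (f t)).
  split; [intros Hf eps; destruct (proj1 W Hf eps) as [d Hd]
         | intros Hf; apply (proj2 W); intros eps; destruct (Hf eps) as [d Hd]];
    exists d; intros s Hs; apply Hd; exact Hs.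
Qed.

Lemma continuous_linear_comp {V W : NormedModule R_AbsRing} (L : V -> W) (f : R -> V) (t : R) :
  is_linear L -> continuous f t -> continuous (fun s => L (f s)) t.
Proof. intros HL Hf. apply continuous_comp; [exact Hf | apply linear_cont, HL]. Qed.

Lemma is_derive_linear_comp {V W : NormedModule R_AbsRing} (L : V -> W) (f : R -> V) (t : R) (l : V) :
  is_linear L -> is_derive f t l -> is_derive (fun s => L (f s)) t (L l).
Proof.
  intros HL Hf. unfold is_derive in *.
  eapply filterdiff_ext_lin.
  - apply (filterdiff_comp' f L t _ L Hf). apply filterdiff_linear, HL.
  - intros y. simpl. apply (linear_scal _ HL).
Qed.

Lemma is_RInt_linear_comp {V W : NormedModule R_AbsRing} (L : V -> W) (f : R -> V) (a b : R) (l : V) :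
  is_linear L -> is_RInt f a b l -> is_RInt (fun s => L (f s)) a b (L l).
Proof.
  intros HL Hf. unfold is_RInt in *.
  assert (E : forall ptd, scal (sign (b - a)) (Riemann_sum (fun s => L (f s)) ptd)
    = L (scal (sign (b - a)) (Riemann_sum f ptd))).
  { intros ptd. rewrite (linear_scal _ HL). f_equal.
    induction ptd as [x0 | h s IH] using SF_cons_ind.
    - symmetry. exact (linear_zero _ HL).
    - rewrite !Riemann_sum_cons, (linear_plus _ HL), (linear_scal _ HL), IH. reflexivity. }
  eapply filterlim_ext; [intros ptd; symmetry; apply E | ].
  eapply filterlim_comp; [exact Hf | apply linear_cont, HL].
Qed.

Lemma continuous_inner {H : HilbertSpace} (f g : R -> H) (t : R) :
  continuous f t -> continuous g t -> continuous (fun s => inner (f s) (g s) : R) t.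
Proof.
  intros Hf Hg.
  (* Expansion around [t]: terms linear in [f s] or [g s], plus a remainder bilinear in the two
     increments, which Cauchy-Schwarz controls. *)
  assert (P : forall s, inner (f s) (g s) =
    inner (f s) (g t) + (inner (g s) (f t) - inner (g t) (f t)) + inner (minus (f s) (f t)) (minus (g s) (g t))).
  { intros s. inner_simpl. rewrite (inner_sym _ (g s) (f t)), (inner_sym _ (g t) (f t)). ring. }
  apply continuous_ext with (1 := fun s => eq_sym (P s)).
  apply (continuous_plus (V := R_NormedModule)).
  - apply (continuous_plus (V := R_NormedModule)).
    + apply (continuous_linear_comp (fun x : H => inner x (g t) : R_NormedModule) f t (is_linear_inner_l _) Hf).
    + apply (continuous_minus (V := R_NormedModule)); [ | apply continuous_const].
      apply (continuous_linear_comp (fun x : H => inner x (f t) : R_NormedModule) g t (is_linear_inner_l _) Hg).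
  - apply filterlim_locally. intros eps.
    rewrite continuous_norm_minus in Hf, Hg.
    destruct (Hf (mkposreal 1 Rlt_0_1)) as [d1 H1]. destruct (Hg eps) as [d2 H2].
    exists (mkposreal _ (Rmin_stable_in_posreal d1 d2)). intros s Hs.
    assert (A1 := H1 s (Rlt_le_trans _ _ _ Hs (Rmin_l _ _))).
    assert (A2 := H2 s (Rlt_le_trans _ _ _ Hs (Rmin_r _ _))).
    change (Rabs (inner (minus (f s) (f t)) (minus (g s) (g t))
      - inner (minus (f t) (f t)) (minus (g t) (g t))) < eps).
    replace (inner (minus (f t) (f t)) (minus (g t) (g t))) with 0 by (inner_simpl; ring).
    rewrite Rminus_0_r.
    eapply Rle_lt_trans; [apply cauchy_schwarz | ].
    simpl in A1. assert (N1 := norm_ge_0 (minus (f s) (f t))).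
    assert (N2 := norm_ge_0 (minus (g s) (g t))).
    apply Rle_lt_trans with (1 * norm (minus (g s) (g t))); [ | lra].
    apply Rmult_le_compat_r; lra.
Qed.

(** After the linear part of the expansion around [f t] is split off, the remainder is |f s - f t|^2
    = O((s - t)^2), whose derivative at [t] is 0. *)
Lemma is_derive_norm_sqr {H : HilbertSpace} (f : R -> H) (t : R) (l : H) :
  is_derive f t l -> is_derive (fun s => inner (f s) (f s) : R) t (2 * inner l (f t)).
Proof.
  intros Hf.
  assert (P : forall s, inner (f s) (f s) =
    (2 * inner (f s) (f t) - inner (f t) (f t)) + inner (minus (f s) (f t)) (minus (f s) (f t))).
  { intros s. inner_simpl. rewrite (inner_sym _ (f t) (f s)). ring. }
  apply (is_derive_ext (fun s => (2 * inner (f s) (f t) - inner (f t) (f t))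
     + inner (minus (f s) (f t)) (minus (f s) (f t)))).
  { intros s. symmetry. apply P. }
  replace (2 * inner l (f t)) with ((2 * inner l (f t) - 0) + 0) by ring.
  apply (is_derive_plus (V := R_NormedModule)).
  - apply (is_derive_minus (V := R_NormedModule));
      [ | exact (is_derive_const (V := R_NormedModule) _ t)].
    apply (is_derive_scal (fun s => inner (f s) (f t)) t 2).
    apply (is_derive_linear_comp (fun x : H => inner x (f t) : R_NormedModule) f t l (is_linear_inner_l _) Hf).
  - destruct Hf as [_ Hf]. specialize (Hf t (fun P H => H)).
    split; [apply is_linear_scal_l | ].
    intros x Hx eps. replace x with t by (apply is_filter_lim_locally_unique; exact Hx). clear x Hx.
    (* Differentiability with tolerance 1 gives |f s - f t| <= C |s - t| near [t]; the radius eps /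
       C^2 then turns C^2 |s - t|^2 into eps |s - t|. *)
    set (C := norm l + 1).
    assert (HC : 0 < C) by (unfold C; assert (W := norm_ge_0 l); lra).
    destruct (Hf (mkposreal 1 Rlt_0_1)) as [d1 H1].
    assert (Hd : 0 < eps / (C * C)) by (apply Rdiv_lt_0_compat; [apply cond_pos | nra]).
    exists (mkposreal _ (Rmin_stable_in_posreal d1 (mkposreal _ Hd))). intros s Hs.
    assert (A1 := H1 s (Rlt_le_trans _ _ _ Hs (Rmin_l _ _))).
    assert (A2 : Rabs (s - t) < eps / (C * C)) by exact (Rlt_le_trans _ _ _ Hs (Rmin_r _ _)).
    change (Rabs (inner (minus (f s) (f t)) (minus (f s) (f t))
      - inner (minus (f t) (f t)) (minus (f t) (f t)) - (s - t) * 0) <= eps * Rabs (s - t)).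
    change (norm (minus (minus (f s) (f t)) (scal (s - t) l)) <= 1 * Rabs (s - t)) in A1.
    replace (inner (minus (f t) (f t)) (minus (f t) (f t))) with 0 by (inner_simpl; ring).
    rewrite inner_norm, Rmult_0_r, !Rminus_0_r.
    assert (A3 := norm_le_minus (minus (f s) (f t)) (scal (s - t) l)).
    rewrite norm_scal_eq in A3.
    assert (A4 : norm (minus (f s) (f t)) <= C * Rabs (s - t)) by (unfold C; lra).
    assert (N := norm_ge_0 (minus (f s) (f t))).
    rewrite Rabs_pos_eq by (apply pow2_ge_0).
    assert (N3 := Rabs_pos (s - t)).
    apply Rle_trans with ((C * Rabs (s - t)) ^ 2); [apply pow_incr; lra | ].
    apply Rle_trans with (C * C * Rabs (s - t) * Rabs (s - t)); [right; ring | ].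
    apply Rmult_le_compat_r; [exact N3 | ].
    apply Rle_trans with (C * C * (eps / (C * C))); [ | right; field; lra].
    apply Rmult_le_compat_l; nra.
Qed.

(** ** Delay integrals *)

(** Nonnegative delays keep the memory causal. Strict positivity away from s = 0 is what makes the
    exponentially weighted memory small for large weights. *)
Record is_delay (d : R -> R) (b : R) : Prop := {
  delay_length : 0 <= b;
  delay_continuous : forall s, continuous d s;
  delay_pos : forall s, 0 <= d s;
  delay_pos_strict : forall s, 0 < s -> 0 < d s
}.

(** [int_0^b f (t - d s) ds].  For [d s = s^(1/a)] this is, up to the factor
    [a], the convolution of [f] with the singular kernel [t^(a-1)]. *)
Definition delay_int {V : CompleteNormedModule R_AbsRing} (d : R -> R) (b : R)
  (f : R -> V) (t : R) : V := RInt (fun s => f (t - d s)) 0 b.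

Lemma is_derive_eps (f : R -> R) (t l : R) :
  is_derive f t l <->
  (forall eps, 0 < eps -> exists delta : posreal,
     forall h, h <> 0 -> Rabs h < delta -> Rabs (f (t + h) - f t - h * l) <= eps * Rabs h).
Proof.
  rewrite is_derive_Reals. unfold derivable_pt_lim. split; intros Hf eps Heps.
  - destruct (Hf eps Heps) as [d Hd]. exists d. intros h Hh Hh2.
    specialize (Hd h Hh Hh2).
    replace (f (t + h) - f t - h * l) with (((f (t + h) - f t) / h - l) * h) by (field; exact Hh).
    rewrite Rabs_mult. apply Rmult_le_compat_r; [apply Rabs_pos | lra].
  - destruct (Hf (eps / 2) ltac:(lra)) as [d Hd]. exists d. intros h Hh Hh2.
    specialize (Hd h Hh Hh2).
    replace ((f (t + h) - f t) / h - l) with ((f (t + h) - f t - h * l) / h) by (field; exact Hh).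
    unfold Rdiv. rewrite Rabs_mult, Rabs_inv.
    assert (P := Rabs_pos_lt h Hh).
    apply Rle_lt_trans with (eps / 2 * Rabs h * / Rabs h).
    + apply Rmult_le_compat_r; [ | exact Hd]. left. apply Rinv_0_lt_compat, P.
    + replace (eps / 2 * Rabs h * / Rabs h) with (eps / 2) by (field; lra). lra.
Qed.

Lemma continuous_shift {V : NormedModule R_AbsRing} (f : R -> V) (c t : R) :
  (forall x, continuous f x) -> continuous (fun s => f (s - c)) t.
Proof.
  intros Hf. apply (continuous_comp (fun s => s - c) f); [ | apply Hf].
  apply (continuous_minus (V := R_NormedModule)); [apply continuous_id | apply continuous_const].
Qed.

Section Delay.

Context {V : CompleteNormedModule R_AbsRing} (d : R -> R) (b : R) (Hd : is_delay d b).

Lemma delay_integrand_continuous (f : R -> V) (t s : R) :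
  (forall x, continuous f x) -> continuous (fun s => f (t - d s)) s.
Proof.
  intros Hf. apply (continuous_comp (fun s => t - d s) f); [ | apply Hf].
  apply (continuous_minus (V := R_NormedModule)); [apply continuous_const | ].
  apply (delay_continuous _ _ Hd).
Qed.

Lemma is_RInt_delay (f : R -> V) (t : R) :
  (forall x, continuous f x) -> is_RInt (fun s => f (t - d s)) 0 b (delay_int d b f t).
Proof.
  intros Hf. apply (RInt_correct (V := V)). apply (ex_RInt_continuous (V := V)).
  intros s _. apply delay_integrand_continuous, Hf.
Qed.

Lemma delay_bounded : exists D, forall s, 0 <= s <= b -> d s <= D.
Proof.
  destruct (continuity_ab_maj d 0 b (delay_length _ _ Hd)) as [x [Hx _]].
  - intros s _. apply continuity_pt_filterlim. apply (delay_continuous _ _ Hd).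
  - exists (d x). exact Hx.
Qed.

Lemma delay_uniform (f : R -> V) (t : R) :
  (forall x, continuous f x) ->
  forall eps, 0 < eps -> exists delta : posreal, forall h, Rabs h < delta ->
    forall s, 0 <= s <= b -> norm (minus (f (t + h - d s)) (f (t - d s))) < eps.
Proof.
  intros Hf eps Heps. destruct delay_bounded as [D HD].
  (* This compact interval contains every t + h - d s with |h| < 1 and 0 <= s <= b. *)
  destruct (unifcont_normed_1d f (t - D - 1) (t + 1) (fun x _ => Hf x) (mkposreal _ Heps))
    as [delta Hdelta].
  exists (mkposreal _ (Rmin_stable_in_posreal delta (mkposreal 1 Rlt_0_1))).
  intros h Hh s Hs. simpl in Hh.
  assert (H1 := Rlt_le_trans _ _ _ Hh (Rmin_l _ _)).
  assert (H2 := Rlt_le_trans _ _ _ Hh (Rmin_r _ _)).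
  apply Rabs_lt_between in H2. assert (P := delay_pos _ _ Hd s). assert (Q := HD s Hs).
  apply Hdelta.
  - lra.
  - lra.
  - change (Rabs (t + h - d s - (t - d s)) < delta).
    replace (t + h - d s - (t - d s)) with h by ring. exact H1.
Qed.

Lemma delay_int_continuous (f : R -> V) (t : R) :
  (forall x, continuous f x) -> continuous (delay_int d b f) t.
Proof.
  intros Hf. refine (proj2 (filterlim_locally_ball_norm (delay_int d b f) _) _). intros eps.
  assert (Hb := delay_length _ _ Hd).
  assert (He : 0 < eps / (b + 1)) by (apply Rdiv_lt_0_compat; [apply cond_pos | lra]).
  destruct (delay_uniform f t Hf _ He) as [delta Hdelta].
  exists delta. intros u Hu. unfold ball_norm.
  apply Rle_lt_trans with ((b - 0) * (eps / (b + 1))).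
  - apply (norm_RInt_le_const (fun s => minus (f (u - d s)) (f (t - d s))) 0 b); [exact Hb | | ].
    + intros s Hs. left. replace u with (t + (u - t)) by ring. apply Hdelta; [exact Hu | exact Hs].
    + apply (is_RInt_minus (V := V)); apply is_RInt_delay, Hf.
  - assert (P := cond_pos eps). apply Rmult_lt_reg_r with (b + 1); [lra | ].
    replace ((b - 0) * (eps / (b + 1)) * (b + 1)) with (b * eps) by (field; lra). nra.
Qed.

Lemma delay_int_ext (f g : R -> V) (t : R) :
  (forall s, s <= t -> f s = g s) -> delay_int d b f t = delay_int d b g t.
Proof.
  intros E. apply (RInt_ext (V := V)). intros s _. apply E.
  assert (P := delay_pos _ _ Hd s). lra.
Qed.

Lemma delay_int_zero (f : R -> V) (t : R) :
  (forall s, s <= t -> f s = zero) -> delay_int d b f t = zero.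
Proof.
  intros E. rewrite (delay_int_ext f (fun _ => zero) t E). unfold delay_int.
  rewrite (RInt_const (V := V)).
  exact (@scal_zero_r R_Ring V (b - 0)).
Qed.

Lemma delay_int_minus (f g : R -> V) (t : R) :
  (forall x, continuous f x) -> (forall x, continuous g x) ->
  delay_int d b (fun s => minus (f s) (g s)) t = minus (delay_int d b f t) (delay_int d b g t).
Proof.
  intros Hf Hg. apply (is_RInt_unique (V := V)).
  apply (is_RInt_minus (V := V)); apply is_RInt_delay; assumption.
Qed.

End Delay.

Lemma delay_int_shift {V : CompleteNormedModule R_AbsRing} (d : R -> R) (b h : R) (f : R -> V) (t : R) :
  delay_int d b (fun s => f (s - h)) t = delay_int d b f (t - h).
Proof.
  apply (RInt_ext (V := V)). intros s _. f_equal. ring.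
Qed.

Lemma delay_int_linear {V W : CompleteNormedModule R_AbsRing} (L : V -> W) (d : R -> R) (b : R)
  (Hd : is_delay d b) (f : R -> V) (t : R) :
  is_linear L -> (forall x, continuous f x) ->
  delay_int d b (fun s => L (f s)) t = L (delay_int d b f t).
Proof.
  intros HL Hf. apply (is_RInt_unique (V := W)).
  apply (is_RInt_linear_comp L _ 0 b _ HL). apply is_RInt_delay; assumption.
Qed.

Lemma delay_int_norm_le {V : CompleteNormedModule R_AbsRing} (d : R -> R) (b : R) (Hd : is_delay d b)
  (f : R -> V) (g : R -> R) (t : R) :
  (forall x, continuous f x) -> (forall x, continuous g x) ->
  (forall s, s <= t -> norm (f s) <= g s) ->
  norm (delay_int d b f t) <= delay_int d b g t.
Proof.
  intros Hf Hg Hfg. assert (Hb := delay_length _ _ Hd).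
  apply (norm_RInt_le (fun s => f (t - d s)) (fun s => g (t - d s)) 0 b); [exact Hb | | | ].
  - intros s _. apply Hfg. assert (P := delay_pos _ _ Hd s). lra.
  - apply is_RInt_delay; assumption.
  - apply (is_RInt_delay (V := R_CompleteNormedModule)); assumption.
Qed.

(** Differentiation under the integral: the mean value theorem replaces each increment of [F] by h
    f(c) with c within |h| of t - d s, and [delay_uniform] makes f(c) - f(t - d s) small uniformly
    in s. *)
Lemma delay_int_derive (d : R -> R) (b : R) (Hd : is_delay d b) (F f : R -> R) (t : R) :
  (forall x, is_derive F x (f x)) -> (forall x, continuous f x) ->
  is_derive (delay_int (V := R_CompleteNormedModule) d b F) t
    (delay_int (V := R_CompleteNormedModule) d b f t).
Proof.
  intros HF Hf. apply is_derive_eps. intros eps Heps.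
  assert (HFc : forall x, continuous F x).
  { intros x. apply (ex_derive_continuous (V := R_NormedModule)). exists (f x). apply HF. }
  assert (Hb := delay_length _ _ Hd).
  assert (He : 0 < eps / (b + 1)) by (apply Rdiv_lt_0_compat; lra).
  destruct (delay_uniform (V := R_CompleteNormedModule) d b Hd f t Hf _ He) as [delta Hdelta].
  exists delta. intros h Hh0 Hh.
  apply Rle_trans with ((b - 0) * (eps / (b + 1) * Rabs h)).
  - apply (norm_RInt_le_const (V := R_NormedModule)
      (fun s => F (t + h - d s) - F (t - d s) - h * f (t - d s)) 0 b); [exact Hb | | ].
    + intros s Hs.
      destruct (MVT_gen F (t - d s) (t + h - d s) f) as [c [Hc E]].
      * intros x _. apply HF.
      * intros x _. apply continuity_pt_filterlim, HFc.
      * change (Rabs (F (t + h - d s) - F (t - d s) - h * f (t - d s)) <= eps / (b + 1) * Rabs h).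
        rewrite E.
        replace (f c * (t + h - d s - (t - d s)) - h * f (t - d s)) with
          ((f c - f (t - d s)) * h) by ring.
        rewrite Rabs_mult. apply Rmult_le_compat_r; [apply Rabs_pos | ]. left.
        assert (W := Hdelta (c - (t - d s))).
        specialize (W ltac:(revert Hc Hh; unfold Rmin, Rmax, Rabs;
          repeat destruct Rle_dec; repeat destruct Rcase_abs; lra) s Hs).
        replace (t + (c - (t - d s)) - d s) with c in W by ring. exact W.
    + apply (is_RInt_minus (V := R_NormedModule)).
      * apply (is_RInt_minus (V := R_NormedModule));
          apply (is_RInt_delay (V := R_CompleteNormedModule)); assumption.
      * apply (is_RInt_scal (V := R_NormedModule)).
        apply (is_RInt_delay (V := R_CompleteNormedModule)); assumption.
  - assert (P := Rabs_pos h). rewrite <- Rmult_assoc. apply Rmult_le_compat_r; [exact P | ].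
    apply Rmult_le_reg_r with (b + 1); [lra | ].
    replace ((b - 0) * (eps / (b + 1)) * (b + 1)) with (b * eps) by (field; lra). nra.
Qed.

(** * Exponential damping of delay integrals *)

Definition damping (d : R -> R) (b lam : R) : R := RInt (fun s => exp (- lam * d s)) 0 b.

Lemma exp_continuous (c x : R) : continuous (fun s => exp (c * s)) x.
Proof.
  apply (ex_derive_continuous (V := R_NormedModule)). auto_derive. trivial.
Qed.

Lemma is_RInt_damping (d : R -> R) (b lam : R) (Hd : is_delay d b) :
  is_RInt (fun s => exp (- lam * d s)) 0 b (damping d b lam).
Proof.
  apply (RInt_correct (V := R_CompleteNormedModule)).
  apply (ex_RInt_continuous (V := R_CompleteNormedModule)). intros s _.
  apply (continuous_comp d (fun x => exp (- lam * x))).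
  - apply (delay_continuous _ _ Hd).
  - apply exp_continuous.
Qed.

Lemma damping_ge_0 (d : R -> R) (b lam : R) (Hd : is_delay d b) : 0 <= damping d b lam.
Proof.
  apply RInt_ge_0.
  - apply (delay_length _ _ Hd).
  - eexists. apply is_RInt_damping, Hd.
  - intros s _. left. apply exp_pos.
Qed.

(** Exponentials are eigenfunctions of a delay integral. For d s = s^(1/a) and b = T^a the
    eigenvalue is, up to the factor a, the Laplace transform of r^(a-1) truncated at T. *)
Lemma delay_int_exp (d : R -> R) (b lam C t : R) (Hd : is_delay d b) :
  delay_int (V := R_CompleteNormedModule) d b (fun s => C * exp (lam * s)) t
  = C * exp (lam * t) * damping d b lam.
Proof.
  apply (is_RInt_unique (V := R_CompleteNormedModule)).
  apply (is_RInt_ext (V := R_NormedModule) (fun s => scal (C * exp (lam * t)) (exp (- lam * d s)))).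
  - intros s _. change (C * exp (lam * t) * exp (- lam * d s) = C * exp (lam * (t - d s))).
    rewrite Rmult_assoc, <- exp_plus. do 2 f_equal. ring.
  - apply (is_RInt_scal (V := R_NormedModule)). apply is_RInt_damping, Hd.
Qed.

(** On [0, eps/2] the integrand is at most 1. On the rest [d] has a positive minimum, and exp(-y) <=
    1/y takes over. *)
Lemma damping_small (d : R -> R) (b : R) (Hd : is_delay d b) (eps : R) :
  0 < eps -> exists lam0, 0 <= lam0 /\ forall lam, lam0 <= lam -> damping d b lam <= eps.
Proof.
  intros Heps. assert (Hb := delay_length _ _ Hd).
  assert (Hle1 : forall lam s, 0 <= lam -> exp (- lam * d s) <= 1).
  { intros lam s Hl. rewrite <- exp_0. assert (P := delay_pos _ _ Hd s).
    destruct (Req_dec (- lam * d s) 0) as [E | E]; [rewrite E; lra | ].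
    left. apply exp_increasing. nra. }
  destruct (Rle_dec b (eps / 2)) as [Hbe | Hbe].
  - exists 0. split; [lra | intros lam Hl].
    apply Rle_trans with (RInt (fun _ => 1) 0 b).
    + apply RInt_le; [exact Hb | eexists; apply is_RInt_damping, Hd | apply ex_RInt_const | ].
      intros s _. apply Hle1, Hl.
    + rewrite RInt_const. change ((b - 0) * 1 <= eps). lra.
  - set (e := eps / 2) in *.
    destruct (continuity_ab_min d e b ltac:(lra)) as [x [Hx Hx2]].
    { intros c _. apply continuity_pt_filterlim, (delay_continuous _ _ Hd). }
    assert (Pd := delay_pos_strict _ _ Hd x ltac:(unfold e in *; lra)).
    (* [d x] is the minimum of [d] on [e, b]; from this [lam] on, the bound (b - e) / (lam * d x)
       for the second piece is at most e. *)
    exists (b / (e * d x)).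
    assert (Pe : 0 < e) by (unfold e; lra).
    assert (Pl : 0 <= b / (e * d x)).
    { apply Rmult_le_pos; [lra | ]. left. apply Rinv_0_lt_compat. nra. }
    split; [exact Pl | intros lam Hl].
    assert (W := is_RInt_damping d b lam Hd).
    assert (Ex : forall u v, 0 <= u <= b -> 0 <= v <= b -> ex_RInt (fun s => exp (- lam * d s)) u v).
    { intros u v Hu Hv. apply (ex_RInt_continuous (V := R_CompleteNormedModule)). intros s _.
      apply (continuous_comp d (fun x => exp (- lam * x)));
        [apply (delay_continuous _ _ Hd) | apply exp_continuous]. }
    unfold damping.
    rewrite <- (RInt_Chasles (V := R_CompleteNormedModule) _ 0 e b) by (apply Ex; lra).
    assert (I1 : RInt (fun s => exp (- lam * d s)) 0 e <= e).
    { apply Rle_trans with (RInt (fun _ => 1) 0 e).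
      + apply RInt_le; [lra | apply Ex; lra | apply ex_RInt_const | ].
        intros s _. apply Hle1. lra.
      + rewrite RInt_const. change ((e - 0) * 1 <= e). lra. }
    assert (I2 : RInt (fun s => exp (- lam * d s)) e b <= e).
    { assert (Hbl : b <= lam * d x * e).
      { apply Rmult_le_compat_r with (r := e * d x) in Hl; [ | nra].
        replace (b / (e * d x) * (e * d x)) with b in Hl by (field; nra). lra. }
      assert (Hlx : 0 < lam * d x) by nra.
      apply Rle_trans with (RInt (fun _ => / (lam * d x)) e b).
      + apply RInt_le; [lra | apply Ex; lra | apply ex_RInt_const | ].
        intros s Hs. replace (- lam * d s) with (- (lam * d s)) by ring. rewrite exp_Ropp.
        apply Rinv_le_contravar; [exact Hlx | ].
        assert (Q := Hx s ltac:(lra)). assert (Q2 := exp_ineq1_le (lam * d s)). nra.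
      + rewrite RInt_const. change ((b - e) * / (lam * d x) <= e).
        apply Rmult_le_reg_r with (lam * d x); [exact Hlx | ].
        rewrite Rmult_assoc, Rinv_l by lra. nra. }
    change (RInt (fun s => exp (- lam * d s)) 0 e + RInt (fun s => exp (- lam * d s)) e b <= eps).
    unfold e in *. lra.
Qed.

Lemma damping_sum_small (m : nat) (d : nat -> R -> R) (b C : nat -> R) (eps : R) :
  (forall j, (1 <= j <= m)%nat -> is_delay (d j) (b j)) -> 0 < eps ->
  exists lam0, 0 <= lam0 /\ forall lam, lam0 <= lam ->
    sum_n_m (fun j => C j * damping (d j) (b j) lam) 1 m <= eps.
Proof.
  revert eps. induction m as [ | m IH]; intros eps Hd Heps.
  - exists 0. split; [lra | intros lam _]. rewrite sum_n_m_zero by lia.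
    change (0 <= eps). lra.
  - destruct (IH (eps / 2)) as [l1 [P1 H1]]; [intros j Hj; apply Hd; lia | lra | ].
    assert (Q := Rabs_pos (C (S m))).
    assert (Qe : 0 < eps / 2 / (Rabs (C (S m)) + 1)) by (apply Rdiv_lt_0_compat; lra).
    destruct (damping_small (d (S m)) (b (S m)) (Hd (S m) ltac:(lia)) _ Qe) as [l2 [P2 H2]].
    exists (Rmax l1 l2). split; [eapply Rle_trans; [exact P1 | apply Rmax_l] | intros lam Hl].
    rewrite sum_n_Sm by lia.
    assert (R1 := H1 lam (Rle_trans _ _ _ (Rmax_l _ _) Hl)).
    assert (R2 := H2 lam (Rle_trans _ _ _ (Rmax_r _ _) Hl)).
    assert (R3 := damping_ge_0 (d (S m)) (b (S m)) lam (Hd (S m) ltac:(lia))).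
    change (sum_n_m (fun j => C j * damping (d j) (b j) lam) 1 m
      + C (S m) * damping (d (S m)) (b (S m)) lam <= eps).
    assert (R4 : C (S m) * damping (d (S m)) (b (S m)) lam <= eps / 2).
    { apply Rle_trans with ((Rabs (C (S m)) + 1) * (eps / 2 / (Rabs (C (S m)) + 1))).
      - assert (R5 := Rle_abs (C (S m))). nra.
      - right. field. lra. }
    lra.
Qed.

(** ** Finite sums *)

Lemma continuous_sum_n_m {V : NormedModule R_AbsRing} (f : nat -> R -> V) (n m : nat) (t : R) :
  (forall j, (n <= j <= m)%nat -> continuous (f j) t) ->
  continuous (fun s => sum_n_m (fun j => f j s) n m) t.
Proof.
  destruct (Nat.le_gt_cases n m) as [Hnm | Hnm].
  - induction Hnm as [ | m Hnm IH]; intros Hf.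
    + apply (continuous_ext (f n)); [intros s; rewrite sum_n_n; reflexivity | apply Hf; lia].
    + apply (continuous_ext (fun s => plus (sum_n_m (fun j => f j s) n m) (f (S m) s))).
      * intros s. rewrite sum_n_Sm by lia. reflexivity.
      * apply (continuous_plus (V := V)); [apply IH; intros; apply Hf; lia | apply Hf; lia].
  - intros _. apply (continuous_ext (fun _ => zero : V)).
    + intros s. rewrite sum_n_m_zero by lia. reflexivity.
    + apply continuous_const.
Qed.

Lemma is_derive_sum_n_m (f f' : nat -> R -> R) (n m : nat) (t : R) :
  (forall j, (n <= j <= m)%nat -> is_derive (f j) t (f' j t)) ->
  is_derive (fun s => sum_n_m (fun j => f j s) n m : R) t (sum_n_m (fun j => f' j t) n m).
Proof.
  destruct (Nat.le_gt_cases n m) as [Hnm | Hnm].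
  - induction Hnm as [ | m Hnm IH]; intros Hf.
    + rewrite sum_n_n. apply (is_derive_ext (f n)); [ | apply Hf; lia].
      intros s. rewrite sum_n_n. reflexivity.
    + rewrite sum_n_Sm by lia.
      apply (is_derive_ext (fun s => plus (sum_n_m (fun j => f j s) n m) (f (S m) s))).
      * intros s. rewrite sum_n_Sm by lia. reflexivity.
      * apply (is_derive_plus (V := R_NormedModule)); [apply IH; intros; apply Hf; lia | apply Hf; lia].
  - intros _. rewrite sum_n_m_zero by lia. apply (is_derive_ext (fun _ => zero : R)).
    + intros s. rewrite sum_n_m_zero by lia. reflexivity.
    + exact (is_derive_const (V := R_NormedModule) (zero : R) t).
Qed.

Lemma sum_n_m_linear {V W : NormedModule R_AbsRing} (L : V -> W) (u : nat -> V) (n m : nat) :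
  is_linear L -> L (sum_n_m u n m) = sum_n_m (fun j => L (u j)) n m.
Proof.
  intros HL. destruct (Nat.le_gt_cases n m) as [Hnm | Hnm].
  - induction Hnm as [ | m Hnm IH]; [rewrite !sum_n_n; reflexivity | ].
    rewrite !sum_n_Sm by lia. rewrite (linear_plus _ HL), IH. reflexivity.
  - rewrite !sum_n_m_zero by lia. apply (linear_zero _ HL).
Qed.

Lemma inner_sum_n_m {H : HilbertSpace} (u : nat -> H) (w : H) (n m : nat) :
  inner (sum_n_m u n m) w = sum_n_m (fun j => inner (u j) w) n m.
Proof. exact (sum_n_m_linear _ u n m (is_linear_inner_l w)). Qed.

Ltac inner_sums := repeat
  match goal with |- context [?t] =>
  lazymatch t with
  | @inner ?H (sum_n_m ?u ?n ?k) ?w => rewrite (@inner_sum_n_m H u w n k : t = _)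
  end end.

Lemma sum_n_m_minus {H : HilbertSpace} (u v : nat -> H) (n m : nat) :
  sum_n_m (fun j => minus (u j) (v j)) n m = minus (sum_n_m u n m) (sum_n_m v n m).
Proof.
  apply inner_ext. intros w. inner_simpl. inner_sums.
  destruct (Nat.le_gt_cases n m) as [Hnm | Hnm].
  - induction Hnm as [ | m Hnm IH]; [rewrite !sum_n_n; apply inner_minus_l | ].
    rewrite !sum_n_Sm by lia. rewrite IH.
    change (sum_n_m (fun j => inner (u j) w) n m - sum_n_m (fun j => inner (v j) w) n m +
      inner (minus (u (S m)) (v (S m))) w =
      (sum_n_m (fun j => inner (u j) w) n m + inner (u (S m)) w) -
      (sum_n_m (fun j => inner (v j) w) n m + inner (v (S m)) w)).
    inner_simpl. ring.
  - rewrite !sum_n_m_zero by lia. change (0 = 0 - 0). ring.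
Qed.

Lemma sum_n_m_le_loc (u v : nat -> R) (n m : nat) :
  (forall j, (n <= j <= m)%nat -> u j <= v j) -> sum_n_m u n m <= sum_n_m v n m.
Proof.
  destruct (Nat.le_gt_cases n m) as [Hnm | Hnm].
  - induction Hnm as [ | m Hnm IH]; intros E; [rewrite !sum_n_n; apply E; lia | ].
    rewrite !sum_n_Sm by lia. apply Rplus_le_compat; [apply IH; intros; apply E; lia | apply E; lia].
  - intros _. rewrite !sum_n_m_zero by lia. apply Rle_refl.
Qed.

Lemma norm_sum_n_m_le {H : HilbertSpace} (u : nat -> H) (v : nat -> R) (n m : nat) :
  (forall j, (n <= j <= m)%nat -> norm (u j) <= v j) -> norm (sum_n_m u n m) <= sum_n_m v n m.
Proof.
  intros E. eapply Rle_trans; [exact (norm_sum_n_m (V := H) u n m) | ].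
  apply sum_n_m_le_loc, E.
Qed.

(** ** A weighted maximum principle *)

Lemma continuous_exp_mult (lam : R) (f : R -> R) (t : R) :
  continuous f t -> continuous (fun s => exp (lam * s) * f s) t.
Proof.
  intros Hf. apply (continuous_mult (K := R_AbsRing)); [apply exp_continuous | exact Hf].
Qed.

Lemma continuous_norm_comp {H : HilbertSpace} (f : R -> H) (t : R) :
  continuous f t -> continuous (fun s => norm (f s)) t.
Proof. intros Hf. apply (continuous_comp f norm); [exact Hf | exact (@filterlim_norm R_AbsRing H (f t))]. Qed.

Lemma weighted_max (phi : R -> R) (lam T : R) :
  (forall t, continuous phi t) -> 0 <= T ->
  exists s0, 0 <= s0 <= T /\
    forall s, 0 <= s <= T -> exp (- lam * s) * phi s <= exp (- lam * s0) * phi s0.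
Proof.
  intros Hc HT.
  destruct (continuity_ab_maj (fun s => exp (- lam * s) * phi s) 0 T HT) as [s0 [H1 H2]].
  - intros c _. apply continuity_pt_filterlim. apply continuous_exp_mult, Hc.
  - exists s0. split; assumption.
Qed.

Lemma weighted_absorb (phi : R -> R) (lam T a : R) :
  (forall t, continuous phi t) -> (forall t, 0 <= phi t) -> (forall t, t <= 0 -> phi t = 0) ->
  0 <= a -> 0 <= T ->
  (forall N, 0 <= N -> (forall s, s <= T -> phi s <= N * exp (lam * s)) ->
     forall s, s <= T -> phi s <= (a + N / 2) * exp (lam * s)) ->
  forall s, s <= T -> phi s <= 2 * a * exp (lam * s).
Proof.
  intros Hc Hpos H0 Ha HT Habs.
  destruct (weighted_max phi lam T Hc HT) as [s0 [Hs0 Hmax]].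
  set (N := exp (- lam * s0) * phi s0) in *.
  assert (EE : forall s, exp (- lam * s) * exp (lam * s) = 1).
  { intros s. rewrite <- exp_plus. replace (- lam * s + lam * s) with 0 by ring. apply exp_0. }
  assert (HN : 0 <= N) by (apply Rmult_le_pos; [left; apply exp_pos | apply Hpos]).
  assert (B : forall s, s <= T -> phi s <= N * exp (lam * s)).
  { intros s Hs. assert (P := exp_pos (lam * s)).
    destruct (Rle_dec s 0) as [Hs2 | Hs2].
    - rewrite (H0 s Hs2). apply Rmult_le_pos; lra.
    - assert (W := Hmax s ltac:(lra)).
      replace (phi s) with (exp (- lam * s) * phi s * exp (lam * s)).
      + apply Rmult_le_compat_r; lra.
      + replace (exp (- lam * s) * phi s * exp (lam * s)) with
          (exp (- lam * s) * exp (lam * s) * phi s) by ring. rewrite EE. ring. }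
  assert (Q := Habs N HN B s0 ltac:(lra)).
  assert (Q2 : N <= a + N / 2).
  { unfold N at 1. replace (a + N / 2) with (exp (- lam * s0) * ((a + N / 2) * exp (lam * s0))).
    - apply Rmult_le_compat_l; [left; apply exp_pos | exact Q].
    - replace (exp (- lam * s0) * ((a + N / 2) * exp (lam * s0))) with
        (exp (- lam * s0) * exp (lam * s0) * (a + N / 2)) by ring. rewrite EE. ring. }
  intros s Hs. eapply Rle_trans; [apply B, Hs | ].
  apply Rmult_le_compat_r; [left; apply exp_pos | lra].
Qed.

(** ** Volterra equations with weakly singular operator kernels *)

(** The majorants are exponentials, so by [delay_int_exp] each delay integral only multiplies them
    by its damping factor. *)
Lemma sum_delay_weighted {H : HilbertSpace} (m : nat) (d : nat -> R -> R) (b C : nat -> R)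
  (l : nat -> R -> H) (lam N t : R) :
  (forall j, (1 <= j <= m)%nat -> is_delay (d j) (b j)) ->
  (forall j, (1 <= j <= m)%nat -> forall s, continuous (l j) s) ->
  (forall j, (1 <= j <= m)%nat -> forall s, s <= t -> norm (l j s) <= C j * (N * exp (lam * s))) ->
  norm (sum_n_m (fun j => delay_int (d j) (b j) (l j) t) 1 m) <=
    N * exp (lam * t) * sum_n_m (fun j => C j * damping (d j) (b j) lam) 1 m.
Proof.
  intros Hd Hc Hl.
  rewrite <- (sum_n_m_mult_l (K := R_Ring) (N * exp (lam * t))).
  apply norm_sum_n_m_le. intros j Hj.
  apply Rle_trans with (delay_int (V := R_CompleteNormedModule) (d j) (b j) (fun s => C j * N * exp (lam * s)) t).
  - apply (delay_int_norm_le (V := H)); [apply Hd, Hj | apply Hc, Hj | | ].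
    + intros x. apply (continuous_scal_r (K := R_AbsRing) (V := R_NormedModule)). apply exp_continuous.
    + intros s Hs. rewrite Rmult_assoc. apply Hl; assumption.
  - rewrite delay_int_exp by (apply Hd, Hj).
    right. change (C j * N * exp (lam * t) * damping (d j) (b j) lam =
      N * exp (lam * t) * (C j * damping (d j) (b j) lam)). ring.
Qed.

Section Volterra.

Context {H : HilbertSpace} (m : nat) (d : nat -> R -> R) (b : nat -> R)
  (M : nat -> H -> H) (CM : nat -> R)
  (Hd : forall j, (1 <= j <= m)%nat -> is_delay (d j) (b j))
  (HM : forall j, (1 <= j <= m)%nat -> is_linear (M j))
  (HCM : forall j, (1 <= j <= m)%nat -> forall x, norm (M j x) <= CM j * norm x).

(** For M_j = B_j K / (a_j Gamma(a_j)) and X = A w with w zero before time 0, this is, for t <= T,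
    the sum of the convolutions of omega_(a_j) with B_j w. *)
Definition memory (X : R -> H) (t : R) : H :=
  sum_n_m (fun j => delay_int (d j) (b j) (fun s => M j (X s)) t) 1 m.

Lemma memory_integrand_continuous (X : R -> H) j :
  (1 <= j <= m)%nat -> (forall t, continuous X t) -> forall t, continuous (fun s => M j (X s)) t.
Proof. intros Hj HX t. apply (continuous_linear_comp (V := H) (W := H)); [apply HM, Hj | apply HX]. Qed.

Lemma memory_continuous (X : R -> H) (t : R) :
  (forall t, continuous X t) -> continuous (memory X) t.
Proof.
  intros HX. unfold memory. apply (continuous_sum_n_m (V := H)). intros j Hj.
  apply (delay_int_continuous (V := H)); [apply Hd, Hj | apply memory_integrand_continuous; assumption].
Qed.

Lemma memory_zero (X : R -> H) (t : R) :
  (forall s, s <= t -> X s = zero) -> memory X t = zero.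
Proof.
  intros E. unfold memory. rewrite (sum_n_m_ext_loc _ (fun _ => zero)).
  - apply sum_n_m_const_zero.
  - intros j Hj. apply delay_int_zero; [apply Hd, Hj | ].
    intros s Hs. rewrite E by exact Hs. apply (linear_zero _ (HM j Hj)).
Qed.

Lemma memory_minus (X Y : R -> H) (t : R) :
  (forall t, continuous X t) -> (forall t, continuous Y t) ->
  memory (fun s => minus (X s) (Y s)) t = minus (memory X t) (memory Y t).
Proof.
  intros HX HY. unfold memory. rewrite <- sum_n_m_minus.
  apply sum_n_m_ext_loc. intros j Hj.
  rewrite <- delay_int_minus; try apply Hd, Hj; try (apply memory_integrand_continuous; assumption).
  apply delay_int_ext; [apply Hd, Hj | ].
  intros s _. apply (linear_minus _ _ _ (HM j Hj)).
Qed.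

Lemma memory_shift (X : R -> H) (h t : R) :
  memory (fun s => X (s - h)) t = memory X (t - h).
Proof.
  apply sum_n_m_ext_loc. intros j _.
  apply (delay_int_shift (d j) (b j) h (fun s => M j (X s)) t).
Qed.

Lemma memory_weighted (X : R -> H) (lam N t : R) :
  (forall t, continuous X t) ->
  (forall j, (1 <= j <= m)%nat -> 0 <= CM j) ->
  (forall s, s <= t -> norm (X s) <= N * exp (lam * s)) ->
  norm (memory X t) <= N * exp (lam * t) * sum_n_m (fun j => CM j * damping (d j) (b j) lam) 1 m.
Proof.
  intros HX HC HN. apply sum_delay_weighted; [exact Hd | | ].
  - intros j Hj. apply memory_integrand_continuous; assumption.
  - intros j Hj s Hs. eapply Rle_trans; [apply HCM, Hj | ].
    apply Rmult_le_compat_l; [apply HC, Hj | apply HN, Hs].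
Qed.

Context (HC : forall j, (1 <= j <= m)%nat -> 0 <= CM j)
  (lam : R) (Hlam : 0 <= lam)
  (Hsmall : sum_n_m (fun j => CM j * damping (d j) (b j) lam) 1 m <= / 2).

(** In the norm sup exp(-lam s) |X s| the memory operator is a contraction of factor 1/2; [Hsmall]
    is the choice of [lam] that achieves this. *)
Lemma memory_contracts (X : R -> H) (N t : R) :
  (forall t, continuous X t) -> 0 <= N ->
  (forall s, s <= t -> norm (X s) <= N * exp (lam * s)) ->
  norm (memory X t) <= N / 2 * exp (lam * t).
Proof.
  intros HX HN HXN. eapply Rle_trans; [apply (memory_weighted X lam N t HX HC HXN) | ].
  assert (P := exp_pos (lam * t)).
  apply Rle_trans with (N * exp (lam * t) * / 2); [ | right; field].
  apply Rmult_le_compat_l; [nra | exact Hsmall].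
Qed.

Lemma volterra_bound (X : R -> H) (a T : R) :
  (forall t, continuous X t) -> (forall t, t <= 0 -> X t = zero) -> 0 <= a -> 0 <= T ->
  (forall t, t <= T -> norm (plus (X t) (memory X t)) <= a) ->
  forall t, t <= T -> norm (X t) <= 2 * a * exp (lam * t).
Proof.
  intros HX HX0 Ha HT Heq.
  apply (weighted_absorb (fun t => norm (X t)) lam T a); try assumption.
  - intros t. apply continuous_norm_comp, HX.
  - intros t. exact (norm_ge_0 (X t)).
  - intros t Ht. rewrite (HX0 t Ht). exact (@norm_zero R_AbsRing H).
  - intros N HN HXN s Hs.
    destruct (Rle_dec s 0) as [Hs0 | Hs0].
    { rewrite (HX0 s Hs0). apply Rle_trans with 0; [right; exact (@norm_zero R_AbsRing H) | ].
      assert (P := exp_pos (lam * s)). apply Rmult_le_pos; lra. }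
    assert (Q := memory_contracts X N s HX HN (fun r Hr => HXN r (Rle_trans _ _ _ Hr Hs))).
    assert (Q2 := Heq s Hs).
    assert (Q3 := norm_minus_le (plus (X s) (memory X s)) (memory X s)).
    replace (minus (plus (X s) (memory X s)) (memory X s)) with (X s) in Q3 by hilbert_ring.
    (* The bound [a] carries no weight; replacing it by a exp(lam s) is allowed here since s > 0,
       and X vanishes for s <= 0. *)
    assert (P : 1 <= exp (lam * s)).
    { rewrite <- exp_0. destruct (Req_dec (lam * s) 0) as [E | E]; [rewrite E; lra | ].
      left. apply exp_increasing. nra. }
    nra.
Qed.

Fixpoint picard (Theta : R -> H) (n : nat) (t : R) : H :=
  match n with
  | O => zero
  | S n => minus (Theta t) (memory (picard Theta n) t)
  end.

Lemma picard_continuous (Theta : R -> H) (n : nat) :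
  (forall t, continuous Theta t) -> forall t, continuous (picard Theta n) t.
Proof.
  intros HT. induction n as [ | n IH]; intros t; simpl.
  - apply continuous_const.
  - apply (continuous_minus (V := H)); [apply HT | apply memory_continuous, IH].
Qed.

Lemma picard_zero (Theta : R -> H) (n : nat) :
  (forall t, t <= 0 -> Theta t = zero) -> forall t, t <= 0 -> picard Theta n t = zero.
Proof.
  intros HT. induction n as [ | n IH]; intros t Ht; simpl; [reflexivity | ].
  rewrite HT by exact Ht. rewrite memory_zero by (intros s Hs; apply IH; lra).
  hilbert_ring.
Qed.

Lemma picard_step (Theta : R -> H) (N : R) (n : nat) :
  (forall t, continuous Theta t) -> 0 <= N ->
  (forall t, norm (Theta t) <= N * exp (lam * t)) ->
  forall t, norm (minus (picard Theta (S n) t) (picard Theta n t)) <= N * (/ 2) ^ n * exp (lam * t).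
Proof.
  intros HT HN HB. induction n as [ | n IH]; intros t.
  - simpl. rewrite memory_zero by reflexivity.
    rewrite Rmult_1_r.
    match goal with |- norm ?x <= _ => replace x with (Theta t) by hilbert_ring end. apply HB.
  - change (norm (minus (minus (Theta t) (memory (picard Theta (S n)) t))
      (minus (Theta t) (memory (picard Theta n) t))) <= N * (/ 2) ^ S n * exp (lam * t)).
    replace (minus (minus (Theta t) (memory (picard Theta (S n)) t))
      (minus (Theta t) (memory (picard Theta n) t))) with
      (opp (minus (memory (picard Theta (S n)) t) (memory (picard Theta n) t))) by hilbert_ring.
    rewrite (@norm_opp R_AbsRing H), <- memory_minus by (intros; apply picard_continuous, HT).
    eapply Rle_trans.
    + apply (memory_contracts _ (N * (/ 2) ^ n)).
      * intros s. apply (continuous_minus (V := H)); apply picard_continuous, HT.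
      * apply Rmult_le_pos; [exact HN | apply pow_le; lra].
      * intros s _. apply IH.
    + right. simpl. field.
Qed.

(** The geometric series of [picard_step] summed exactly: keeping the term (/2)^p is what lets the
    induction on [p] close. *)
Lemma picard_diff (Theta : R -> H) (N : R) (n p : nat) :
  (forall t, continuous Theta t) -> 0 <= N ->
  (forall t, norm (Theta t) <= N * exp (lam * t)) -> (n <= p)%nat ->
  forall t, norm (minus (picard Theta p t) (picard Theta n t)) <=
    2 * N * ((/ 2) ^ n - (/ 2) ^ p) * exp (lam * t).
Proof.
  intros HT HN HB Hnp t. induction Hnp as [ | p Hnp IH].
  - replace (minus (picard Theta n t) (picard Theta n t)) with (zero : H) by hilbert_ring.
    right. replace (norm (zero : H)) with 0 by (symmetry; exact (@norm_zero R_AbsRing H)). ring.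
  - eapply Rle_trans; [apply (norm_minus_triangle _ (picard Theta p t)) | ].
    assert (Q := picard_step Theta N p HT HN HB t). simpl pow in *. lra.
Qed.

Lemma volterra_solution (Theta : R -> H) (N : R) :
  (forall t, continuous Theta t) -> 0 <= N ->
  (forall t, norm (Theta t) <= N * exp (lam * t)) ->
  (forall t, t <= 0 -> Theta t = zero) ->
  exists Z : R -> H, (forall t, continuous Z t) /\ (forall t, t <= 0 -> Z t = zero) /\
    forall t, plus (Z t) (memory Z t) = Theta t.
Proof.
  intros HT HN HB H0.
  assert (Hhalf : forall eps, 0 < eps -> exists n0, forall n, (n0 <= n)%nat -> (/ 2) ^ n < eps).
  { intros eps Heps. destruct (pow_lt_1_zero (/ 2) ltac:(rewrite Rabs_pos_eq; lra) eps Heps) as [n0 Hn0].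
    exists n0. intros n Hn. specialize (Hn0 n Hn). apply Rabs_lt_between in Hn0. lra. }
  assert (Hlim : forall t, exists z : H, filterlim (fun n => picard Theta n t) eventually (locally z)).
  { intros t. apply (filterlim_locally_cauchy (U := H)). intros eps.
    assert (P := exp_pos (lam * t)).
    assert (He : 0 < eps / (2 * (2 * N + 1) * exp (lam * t))).
    { apply Rdiv_lt_0_compat; [apply cond_pos | nra]. }
    destruct (Hhalf _ He) as [n0 Hn0].
    exists (fun n => (n0 <= n)%nat). split; [exists n0; auto | intros u v Hu Hv].
    apply (@norm_compat1 R_AbsRing H).
    assert (Hb : forall p, (n0 <= p)%nat ->
      norm (minus (picard Theta p t) (picard Theta n0 t)) < eps / 2).
    { intros p Hp. eapply Rle_lt_trans; [apply (picard_diff Theta N n0 p HT HN HB Hp t) | ].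
      assert (Q := Hn0 n0 (le_n _)). assert (Q2 := pow_le (/ 2) p ltac:(lra)).
      apply Rle_lt_trans with ((2 * N + 1) * (/ 2) ^ n0 * exp (lam * t)).
      - apply Rmult_le_compat_r; [lra | ]. assert (Q3 := pow_le (/ 2) n0 ltac:(lra)). nra.
      - apply Rlt_le_trans with ((2 * N + 1) * (eps / (2 * (2 * N + 1) * exp (lam * t))) * exp (lam * t)).
        + apply Rmult_lt_compat_r; [exact P | ]. apply Rmult_lt_compat_l; [lra | exact Q].
        + right. field. split; [lra | nra]. }
    eapply Rle_lt_trans; [apply (norm_minus_triangle _ (picard Theta n0 t)) | ].
    rewrite (norm_minus_sym (picard Theta n0 t)).
    assert (Q1 := Hb u Hu). assert (Q2 := Hb v Hv). lra. }
  (* Limits are unique, so [iota] selects the pointwise limit and turns it into a function of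
     [t]. *)
  set (Z := fun t => iota (T := H) (fun z => filterlim (fun n => picard Theta n t) eventually (locally z))).
  assert (HZ : forall t, filterlim (fun n => picard Theta n t) eventually (locally (Z t))).
  { intros t. unfold Z. apply (iota_correct (V := H)).
    destruct (Hlim t) as [z Hz]. exists z. split; [exact Hz | ].
    intros z' Hz'. exact (filterlim_locally_unique _ _ _ Hz Hz'). }
  assert (HZn : forall n t, norm (minus (Z t) (picard Theta n t)) <= 2 * N * (/ 2) ^ n * exp (lam * t)).
  { intros n t. apply Rle_plus_epsilon. intros eps Heps.
    destruct (proj1 (filterlim_norm_minus eventually _ _ _) (HZ t) (mkposreal _ Heps)) as [p0 Hp0].
    assert (Q := Hp0 (Nat.max n p0) (Nat.le_max_r _ _)). simpl in Q.
    assert (Q2 := picard_diff Theta N n (Nat.max n p0) HT HN HB (Nat.le_max_l _ _) t).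
    assert (Q3 := norm_minus_triangle (Z t) (picard Theta (Nat.max n p0) t) (picard Theta n t)).
    rewrite (norm_minus_sym (Z t) (picard Theta (Nat.max n p0) t)) in Q3.
    assert (Q4 := pow_le (/ 2) (Nat.max n p0) ltac:(lra)). assert (P := exp_pos (lam * t)).
    assert (Q5 : 2 * N * ((/ 2) ^ n - (/ 2) ^ Nat.max n p0) * exp (lam * t)
      <= 2 * N * (/ 2) ^ n * exp (lam * t)).
    { apply Rmult_le_compat_r; [lra | ]. apply Rmult_le_compat_l; lra. }
    lra. }
  assert (HZc : forall t, continuous Z t).
  { intros t. apply continuous_norm_minus. intros eps. assert (Pe := cond_pos eps).
    assert (P := exp_pos (lam * (t + 1))).
    assert (He : 0 < eps / (3 * (2 * N + 1) * exp (lam * (t + 1)))).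
    { apply Rdiv_lt_0_compat; [lra | nra]. }
    destruct (Hhalf _ He) as [n Hn]. specialize (Hn n (le_n _)).
    (* The weight exp(lam s) is bounded on s <= t + 1, so convergence is uniform there and the limit
       inherits continuity by an eps/3 argument. *)
    assert (Hb : forall s, s <= t + 1 -> norm (minus (Z s) (picard Theta n s)) < eps / 3).
    { intros s Hs. eapply Rle_lt_trans; [apply HZn | ].
      assert (Q3 := pow_le (/ 2) n ltac:(lra)).
      apply Rle_lt_trans with ((2 * N + 1) * (/ 2) ^ n * exp (lam * (t + 1))).
      - assert (Pe2 : exp (lam * s) <= exp (lam * (t + 1))).
        { destruct (Req_dec (lam * s) (lam * (t + 1))) as [E | E]; [rewrite E; lra | ].
          left. apply exp_increasing. nra. }
        assert (Pe3 := exp_pos (lam * s)).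
        apply Rmult_le_compat; [ | lra | | exact Pe2]; nra.
      - apply Rlt_le_trans with ((2 * N + 1) * (eps / (3 * (2 * N + 1) * exp (lam * (t + 1)))) * exp (lam * (t + 1))).
        + apply Rmult_lt_compat_r; [exact P | ]. apply Rmult_lt_compat_l; [lra | exact Hn].
        + right. field. split; [lra | nra]. }
    destruct (proj1 (continuous_norm_minus _ _) (picard_continuous Theta n HT t)
      (mkposreal (eps / 3) ltac:(lra))) as [delta Hdelta].
    exists (mkposreal _ (Rmin_stable_in_posreal delta (mkposreal 1 Rlt_0_1))).
    intros s Hs. simpl in Hs.
    assert (A1 := Hdelta s (Rlt_le_trans _ _ _ Hs (Rmin_l _ _))). simpl in A1.
    assert (A2 := Rlt_le_trans _ _ _ Hs (Rmin_r _ _)). apply Rabs_lt_between in A2.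
    assert (B1 := Hb s ltac:(lra)). assert (B2 := Hb t ltac:(lra)).
    assert (T1 := norm_minus_triangle (Z s) (picard Theta n s) (Z t)).
    assert (T2 := norm_minus_triangle (picard Theta n s) (picard Theta n t) (Z t)).
    rewrite (norm_minus_sym (picard Theta n t) (Z t)) in T2. lra. }
  exists Z. split; [exact HZc | split].
  - intros t Ht. apply (filterlim_locally_unique _ _ _ (HZ t)).
    eapply filterlim_ext; [intros n; symmetry; apply picard_zero; assumption | ].
    apply filterlim_const.
  - intros t. set (r := minus (plus (Z t) (memory Z t)) (Theta t)).
    assert (Hr : norm r <= 0).
    { apply Rle_plus_epsilon. intros eps Heps. rewrite Rplus_0_l.
      assert (P := exp_pos (lam * t)).
      assert (He : 0 < eps / ((2 * N + 1) * exp (lam * t))).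
      { apply Rdiv_lt_0_compat; [lra | nra]. }
      destruct (Hhalf _ He) as [n Hn]. specialize (Hn n (le_n _)).
      (* By the Picard recursion the residual is made of two errors of order (/2)^n, for every n,
         hence is zero. *)
      assert (E : r = plus (minus (Z t) (picard Theta (S n) t))
        (memory (fun s => minus (Z s) (picard Theta n s)) t)).
      { rewrite memory_minus by (assumption || apply picard_continuous, HT).
        unfold r. simpl. hilbert_ring. }
      rewrite E. eapply Rle_trans; [exact (@norm_triangle R_AbsRing H _ _) | ].
      assert (Q1 := HZn (S n) t).
      assert (Q2 := memory_contracts (fun s => minus (Z s) (picard Theta n s)) (2 * N * (/ 2) ^ n) t
        (fun s => continuous_minus (V := H) _ _ _ (HZc s) (picard_continuous Theta n HT s))
        ltac:(apply Rmult_le_pos; [lra | apply pow_le; lra]) (fun s _ => HZn n s)).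
      simpl pow in Q1.
      apply Rle_trans with ((2 * N + 1) * (/ 2) ^ n * exp (lam * t)).
      - assert (Q3 := pow_le (/ 2) n ltac:(lra)).
        assert (Q4 : 0 <= (/ 2) ^ n * exp (lam * t)) by nra. lra.
      - apply Rle_trans with ((2 * N + 1) * (eps / ((2 * N + 1) * exp (lam * t))) * exp (lam * t)).
        + apply Rmult_le_compat_r; [lra | ]. apply Rmult_le_compat_l; lra.
        + right. field. split; [lra | nra]. }
    assert (Hr0 : norm r = 0) by (apply Rle_antisym; [exact Hr | exact (norm_ge_0 r)]).
    apply norm_eq_zero in Hr0. apply (plus_reg_r (opp (Theta t))).
    rewrite plus_opp_r. exact Hr0.
Qed.

End Volterra.

(** ** The energy estimate *)

(** The mean value theorem for f - F. It stands in for integrating inequalities in time, and with F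
    = 0 it gives monotonicity. *)
Lemma derive_compare (F f dF df : R -> R) (a b : R) :
  a <= b ->
  (forall x, a <= x <= b -> is_derive F x (dF x)) ->
  (forall x, a <= x <= b -> is_derive f x (df x)) ->
  (forall x, a <= x <= b -> dF x <= df x) ->
  F b - F a <= f b - f a.
Proof.
  intros Hab HF Hf Hle.
  assert (HD : forall x, a <= x <= b -> is_derive (fun s => f s - F s) x (df x - dF x)).
  { intros x Hx. apply (is_derive_minus (V := R_NormedModule)); [apply Hf | apply HF]; exact Hx. }
  destruct (MVT_gen (fun s => f s - F s) a b (fun x => df x - dF x)) as [c [Hc E]].
  - intros x Hx. rewrite Rmin_left, Rmax_right in Hx by exact Hab. apply HD. lra.
  - intros x Hx. rewrite Rmin_left, Rmax_right in Hx by exact Hab.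
    apply continuity_pt_filterlim. apply (ex_derive_continuous (V := R_NormedModule) (fun s => f s - F s)).
    exists (df x - dF x). apply HD, Hx.
  - rewrite Rmin_left, Rmax_right in Hc by exact Hab. assert (W := Hle c Hc). nra.
Qed.

Lemma is_derive_primitive {V : CompleteNormedModule R_AbsRing} (f : R -> V) (t : R) :
  (forall x, continuous f x) -> is_derive (fun s => RInt f 0 s) t (f t).
Proof.
  intros Hf. apply (is_derive_RInt f (fun s => RInt f 0 s) 0 t); [ | apply Hf].
  apply filter_forall. intros s. apply (RInt_correct (V := V)).
  apply (ex_RInt_continuous (V := V)). intros x _. apply Hf.
Qed.

Lemma is_RInt_primitive {V : CompleteNormedModule R_AbsRing} (f : R -> V) (a t : R) :
  (forall x, continuous f x) -> is_RInt f a t (minus (RInt f 0 t) (RInt f 0 a)).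
Proof.
  intros Hf.
  assert (E : forall u v, ex_RInt f u v).
  { intros u v. apply (ex_RInt_continuous (V := V)). intros x _. apply Hf. }
  unfold minus. rewrite plus_comm. apply (is_RInt_Chasles (V := V)) with 0.
  - apply (is_RInt_swap (V := V)). apply (RInt_correct (V := V)), E.
  - apply (RInt_correct (V := V)), E.
Qed.

Lemma primitive_zero {V : CompleteNormedModule R_AbsRing} (f : R -> V) (t : R) :
  (forall x, x <= 0 -> f x = zero) -> t <= 0 -> RInt f 0 t = zero.
Proof.
  intros Hf Ht. rewrite (RInt_ext (V := V) f (fun _ => zero)).
  - rewrite (RInt_const (V := V)). exact (@scal_zero_r R_Ring V (t - 0)).
  - intros x Hx. rewrite Rmin_right, Rmax_left in Hx by exact Ht. apply Hf. lra.
Qed.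

Lemma weighted_young (p q c : R) : 0 < c -> 2 * (p * q) <= c * p ^ 2 + / c * q ^ 2.
Proof.
  intros Hc. assert (P := Rinv_0_lt_compat c Hc).
  assert (Q : 0 <= / c * (c * p - q) ^ 2) by (apply Rmult_le_pos; [lra | apply pow2_ge_0]).
  replace (/ c * (c * p - q) ^ 2) with (c * p ^ 2 + / c * q ^ 2 - 2 * (p * q)) in Q by (field; lra).
  lra.
Qed.

Section Energy.

Context {H : HilbertSpace} (m : nat) (d : nat -> R -> R) (b : nat -> R)
  (K : H -> H) (M : nat -> H -> H) (CE : nat -> R)
  (Hd : forall j, (1 <= j <= m)%nat -> is_delay (d j) (b j))
  (HM : forall j, (1 <= j <= m)%nat -> is_linear (M j))
  (HK : is_linear K)
  (Kpos : forall x, 0 <= inner x (K x))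
  (HCE0 : forall j, (1 <= j <= m)%nat -> 0 <= CE j)
  (HCE : forall j, (1 <= j <= m)%nat -> forall x y,
     Rabs (inner (M j x) (K y)) <= CE j * sqrt (inner x (K x)) * sqrt (inner y (K y))).

(** The bound 2 is the coefficient of the dissipation [N] in the energy below, and [2 * lam] appears
    because squared norms carry the weight exp(-2 lam t). [lmin] leaves room to make [lam] exceed
    kappa. *)
Lemma energy_parameters (lmin : R) :
  exists mu lam, 0 < mu /\ lmin <= lam /\ 0 <= lam /\
    sum_n_m (fun j => CE j * (mu * b j + / mu * damping (d j) (b j) (2 * lam))) 1 m <= 2.
Proof.
  set (S := sum_n_m (fun j => CE j * b j) 1 m).
  assert (HS : 0 <= S).
  { unfold S. apply Rle_trans with (sum_n_m (fun _ => 0) 1 m).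
    - right. symmetry. exact (sum_n_m_const_zero (G := R_AbelianMonoid) 1 m).
    - apply sum_n_m_le_loc. intros j Hj. apply Rmult_le_pos; [apply HCE0, Hj | apply (delay_length _ _ (Hd j Hj))]. }
  (* This makes mu * S at most 1; only then is [lam] chosen, so that the terms divided by [mu]
     contribute at most 1 more. *)
  set (mu := / (S + 1)).
  assert (Hmu : 0 < mu) by (apply Rinv_0_lt_compat; lra).
  destruct (damping_sum_small m d b (fun j => CE j * / mu) 1 Hd Rlt_0_1) as [l0 [Hl0 Hl]].
  exists mu, (Rmax lmin l0). split; [exact Hmu | split; [apply Rmax_l | ]].
  assert (Q := Rmax_r lmin l0). split; [lra | ].
  assert (Q1 := Hl (2 * Rmax lmin l0) ltac:(lra)).
  rewrite (sum_n_m_ext_loc _ (fun j => plus (mult mu (CE j * b j))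
    (CE j * / mu * damping (d j) (b j) (2 * Rmax lmin l0)))).
  - rewrite sum_n_m_plus, (sum_n_m_mult_l (K := R_Ring)).
    assert (Q2 : mu * S <= 1).
    { unfold mu. apply Rmult_le_reg_l with (S + 1); [lra | ].
      rewrite <- Rmult_assoc, Rinv_r by lra. lra. }
    change (mu * S + sum_n_m (fun j => CE j * / mu * damping (d j) (b j) (2 * Rmax lmin l0)) 1 m <= 2).
    lra.
  - intros j _. unfold plus, mult; simpl. ring.
Qed.

Context (X Y Y' Psi : R -> H) (psi Ipsi : R -> R) (kappa lam mu T : R)
  (HXc : forall t, continuous X t)
  (HY : forall t, is_derive Y t (Y' t))
  (HX0 : forall t, t <= 0 -> X t = zero)
  (HY0 : Y 0 = zero)
  (HYX : forall t, t <= T -> Y t = K (X t))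
  (Heq : forall t, t <= T ->
     minus (plus (plus (Y' t) (X t)) (memory m d b M X t)) (scal kappa (Y t)) = Psi t)
  (Hpsi : forall t, t <= T -> norm (Psi t) <= psi t)
  (HIpsi : forall t, is_derive Ipsi t (psi t))
  (HIpsi0 : Ipsi 0 = 0)
  (Hmu : 0 < mu) (Hlam : 0 <= lam) (Hkappa : kappa <= lam) (HT : 0 <= T)
  (Hpar : sum_n_m (fun j => CE j * (mu * b j + / mu * damping (d j) (b j) (2 * lam))) 1 m <= 2).

(** [Fe] is the squared norm plus the dissipation [2 N], less what the memory can
    give back by Young's inequality; the weight [mu] is fixed first, then [lam] is
    taken so large that [Fe] still dominates the squared norm. *)
Let n2 (t : R) : R := exp (- (2 * lam) * t) * inner (X t) (K (X t)).
Let N (t : R) : R := RInt (V := R_CompleteNormedModule) n2 0 t.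
Let Fe (t : R) : R := exp (- (2 * lam) * t) * inner (Y t) (Y t) + 2 * N t
  - sum_n_m (fun j => CE j * (mu * delay_int (V := R_CompleteNormedModule) (d j) (b j) N t
      + / mu * damping (d j) (b j) (2 * lam) * N t)) 1 m.
Let dFe (t : R) : R := exp (- (2 * lam) * t) * (2 * inner (Y' t) (Y t) - 2 * lam * inner (Y t) (Y t))
  + 2 * n2 t
  - sum_n_m (fun j => CE j * (mu * delay_int (V := R_CompleteNormedModule) (d j) (b j) n2 t
      + / mu * damping (d j) (b j) (2 * lam) * n2 t)) 1 m.

Lemma energy_n2_continuous (t : R) : continuous n2 t.
Proof.
  unfold n2. apply (continuous_exp_mult (- (2 * lam)) (fun t => inner (X t) (K (X t)))).
  apply continuous_inner; [apply HXc | ].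
  apply (continuous_linear_comp (V := H) (W := H) K X t HK (HXc t)).
Qed.

Lemma energy_n2_pos (t : R) : 0 <= n2 t.
Proof. apply Rmult_le_pos; [left; apply exp_pos | apply Kpos]. Qed.

Lemma energy_N_derive (t : R) : is_derive N t (n2 t).
Proof. apply (is_derive_primitive (V := R_CompleteNormedModule)), energy_n2_continuous. Qed.

Lemma energy_N_continuous (t : R) : continuous N t.
Proof. apply (ex_derive_continuous (V := R_NormedModule)). exists (n2 t). apply energy_N_derive. Qed.

Lemma energy_N_zero (t : R) : t <= 0 -> N t = 0.
Proof.
  intros Ht. apply (primitive_zero (V := R_CompleteNormedModule)); [ | exact Ht].
  intros x Hx. unfold n2. rewrite HX0 by exact Hx. inner_simpl.
  change (exp (- (2 * lam) * x) * 0 = 0). ring.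
Qed.

Lemma energy_N_mono (s t : R) : s <= t -> N s <= N t.
Proof.
  intros Hst.
  assert (W := derive_compare (fun _ => 0) N (fun _ => 0) n2 s t Hst
    (fun x _ => is_derive_const (V := R_NormedModule) 0 x) (fun x _ => energy_N_derive x)
    (fun x _ => energy_n2_pos x)). lra.
Qed.

Lemma energy_Fe_derive (t : R) : is_derive Fe t (dFe t).
Proof.
  unfold Fe, dFe.
  apply (is_derive_minus (V := R_NormedModule)).
  - apply (is_derive_plus (V := R_NormedModule)).
    + assert (E1 : is_derive (fun t => exp (- (2 * lam) * t)) t (- (2 * lam) * exp (- (2 * lam) * t))).
      { auto_derive; [trivial | ring]. }
      assert (E2 := is_derive_mult (fun t => exp (- (2 * lam) * t)) (fun t => inner (Y t) (Y t)) t _ _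
        E1 (is_derive_norm_sqr Y t _ (HY t)) Rmult_comm).
      replace (exp (- (2 * lam) * t) * (2 * inner (Y' t) (Y t) - 2 * lam * inner (Y t) (Y t)))
        with (plus (mult (- (2 * lam) * exp (- (2 * lam) * t)) (inner (Y t) (Y t)))
          (mult (exp (- (2 * lam) * t)) (2 * inner (Y' t) (Y t))))
        by (unfold plus, mult; simpl; ring).
      exact E2.
    + apply (is_derive_scal N t 2). apply energy_N_derive.
  - apply (is_derive_sum_n_m (fun j t => CE j * (mu * delay_int (V := R_CompleteNormedModule) (d j) (b j) N t
      + / mu * damping (d j) (b j) (2 * lam) * N t))
      (fun j t => CE j * (mu * delay_int (V := R_CompleteNormedModule) (d j) (b j) n2 t
      + / mu * damping (d j) (b j) (2 * lam) * n2 t))).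
    intros j Hj.
    apply (is_derive_scal (fun t => mu * delay_int (V := R_CompleteNormedModule) (d j) (b j) N t
      + / mu * damping (d j) (b j) (2 * lam) * N t) t (CE j)).
    apply (is_derive_plus (V := R_NormedModule)).
    + apply (is_derive_scal (delay_int (V := R_CompleteNormedModule) (d j) (b j) N) t mu).
      apply delay_int_derive; [apply Hd, Hj | apply energy_N_derive | apply energy_n2_continuous].
    + apply (is_derive_scal N t). apply energy_N_derive.
Qed.

(** Since Y t = K (X t), the form bound gives the product of the energy norms of X at the times t -
    d s and t. Young's inequality separates them into a delayed [n2] and a damped multiple of
    [n2 t], both of which are derivatives of terms of [Fe]. *)
Lemma energy_memory_le (t : R) : t <= T ->
  exp (- (2 * lam) * t) * (2 * Rabs (inner (memory m d b M X t) (Y t))) <=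
  sum_n_m (fun j => CE j * (mu * delay_int (V := R_CompleteNormedModule) (d j) (b j) n2 t
      + / mu * damping (d j) (b j) (2 * lam) * n2 t)) 1 m.
Proof.
  intros Ht. unfold memory. inner_sums.
  assert (Pe := exp_pos (- (2 * lam) * t)).
  apply Rle_trans with (exp (- (2 * lam) * t) * (2 * sum_n_m (fun j => Rabs (inner
    (delay_int (d j) (b j) (fun s => M j (X s)) t) (Y t))) 1 m)).
  { apply Rmult_le_compat_l; [lra | ]. apply Rmult_le_compat_l; [lra | ].
    exact (norm_sum_n_m (V := R_NormedModule) _ 1 m). }
  rewrite <- Rmult_assoc.
  apply Rle_trans with (sum_n_m (fun j => mult (exp (- (2 * lam) * t) * 2) (Rabs (inner
    (delay_int (d j) (b j) (fun s => M j (X s)) t) (Y t)))) 1 m).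
  { right. symmetry. exact (sum_n_m_mult_l (K := R_Ring) _ _ 1 m). }
  apply sum_n_m_le_loc. intros j Hj.
  set (g := fun s => / 2 * CE j * (mu * exp (2 * lam * t) * n2 s + / mu * n2 t * exp (2 * lam * s))).
  assert (Hg : is_RInt (fun s => g (t - d j s)) 0 (b j)
    (/ 2 * CE j * (mu * exp (2 * lam * t) * delay_int (V := R_CompleteNormedModule) (d j) (b j) n2 t
      + / mu * n2 t * exp (2 * lam * t) * damping (d j) (b j) (2 * lam)))).
  { apply (is_RInt_scal (V := R_NormedModule)). apply (is_RInt_plus (V := R_NormedModule)).
    - apply (is_RInt_scal (V := R_NormedModule)).
      apply (is_RInt_delay (V := R_CompleteNormedModule)); [apply Hd, Hj | apply energy_n2_continuous].
    - rewrite <- delay_int_exp by apply Hd, Hj.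
      apply (is_RInt_delay (V := R_CompleteNormedModule) (d j) (b j) (Hd j Hj)
        (fun s => / mu * n2 t * exp (2 * lam * s))).
      intros x. apply (continuous_scal_r (K := R_AbsRing) (V := R_NormedModule)). apply exp_continuous. }
  assert (HMX : forall x, continuous (fun s => M j (X s)) x).
  { apply memory_integrand_continuous with (m := m); assumption. }
  assert (Hi : is_RInt (fun s => inner (M j (X (t - d j s))) (Y t)) 0 (b j)
     (inner (delay_int (d j) (b j) (fun s => M j (X s)) t) (Y t))).
  { apply (is_RInt_linear_comp (V := H) (W := R_NormedModule) (fun x : H => inner x (Y t))).
    - apply is_linear_inner_l.
    - apply (is_RInt_delay (V := H) (d j) (b j) (Hd j Hj) (fun s => M j (X s))). exact HMX. }
  assert (Q : Rabs (inner (delay_int (d j) (b j) (fun s => M j (X s)) t) (Y t)) <=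
    / 2 * CE j * (mu * exp (2 * lam * t) * delay_int (V := R_CompleteNormedModule) (d j) (b j) n2 t
      + / mu * n2 t * exp (2 * lam * t) * damping (d j) (b j) (2 * lam))).
  { refine (norm_RInt_le (V := R_NormedModule) _ _ 0 (b j) _ _ (delay_length _ _ (Hd j Hj)) _ Hi Hg).
    intros r _. set (s := t - d j r). change (Rabs (inner (M j (X s)) (Y t)) <= g s).
    rewrite (HYX t Ht). eapply Rle_trans; [apply HCE, Hj | ].
    unfold g, n2.
    set (a := inner (X s) (K (X s))). set (c := inner (X t) (K (X t))).
    (* The Young weight mu exp(2 lam (t - s)) gives the square at time s precisely the factor exp(-2
       lam s) that occurs in [n2 s], and likewise at time t. *)
    assert (Ya := weighted_young (sqrt a) (sqrt c) (mu * (exp (2 * lam * t) * exp (- (2 * lam) * s)))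
      ltac:(apply Rmult_lt_0_compat; [exact Hmu | apply Rmult_lt_0_compat; apply exp_pos])).
    rewrite !pow2_sqrt in Ya by apply Kpos.
    replace (/ (mu * (exp (2 * lam * t) * exp (- (2 * lam) * s)))) with
      (/ mu * (exp (- (2 * lam) * t) * exp (2 * lam * s))) in Ya.
    - assert (W := HCE0 j Hj).
      apply Rle_trans with (/ 2 * CE j * (2 * (sqrt a * sqrt c))); [right; field | ].
      apply Rmult_le_compat_l; [lra | ].
      eapply Rle_trans; [exact Ya | right; ring].
    - replace (- (2 * lam) * t) with (- (2 * lam * t)) by ring.
      replace (- (2 * lam) * s) with (- (2 * lam * s)) by ring.
      rewrite !exp_Ropp. assert (W1 := exp_pos (2 * lam * t)). assert (W2 := exp_pos (2 * lam * s)).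
      field. repeat split; lra. }
  change (exp (- (2 * lam) * t) * 2 * Rabs (inner (delay_int (d j) (b j) (fun s => M j (X s)) t) (Y t)) <=
    CE j * (mu * delay_int (V := R_CompleteNormedModule) (d j) (b j) n2 t
      + / mu * damping (d j) (b j) (2 * lam) * n2 t)).
  eapply Rle_trans; [apply Rmult_le_compat_l; [lra | exact Q] | ].
  assert (EE : exp (- (2 * lam) * t) * exp (2 * lam * t) = 1).
  { rewrite <- exp_plus, <- exp_0. f_equal. ring. }
  right. set (J := delay_int (V := R_CompleteNormedModule) (d j) (b j) n2 t).
  transitivity (CE j * (exp (- (2 * lam) * t) * exp (2 * lam * t)) *
    (mu * J + / mu * damping (d j) (b j) (2 * lam) * n2 t)); [field; lra | ].
  rewrite EE. ring.
Qed.

(** Pair [Heq] with Y: the term <X, K X> cancels 2 n2, the memory is covered by [energy_memory_le],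
    and kappa |Y|^2 by the decay of the weight, as kappa <= lam. Only the source is left. *)
Lemma energy_dFe_le (t : R) : t <= T ->
  dFe t <= 2 * (exp (- (2 * lam) * t) * (psi t * norm (Y t))).
Proof.
  intros Ht. assert (Pe := exp_pos (- (2 * lam) * t)).
  assert (E : inner (Y' t) (Y t) = inner (Psi t) (Y t) - inner (X t) (K (X t))
    - inner (memory m d b M X t) (Y t) + kappa * inner (Y t) (Y t)).
  { rewrite <- (Heq t Ht). inner_simpl. rewrite <- (HYX t Ht). ring. }
  assert (Q := energy_memory_le t Ht).
  assert (Q2 := Rabs_maj2 (inner (memory m d b M X t) (Y t))).
  assert (Q3 : inner (Psi t) (Y t) <= psi t * norm (Y t)).
  { eapply Rle_trans; [apply inner_le_norm | ].
    apply Rmult_le_compat_r; [exact (norm_ge_0 (Y t)) | apply Hpsi, Ht]. }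
  assert (Q4 : 0 <= inner (Y t) (Y t)) by (rewrite inner_norm; apply pow2_ge_0).
  unfold dFe. rewrite E. unfold n2 at 1.
  set (S := sum_n_m _ 1 m) in *. clearbody S.
  set (e := exp (- (2 * lam) * t)) in *. set (p := inner (Y t) (Y t)) in *.
  set (w := inner (memory m d b M X t) (Y t)) in *. set (x := inner (X t) (K (X t))) in *.
  set (f := inner (Psi t) (Y t)) in *. set (g := psi t * norm (Y t)) in *.
  assert (R1 : e * f <= e * g) by (apply Rmult_le_compat_l; lra).
  assert (R2 : e * (2 * - w) <= e * (2 * Rabs w)) by (apply Rmult_le_compat_l; lra).
  assert (R3 : e * (kappa * p) <= e * (lam * p)).
  { apply Rmult_le_compat_l; [lra | ]. apply Rmult_le_compat_r; lra. }
  lra.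
Qed.

(** [N] is nondecreasing, so its delay integral is at most b_j N t; by [Hpar] the subtracted sum is
    then at most the dissipation 2 N t. *)
Lemma energy_Fe_ge (t : R) : 0 <= t -> exp (- (2 * lam) * t) * inner (Y t) (Y t) <= Fe t.
Proof.
  intros Ht.
  assert (HN : 0 <= N t) by (rewrite <- (energy_N_zero 0) by lra; apply energy_N_mono, Ht).
  assert (Q : sum_n_m (fun j => CE j * (mu * delay_int (V := R_CompleteNormedModule) (d j) (b j) N t
      + / mu * damping (d j) (b j) (2 * lam) * N t)) 1 m <= N t * 2).
  { apply Rle_trans with (sum_n_m (fun j => mult (N t)
      (CE j * (mu * b j + / mu * damping (d j) (b j) (2 * lam)))) 1 m).
    - apply sum_n_m_le_loc. intros j Hj.
      change (CE j * (mu * delay_int (V := R_CompleteNormedModule) (d j) (b j) N t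
        + / mu * damping (d j) (b j) (2 * lam) * N t) <=
        N t * (CE j * (mu * b j + / mu * damping (d j) (b j) (2 * lam)))).
      assert (W : delay_int (V := R_CompleteNormedModule) (d j) (b j) N t <= b j * N t).
      { apply Rle_trans with (RInt (fun _ => N t) 0 (b j)).
        - apply RInt_le; [apply (delay_length _ _ (Hd j Hj)) | | apply ex_RInt_const | ].
          + eexists. apply (is_RInt_delay (V := R_CompleteNormedModule) (d j) (b j) (Hd j Hj) N).
            apply energy_N_continuous.
          + intros s _. apply energy_N_mono. assert (P := delay_pos _ _ (Hd j Hj) s). lra.
        - rewrite RInt_const. right. change ((b j - 0) * N t = b j * N t). ring. }
      assert (W2 := HCE0 j Hj).
      apply Rle_trans with (CE j * (mu * (b j * N t) + / mu * damping (d j) (b j) (2 * lam) * N t));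
        [ | right; ring].
      apply Rmult_le_compat_l; [exact W2 | ]. apply Rplus_le_compat_r.
      apply Rmult_le_compat_l; lra.
    - rewrite (sum_n_m_mult_l (K := R_Ring)). apply Rmult_le_compat_l; assumption. }
  unfold Fe. lra.
Qed.

(** Evaluate at the point s0 where exp(-lam s) |Y s| attains its maximum Mx. There Mx^2 <= Fe s0 <=
    2 Mx Ipsi s0, and one factor Mx cancels. The source enters only through its time integral, which
    is essential for data with a jump. *)
Lemma energy_estimate (t : R) : t <= T -> 0 <= t -> norm (Y t) <= 2 * Ipsi T * exp (lam * t).
Proof.
  intros Ht Ht0.
  assert (HYc : forall s, continuous Y s).
  { intros s. apply (ex_derive_continuous (V := H)). exists (Y' s). apply HY. }
  destruct (weighted_max (fun s => norm (Y s)) lam T (fun s => continuous_norm_comp Y s (HYc s)) HT)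
    as [s0 [Hs0 Hmax]].
  set (Mx := exp (- lam * s0) * norm (Y s0)) in *.
  assert (HMx : 0 <= Mx) by (apply Rmult_le_pos; [left; apply exp_pos | exact (norm_ge_0 (Y s0))]).
  assert (Hpsi0 : forall s, s <= T -> 0 <= psi s).
  { intros s Hs. eapply Rle_trans; [exact (norm_ge_0 (Psi s)) | apply Hpsi, Hs]. }
  assert (E2 : forall s, exp (- (2 * lam) * s) = exp (- lam * s) * exp (- lam * s)).
  { intros s. rewrite <- exp_plus. f_equal. ring. }
  assert (HF : Fe s0 - Fe 0 <= 2 * Mx * Ipsi s0 - 2 * Mx * Ipsi 0).
  { apply (derive_compare Fe (fun s => 2 * Mx * Ipsi s) dFe (fun s => 2 * Mx * psi s) 0 s0).
    - lra.
    - intros x _. apply energy_Fe_derive.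
    - intros x _. apply (is_derive_scal Ipsi x (2 * Mx)). apply HIpsi.
    - intros x Hx. eapply Rle_trans; [apply energy_dFe_le; lra | ].
      assert (W := Hmax x ltac:(lra)). simpl in W. assert (W2 := Hpsi0 x ltac:(lra)).
      assert (W3 := norm_ge_0 (Y x)). assert (W4 := exp_pos (- lam * x)).
      assert (W5 : exp (- lam * x) <= 1).
      { rewrite <- exp_0. destruct (Req_dec (- lam * x) 0) as [E | E]; [rewrite E; lra | ].
        left. apply exp_increasing. nra. }
      rewrite E2, (Rmult_assoc 2). apply Rmult_le_compat_l; [lra | ].
      apply Rle_trans with ((exp (- lam * x) * norm (Y x)) * (exp (- lam * x) * psi x)); [right; ring | ].
      apply Rmult_le_compat; [apply Rmult_le_pos; lra | apply Rmult_le_pos; lra | exact W | ].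
      rewrite <- (Rmult_1_l (psi x)) at 2. apply Rmult_le_compat_r; lra. }
  assert (HF0 : Fe 0 = 0).
  { unfold Fe. rewrite HY0, (energy_N_zero 0) by lra.
    rewrite (sum_n_m_ext_loc _ (fun _ => zero)).
    - rewrite (sum_n_m_const_zero (G := R_AbelianMonoid)). inner_simpl.
      change (exp (- (2 * lam) * 0) * 0 + 2 * 0 - 0 = 0). ring.
    - intros j Hj. rewrite (delay_int_zero (V := R_CompleteNormedModule) (d j) (b j) (Hd j Hj)).
      + change (CE j * (mu * 0 + / mu * damping (d j) (b j) (2 * lam) * 0) = 0). ring.
      + intros s Hs. apply energy_N_zero, Hs. }
  assert (HI : Ipsi s0 <= Ipsi T).
  { assert (W := derive_compare (fun _ => 0) Ipsi (fun _ => 0) psi s0 T ltac:(lra)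
      (fun x _ => is_derive_const (V := R_NormedModule) 0 x) (fun x _ => HIpsi x)
      (fun x Hx => Hpsi0 x ltac:(lra))). lra. }
  assert (HI0 : 0 <= Ipsi s0).
  { assert (W := derive_compare (fun _ => 0) Ipsi (fun _ => 0) psi 0 s0 ltac:(lra)
      (fun x _ => is_derive_const (V := R_NormedModule) 0 x) (fun x _ => HIpsi x)
      (fun x Hx => Hpsi0 x ltac:(lra))). lra. }
  assert (HG := energy_Fe_ge s0 ltac:(lra)).
  assert (HMx2 : Mx * Mx = exp (- (2 * lam) * s0) * inner (Y s0) (Y s0)).
  { rewrite inner_norm, E2. unfold Mx. ring. }
  assert (HMxle : Mx <= 2 * Ipsi T).
  { rewrite HIpsi0 in HF. destruct (Req_dec Mx 0) as [E | E]; [rewrite E; lra | ].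
    apply Rmult_le_reg_l with Mx; [lra | ]. nra. }
  assert (W := Hmax t ltac:(lra)). simpl in W.
  assert (EE : exp (- lam * t) * exp (lam * t) = 1).
  { rewrite <- exp_plus, <- exp_0. f_equal. ring. }
  assert (P := exp_pos (lam * t)).
  replace (norm (Y t)) with (exp (- lam * t) * norm (Y t) * exp (lam * t)).
  - apply Rmult_le_compat_r; lra.
  - transitivity (exp (- lam * t) * exp (lam * t) * norm (Y t)); [ring | rewrite EE; ring].
Qed.

End Energy.

(** ** Backward differences and the a priori bounds *)

(** Only left increments are used because the estimates hold up to T and the endpoint t = T is
    needed. *)
Lemma derive_bound_left (f : R -> R) (t l C e : R) :
  is_derive f t l -> 0 < e ->
  (forall h, 0 < h < e -> Rabs (f t - f (t - h)) <= C * h) -> Rabs l <= C.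
Proof.
  intros Hf He HC. apply Rle_plus_epsilon. intros eps Heps.
  destruct (proj1 (is_derive_eps f t l) Hf eps Heps) as [delta Hdelta].
  assert (Q0 := Rmin_stable_in_posreal delta (mkposreal e He)). simpl in Q0.
  assert (Q1 := Rmin_l delta e). assert (Q1' := Rmin_r delta e).
  set (h := Rmin delta e / 2). assert (Hh : 0 < h) by (unfold h; lra).
  assert (Q := Hdelta (- h) ltac:(lra) ltac:(rewrite Rabs_Ropp, Rabs_pos_eq; unfold h; lra)).
  assert (Q2 := HC h ltac:(unfold h in *; lra)). rewrite Rabs_Ropp, (Rabs_pos_eq h) in Q by lra.
  replace (t + - h) with (t - h) in Q by ring.
  apply Rmult_le_reg_r with h; [exact Hh | ].
  replace (Rabs l * h) with (Rabs (l * h)) by (rewrite Rabs_mult, (Rabs_pos_eq h); lra).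
  replace (l * h) with ((f (t - h) - f t - - h * l) + (f t - f (t - h))) by ring.
  eapply Rle_trans; [apply Rabs_triang | lra].
Qed.

Lemma derive_inner {H : HilbertSpace} (f : R -> H) (t : R) (l w : H) :
  is_derive f t l -> is_derive (fun s => inner (f s) w : R) t (inner l w).
Proof.
  intros Hf.
  exact (is_derive_linear_comp (V := H) (W := R_NormedModule) (fun x => inner x w) f t l
    (is_linear_inner_l w) Hf).
Qed.

Lemma norm_derive_bound_left {H : HilbertSpace} (f : R -> H) (t : R) (l : H) (C e : R) :
  0 <= C -> is_derive f t l -> 0 < e ->
  (forall h, 0 < h < e -> norm (minus (f t) (f (t - h))) <= C * h) -> norm l <= C.
Proof.
  intros HC0 Hf He HC. apply norm_le_of_inner; [exact HC0 | intros w].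
  eapply Rle_trans; [apply Rle_abs | ].
  apply (derive_bound_left (fun s => inner (f s) w) t _ _ e); [apply derive_inner, Hf | exact He | ].
  intros h Hh. rewrite <- inner_minus_l.
  eapply Rle_trans; [apply cauchy_schwarz | ].
  replace (C * norm w * h) with (C * h * norm w) by ring.
  apply Rmult_le_compat_r; [exact (norm_ge_0 w) | apply HC, Hh].
Qed.

Lemma norm_le_of_dense {H : HilbertSpace} (D : H -> Prop) (x : H) (C : R) :
  (forall y eps, 0 < eps -> exists w, D w /\ norm (minus w y) < eps) ->
  0 <= C -> (forall w, D w -> inner x w <= C * norm w) -> norm x <= C.
Proof.
  intros HD HC Hx. set (n := norm x). assert (Hn : 0 <= n) by exact (norm_ge_0 x).
  assert (Hnn : n * n <= C * n).
  { apply Rle_plus_epsilon. intros eps Heps.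
    assert (He : 0 < eps / (C + n + 1)) by (apply Rdiv_lt_0_compat; lra).
    destruct (HD x _ He) as [w [Hw Hwx]].
    set (e := eps / (C + n + 1)) in *.
    assert (Q1 := Hx w Hw).
    assert (Q2 := inner_le_norm x (minus x w)).
    rewrite norm_minus_sym in Q2. rewrite inner_minus_r, inner_norm in Q2.
    assert (Q3 := norm_le_minus w x). fold n in Q2, Q3.
    assert (Q4 : n * norm (minus w x) <= n * e) by (apply Rmult_le_compat_l; lra).
    assert (Q5 : C * norm w <= C * (e + n)) by (apply Rmult_le_compat_l; lra).
    assert (Q6 : (C + n) * e <= eps).
    { apply Rle_trans with ((C + n + 1) * e); [ | right; unfold e; field; lra].
      apply Rmult_le_compat_r; lra. }
    simpl in Q2. nra. }
  destruct (Req_dec n 0) as [E | E]; [lra | ]. apply Rmult_le_reg_r with n; lra.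
Qed.

(** Backward differences respect causality: an equation valid for t <= T stays valid for them up to
    T, and functions that vanish for t <= 0 keep doing so. *)
Definition bdiff {G : AbelianGroup} (h : R) (f : R -> G) (t : R) : G := minus (f t) (f (t - h)).

Lemma bdiff_continuous {V : NormedModule R_AbsRing} (h : R) (f : R -> V) (t : R) :
  (forall x, continuous f x) -> continuous (bdiff h f) t.
Proof.
  intros Hf. apply (continuous_minus (V := V)); [apply Hf | apply continuous_shift, Hf].
Qed.

Lemma is_derive_shift {V : NormedModule R_AbsRing} (f : R -> V) (h t : R) (l : V) :
  is_derive f (t - h) l -> is_derive (fun s => f (s - h)) t l.
Proof.
  intros Hf.
  assert (E : is_derive (fun s => s - h) t 1).
  { auto_derive; [trivial | ring]. }
  assert (W := is_derive_comp (V := V) f (fun s => s - h) t l 1 Hf E).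
  replace l with (scal 1 l) by exact (@scal_one R_Ring V l). exact W.
Qed.

Lemma bdiff_derive {V : NormedModule R_AbsRing} (h : R) (f f' : R -> V) (t : R) :
  (forall x, is_derive f x (f' x)) -> is_derive (bdiff h f) t (bdiff h f' t).
Proof.
  intros Hf. apply (is_derive_minus (V := V)); [apply Hf | apply is_derive_shift, Hf].
Qed.

Lemma bdiff_zero {V : NormedModule R_AbsRing} (h : R) (f : R -> V) (t : R) :
  0 <= h -> (forall s, s <= 0 -> f s = zero) -> t <= 0 -> bdiff h f t = zero.
Proof.
  intros Hh Hf Ht. unfold bdiff. rewrite !Hf by lra. exact (minus_eq_zero (G := V) zero).
Qed.

Section APriori.

Context {H : HilbertSpace} (m : nat) (d : nat -> R -> R) (b : nat -> R)
  (K : H -> H) (M : nat -> H -> H) (CM CE : nat -> R)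
  (Hd : forall j, (1 <= j <= m)%nat -> is_delay (d j) (b j))
  (HM : forall j, (1 <= j <= m)%nat -> is_linear (M j))
  (HK : is_linear K)
  (Ksym : forall x y, inner (K x) y = inner x (K y))
  (Kpos : forall x, 0 <= inner x (K x))
  (Kdense : forall x eps, 0 < eps -> exists y, norm (minus (K y) x) < eps)
  (HCM0 : forall j, (1 <= j <= m)%nat -> 0 <= CM j)
  (HCM : forall j, (1 <= j <= m)%nat -> forall x, norm (M j x) <= CM j * norm x)
  (KM : forall j, (1 <= j <= m)%nat -> forall x y, inner (K (M j x)) y = inner (K x) (M j y))
  (HCE0 : forall j, (1 <= j <= m)%nat -> 0 <= CE j)
  (HCE : forall j, (1 <= j <= m)%nat -> forall x y,
     Rabs (inner (M j x) (K y)) <= CE j * sqrt (inner x (K x)) * sqrt (inner y (K y))).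

(** By [KM] the operator M_j moves to the test vector, where it is bounded. So K M_j x is controlled
    by K x alone, without any control on x. *)
Lemma norm_KM_le j x : (1 <= j <= m)%nat -> norm (K (M j x)) <= CM j * norm (K x).
Proof.
  intros Hj. assert (P := HCM0 j Hj). assert (Q := norm_ge_0 (K x)).
  apply norm_le_of_inner; [apply Rmult_le_pos; assumption | intros w].
  rewrite KM by exact Hj. eapply Rle_trans; [apply inner_le_norm | ].
  apply Rle_trans with (norm (K x) * (CM j * norm w)); [ | right; ring].
  apply Rmult_le_compat_l; [exact Q | apply HCM, Hj].
Qed.

Context (kappa T : R) (HT : 0 <= T)
  (v z Phi : R -> H) (P : R -> R) (L LPhi : R)
  (Hvz : forall t, K (z t) = v t)
  (Hvc : forall t, continuous v t)
  (Hv0 : forall t, t <= 0 -> v t = zero)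
  (HPhic : forall t, continuous Phi t)
  (HPhi0 : forall t, t <= 0 -> Phi t = zero)
  (HLPhi : 0 <= LPhi)
  (HPhiLip : forall h t, 0 < h -> t <= T -> norm (bdiff h Phi t) <= LPhi * h)
  (HPc : forall t, continuous P t)
  (HP0 : forall t, t <= 0 -> P t = 0)
  (HL : 0 <= L)
  (HPLip : forall h t, 0 < h -> bdiff (G := R_AbelianGroup) h P t <= L * h)
  (HPhiP : forall h k t, 0 < h -> 0 < k -> t <= T ->
     norm (bdiff k (bdiff h Phi) t) <=
       bdiff (G := R_AbelianGroup) k (bdiff (G := R_AbelianGroup) h P) t).

Let U (t : R) : H := RInt v 0 t.
Let ell (j : nat) (t : R) : H := K (M j (z t)).
Let Lam (j : nat) (t : R) : H := RInt (ell j) 0 t.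

(** Here [v] is the solution minus u0, extended by zero, and [z] is A applied to it. The equation is
    taken integrated in time and with K applied, so that only K z and K M_j z occur under integrals,
    and not [z] itself. *)
Context (Hint : forall t, t <= T ->
  plus (plus (K (v t)) (U t)) (sum_n_m (fun j => delay_int (d j) (b j) (Lam j) t) 1 m)
    = K (plus (Phi t) (scal kappa (U t)))).

(** No regularity of [z] in time is available, but by [norm_KM_le] the increments of K M_j z are
    bounded by those of K z = v. *)
Lemma ell_continuous j : (1 <= j <= m)%nat -> forall t, continuous (ell j) t.
Proof.
  intros Hj t. apply continuous_norm_minus. intros eps.
  assert (Q := HCM0 j Hj). assert (Pe := cond_pos eps).
  assert (He : 0 < eps / (CM j + 1)) by (apply Rdiv_lt_0_compat; lra).
  destruct (proj1 (continuous_norm_minus v t) (Hvc t) (mkposreal _ He)) as [delta Hdelta].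
  exists delta. intros s Hs. specialize (Hdelta s Hs). simpl in Hdelta.
  unfold ell. rewrite <- (linear_minus _ _ _ HK), <- (linear_minus _ _ _ (HM j Hj)).
  eapply Rle_lt_trans; [apply norm_KM_le, Hj | ].
  rewrite (linear_minus _ _ _ HK), !Hvz.
  assert (Q2 := norm_ge_0 (minus (v s) (v t))).
  apply Rle_lt_trans with ((CM j + 1) * norm (minus (v s) (v t))); [apply Rmult_le_compat_r; lra | ].
  apply Rlt_le_trans with ((CM j + 1) * (eps / (CM j + 1))).
  - apply Rmult_lt_compat_l; lra.
  - right. field. lra.
Qed.

Lemma U_derive t : is_derive U t (v t).
Proof. apply (is_derive_primitive (V := H)), Hvc. Qed.

Lemma U_continuous t : continuous U t.
Proof. apply (ex_derive_continuous (V := H)). exists (v t). apply U_derive. Qed.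

Lemma U_zero t : t <= 0 -> U t = zero.
Proof. apply (primitive_zero (V := H)), Hv0. Qed.

Lemma Lam_continuous j : (1 <= j <= m)%nat -> forall t, continuous (Lam j) t.
Proof.
  intros Hj t. apply (ex_derive_continuous (V := H)). exists (ell j t).
  apply (is_derive_primitive (V := H)), ell_continuous, Hj.
Qed.

(** Formally [Lam j] is K M_j A U; this is the weak form of that identity, which makes sense before
    A U is known to exist. *)
Lemma inner_Lam j t w : (1 <= j <= m)%nat -> inner (Lam j t) w = inner (U t) (M j w).
Proof.
  intros Hj.
  assert (E1 : is_RInt (fun s => inner (ell j s) w) 0 t (inner (Lam j t) w)).
  { apply (is_RInt_linear_comp (V := H) (W := R_NormedModule) (fun x : H => inner x w)); [apply is_linear_inner_l | ].
    apply (RInt_correct (V := H)), (ex_RInt_continuous (V := H)). intros x _. apply ell_continuous, Hj. }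
  assert (E2 : is_RInt (fun s => inner (v s) (M j w)) 0 t (inner (U t) (M j w))).
  { apply (is_RInt_linear_comp (V := H) (W := R_NormedModule) (fun x : H => inner x (M j w))); [apply is_linear_inner_l | ].
    apply (RInt_correct (V := H)), (ex_RInt_continuous (V := H)). intros x _. apply Hvc. }
  rewrite <- (is_RInt_unique (V := R_CompleteNormedModule) _ _ _ _ E1).
  rewrite <- (is_RInt_unique (V := R_CompleteNormedModule) _ _ _ _ E2).
  apply (RInt_ext (V := R_CompleteNormedModule)). intros s _.
  unfold ell. rewrite KM by exact Hj. rewrite Hvz. reflexivity.
Qed.

(** The right-hand side of the equation that A U should satisfy, read off from [Hint] by removing K.
    Freezing time at T makes it bounded on the whole line, as [volterra_solution] requires. *)
Let Theta (t : R) : H :=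
  minus (plus (Phi (Rmin t T)) (scal kappa (U (Rmin t T)))) (v (Rmin t T)).

Lemma Rmin_continuous (t : R) : continuous (fun s => Rmin s T) t.
Proof.
  apply (continuous_ext (fun s => / 2 * (s + T - Rabs (s - T)))).
  - intros s. unfold Rmin, Rabs. destruct Rle_dec; destruct Rcase_abs; lra.
  - apply (continuous_scal_r (K := R_AbsRing) (V := R_NormedModule)).
    apply (continuous_minus (V := R_NormedModule)).
    + apply (continuous_plus (V := R_NormedModule)); [apply continuous_id | apply continuous_const].
    + apply (continuous_comp (fun s => s - T) Rabs).
      * apply (continuous_minus (V := R_NormedModule)); [apply continuous_id | apply continuous_const].
      * apply continuous_Rabs.
Qed.

Lemma Theta_continuous t : continuous Theta t.
Proof.
  apply (continuous_comp (fun s => Rmin s T)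
    (fun s => minus (plus (Phi s) (scal kappa (U s))) (v s))); [apply Rmin_continuous | ].
  apply (continuous_minus (V := H)); [ | apply Hvc].
  apply (continuous_plus (V := H)); [apply HPhic | ].
  apply (continuous_scal_r (V := H)), U_continuous.
Qed.

Lemma Theta_le t : t <= T -> Theta t = minus (plus (Phi t) (scal kappa (U t))) (v t).
Proof. intros Ht. unfold Theta. rewrite Rmin_left by exact Ht. reflexivity. Qed.

Lemma Theta_zero t : t <= 0 -> Theta t = zero.
Proof.
  intros Ht. rewrite Theta_le by lra. rewrite HPhi0, U_zero, Hv0 by exact Ht.
  hilbert_ring.
Qed.

Lemma Theta_bounded : exists N, 0 <= N /\ forall t, norm (Theta t) <= N.
Proof.
  destruct (continuity_ab_maj (fun t => norm (Theta t)) 0 T HT) as [x [Hx _]].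
  { intros c _. apply continuity_pt_filterlim. apply continuous_norm_comp, Theta_continuous. }
  exists (norm (Theta x)). split; [exact (norm_ge_0 (Theta x)) | intros t].
  destruct (Rle_dec t 0) as [Ht | Ht].
  - rewrite Theta_zero by exact Ht.
    apply Rle_trans with 0; [right; exact (@norm_zero R_AbsRing H) | exact (norm_ge_0 (Theta x))].
  - replace (Theta t) with (Theta (Rmin t T)).
    + apply Hx. unfold Rmin. destruct Rle_dec; lra.
    + unfold Theta. rewrite (Rmin_left (Rmin t T)) by apply Rmin_r. reflexivity.
Qed.

(** [Z] is [A U], obtained by solving a Volterra equation because nothing is
    known a priori about the integrability of [A v]. *)
Lemma exists_AU : exists Z : R -> H,
  (forall t, continuous Z t) /\ (forall t, t <= 0 -> Z t = zero) /\
  (forall t, plus (Z t) (memory m d b M Z t) = Theta t) /\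
  (forall t, t <= T -> U t = K (Z t)).
Proof.
  destruct (damping_sum_small m d b CM (/ 2) Hd ltac:(lra)) as [lam [Hlam Hsm]].
  specialize (Hsm lam (Rle_refl _)).
  destruct Theta_bounded as [N [HN HB]].
  destruct (volterra_solution m d b M CM Hd HM HCM HCM0 lam Hlam Hsm Theta N) as [Z [HZc [HZ0 HZ]]].
  - apply Theta_continuous.
  - exact HN.
  - intros t. destruct (Rle_dec t 0) as [Ht | Ht].
    + rewrite Theta_zero by exact Ht.
      apply Rle_trans with 0; [right; exact (@norm_zero R_AbsRing H) | ].
      apply Rmult_le_pos; [exact HN | left; apply exp_pos].
    + eapply Rle_trans; [apply HB | ]. rewrite <- (Rmult_1_r N) at 1.
      apply Rmult_le_compat_l; [exact HN | ]. assert (W := exp_ineq1_le (lam * t)). nra.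
  - apply Theta_zero.
  - exists Z. split; [exact HZc | split; [exact HZ0 | split; [exact HZ | ]]].
    assert (HKZ : forall s, continuous (fun t => K (Z t)) s).
    { intros s. apply (continuous_linear_comp (V := H) (W := H) K Z s HK (HZc s)). }
    assert (HDc : forall s, continuous (fun t => minus (U t) (K (Z t))) s).
    { intros s. apply (continuous_minus (V := H)); [apply U_continuous | apply HKZ]. }
    assert (HKMZ : forall j, (1 <= j <= m)%nat -> forall s, continuous (fun t => K (M j (Z t))) s).
    { intros j Hj s. apply (continuous_linear_comp (V := H) (W := H) K _ s HK).
      apply memory_integrand_continuous with (m := m); assumption. }
    (* The weak identity [inner_Lam] bounds the mismatch in the memory by the mismatch U - K Z,
       which therefore satisfies a homogeneous Volterra inequality. *)
    assert (Hdiff : forall j s, (1 <= j <= m)%nat ->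
      norm (minus (Lam j s) (K (M j (Z s)))) <= CM j * norm (minus (U s) (K (Z s)))).
    { intros j s Hj. assert (Q := HCM0 j Hj). assert (Q2 := norm_ge_0 (minus (U s) (K (Z s)))).
      apply norm_le_of_inner; [apply Rmult_le_pos; assumption | intros w].
      rewrite inner_minus_l, inner_Lam, KM, <- inner_minus_l by exact Hj.
      eapply Rle_trans; [apply inner_le_norm | ].
      apply Rle_trans with (norm (minus (U s) (K (Z s))) * (CM j * norm w)); [ | right; ring].
      apply Rmult_le_compat_l; [exact Q2 | apply HCM, Hj]. }
    assert (HDeq : forall t, t <= T -> minus (U t) (K (Z t)) =
      opp (sum_n_m (fun j => delay_int (d j) (b j) (fun s => minus (Lam j s) (K (M j (Z s)))) t) 1 m)).
    { intros t Ht.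
      assert (E1 : sum_n_m (fun j => delay_int (d j) (b j) (fun s => minus (Lam j s) (K (M j (Z s)))) t) 1 m
        = minus (sum_n_m (fun j => delay_int (d j) (b j) (Lam j) t) 1 m) (K (memory m d b M Z t))).
      { unfold memory. rewrite (sum_n_m_linear (V := H) (W := H) K _ 1 m HK).
        etransitivity; [ | exact (sum_n_m_minus _ _ 1 m)].
        apply sum_n_m_ext_loc. intros j Hj.
        rewrite delay_int_minus; [ | apply Hd, Hj | apply Lam_continuous, Hj | apply HKMZ, Hj].
        f_equal. apply (delay_int_linear (V := H) (W := H) K (d j) (b j) (Hd j Hj) (fun s => M j (Z s)) t HK).
        apply memory_integrand_continuous with (m := m); assumption. }
      rewrite E1. clear E1.
      assert (E2 := Hint t Ht). assert (E3 := f_equal K (HZ t)). rewrite Theta_le in E3 by exact Ht.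
      rewrite (linear_plus _ HK), (linear_minus _ _ _ HK), <- E2 in E3.
      set (S := sum_n_m (fun j => delay_int (d j) (b j) (Lam j) t) 1 m) in *.
      apply inner_ext. intros w. assert (E4 := f_equal (fun x => inner x w) E3). simpl in E4.
      revert E4. inner_simpl. lra. }
    intros t Ht.
    (* Uniqueness: [weighted_absorb] with a = 0. *)
    assert (W : norm (minus (U t) (K (Z t))) <= 2 * 0 * exp (lam * t)).
    { apply (weighted_absorb (fun s => norm (minus (U s) (K (Z s)))) lam T 0); try lra.
      - intros s. apply (continuous_norm_comp (fun t => minus (U t) (K (Z t)))), HDc.
      - intros s. exact (norm_ge_0 (minus (U s) (K (Z s)))).
      - intros s Hs. assert (EK : K (Z s) = zero) by (rewrite HZ0 by exact Hs; exact (linear_zero _ HK)).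
        rewrite U_zero, EK by exact Hs.
        match goal with |- norm ?x = _ => replace x with (zero : H) by hilbert_ring end.
        exact (@norm_zero R_AbsRing H).
      - intros N' HN' HXN s Hs. rewrite (HDeq s Hs).
        apply Rle_trans with (norm (sum_n_m (fun j => delay_int (d j) (b j)
          (fun r => minus (Lam j r) (K (M j (Z r)))) s) 1 m)); [right; exact (@norm_opp R_AbsRing H _) | ].
        eapply Rle_trans.
        + apply (sum_delay_weighted m d b CM (fun j r => minus (Lam j r) (K (M j (Z r)))) lam N' s Hd).
          * intros j Hj r. apply (continuous_minus (V := H)); [apply Lam_continuous, Hj | apply HKMZ, Hj].
          * intros j Hj r Hr. eapply Rle_trans; [apply Hdiff, Hj | ].
            apply Rmult_le_compat_l; [apply HCM0, Hj | apply HXN; lra].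
        + assert (Pe := exp_pos (lam * s)).
          apply Rle_trans with (N' * exp (lam * s) * / 2); [ | right; field].
          apply Rmult_le_compat_l; [nra | exact Hsm]. }
    assert (W2 : norm (minus (U t) (K (Z t))) = 0).
    { apply Rle_antisym; [lra | exact (norm_ge_0 (minus (U t) (K (Z t))))]. }
    apply norm_eq_zero in W2. apply (plus_reg_r (opp (K (Z t)))). rewrite plus_opp_r. exact W2.
Qed.

(** The energy estimate is applied to X = D_k D_h Z and Y = D_k D_h U. The source D_k D_h Phi need
    not be of size h k at each time; it is its majorant D_k D_h P whose time integral is at most L h
    k. *)
Lemma second_difference_bound : exists C, 0 <= C /\
  forall h k t, 0 < h -> 0 < k -> t <= T -> norm (bdiff k (bdiff h U) t) <= C * h * k.
Proof.
  destruct exists_AU as [Z [HZc [HZ0 [HZ HUZ]]]].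
  destruct (energy_parameters m d b CE Hd HCE0 kappa) as [mu [lam [Hmu [Hkl [Hlam Hpar]]]]].
  exists (2 * L * exp (lam * T)).
  split; [assert (W := exp_pos (lam * T)); apply Rmult_le_pos; lra | ].
  intros h k t Hh Hk Ht.
  destruct (Rle_dec t 0) as [Ht0 | Ht0].
  { replace (bdiff k (bdiff h U) t) with (zero : H).
    2: { symmetry. apply (bdiff_zero (V := H)); [lra | | exact Ht0].
         intros s Hs. apply (bdiff_zero (V := H)); [lra | exact U_zero | exact Hs]. }
    apply Rle_trans with 0; [right; exact (@norm_zero R_AbsRing H) | ].
    assert (W := exp_pos (lam * T)). repeat apply Rmult_le_pos; lra. }
  set (Q := fun t => RInt (V := R_CompleteNormedModule) P 0 t).
  assert (HQ : forall s, is_derive Q s (P s)) by (intros s; apply (is_derive_primitive (V := R_CompleteNormedModule)), HPc).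
  assert (HQ0 : forall s, s <= 0 -> Q s = 0).
  { intros s Hs. apply (primitive_zero (V := R_CompleteNormedModule)); assumption. }
  (* [Q] is the primitive of [P], so this is the time integral of the majorant; it equals the
     increment of D_h Q over [T - k, T], whose derivative D_h P is at most L h. *)
  assert (HI : bdiff (G := R_AbelianGroup) k (bdiff (G := R_AbelianGroup) h Q) T <= L * h * k).
  { unfold bdiff at 1.
    change (bdiff (G := R_AbelianGroup) h Q T - bdiff (G := R_AbelianGroup) h Q (T - k) <= L * h * k).
    replace (L * h * k) with (L * h * T - L * h * (T - k)) by ring.
    apply (derive_compare (bdiff (G := R_AbelianGroup) h Q) (fun s => L * h * s)
      (bdiff (G := R_AbelianGroup) h P) (fun _ => L * h) (T - k) T); [lra | | | ].
    - intros x _. apply (bdiff_derive (V := R_NormedModule) h Q P x HQ).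
    - intros x _. auto_derive; [trivial | ring].
    - intros x _. apply HPLip, Hh. }
  eapply Rle_trans.
  - apply (energy_estimate m d b K M CE Hd HM HK Kpos HCE0 HCE
      (bdiff k (bdiff h Z)) (bdiff k (bdiff h U)) (bdiff k (bdiff h v)) (bdiff k (bdiff h Phi))
      (bdiff (G := R_AbelianGroup) k (bdiff (G := R_AbelianGroup) h P))
      (bdiff (G := R_AbelianGroup) k (bdiff (G := R_AbelianGroup) h Q)) kappa lam mu T).
    + intros s. apply (bdiff_continuous (V := H)). intros x. apply (bdiff_continuous (V := H)), HZc.
    + intros s. apply (bdiff_derive (V := H)). intros x. apply (bdiff_derive (V := H)). apply U_derive.
    + intros s Hs. apply (bdiff_zero (V := H)); [lra | | exact Hs].
      intros r Hr. apply (bdiff_zero (V := H)); [lra | exact HZ0 | exact Hr].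
    + apply (bdiff_zero (V := H)); [lra | | lra].
      intros r Hr. apply (bdiff_zero (V := H)); [lra | exact U_zero | exact Hr].
    + intros s Hs. unfold bdiff. rewrite !(linear_minus _ _ _ HK), <- !HUZ by lra. reflexivity.
    + intros s Hs.
      assert (E : forall r, r <= T -> Phi r =
        minus (plus (plus (v r) (Z r)) (memory m d b M Z r)) (scal kappa (U r))).
      { intros r Hr. assert (E := HZ r). rewrite Theta_le in E by exact Hr.
        apply inner_ext. intros w. assert (E' := f_equal (fun x => inner x w) E). simpl in E'.
        revert E'. inner_simpl. lra. }
      assert (Em : memory m d b M (bdiff k (bdiff h Z)) s =
        minus (minus (memory m d b M Z s) (memory m d b M Z (s - h)))
          (minus (memory m d b M Z (s - k)) (memory m d b M Z (s - k - h)))).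
      { assert (Hsh : forall c x, continuous (fun s => Z (s - c)) x) by (intros c x; apply (continuous_shift (V := H)), HZc).
        unfold bdiff. rewrite (memory_minus m d b M Hd HM (fun s => minus (Z s) (Z (s - h)))
          (fun s => minus (Z (s - k)) (Z (s - k - h)))).
        - rewrite (memory_minus m d b M Hd HM Z (fun s => Z (s - h)) s HZc (Hsh h)).
          rewrite (memory_shift m d b M (fun s => minus (Z s) (Z (s - h))) k s).
          rewrite (memory_minus m d b M Hd HM Z (fun s => Z (s - h)) (s - k) HZc (Hsh h)).
          rewrite !(memory_shift m d b M Z h). reflexivity.
        - intros x. apply (continuous_minus (V := H)); [apply HZc | apply Hsh].
        - intros x. apply (continuous_shift (V := H) (fun s => minus (Z s) (Z (s - h))) k).
          intros y. apply (continuous_minus (V := H)); [apply HZc | apply Hsh]. }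
      rewrite Em. unfold bdiff. rewrite !E by lra. hilbert_ring.
    + intros s Hs. apply HPhiP; assumption.
    + intros s. apply (bdiff_derive (V := R_NormedModule)). intros x.
      apply (bdiff_derive (V := R_NormedModule)). exact HQ.
    + unfold bdiff. rewrite !HQ0 by lra. change (0 - 0 - (0 - 0) = 0). ring.
    + exact Hmu.
    + exact Hlam.
    + exact Hkl.
    + exact HT.
    + exact Hpar.
    + exact Ht.
    + lra.
  - assert (W : exp (lam * t) <= exp (lam * T)).
    { destruct (Req_dec (lam * t) (lam * T)) as [E | E]; [rewrite E; lra | ].
      left. apply exp_increasing. nra. }
    assert (W2 := exp_pos (lam * t)).
    apply Rle_trans with (2 * (L * h * k) * exp (lam * t)).
    + apply Rmult_le_compat_r; lra.
    + apply Rle_trans with (2 * (L * h * k) * exp (lam * T)); [ | right; ring].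
      apply Rmult_le_compat_l; [ | exact W]. repeat apply Rmult_le_pos; lra.
Qed.

(** Divide the second difference bound by k and let k tend to 0: D_h U has derivative D_h v. *)
Lemma v_lipschitz : exists C, 0 <= C /\
  forall h t, 0 < h -> t <= T -> norm (bdiff h v t) <= C * h.
Proof.
  destruct second_difference_bound as [C [HC Hb]]. exists C. split; [exact HC | ].
  intros h t Hh Ht.
  apply (norm_derive_bound_left (bdiff h U) t _ _ 1).
  - apply Rmult_le_pos; lra.
  - apply (bdiff_derive (V := H)). apply U_derive.
  - lra.
  - intros k Hk. apply Hb; tauto.
Qed.

(** Once [v] is Lipschitz, so is the right-hand side of the Volterra equation for Z = A U; hence Z
    is Lipschitz, and [z] is its derivative in the weak sense. *)
Lemma z_bounded : exists C, 0 <= C /\ forall t, t <= T -> norm (z t) <= C.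
Proof.
  destruct v_lipschitz as [C [HC HvL]].
  destruct exists_AU as [Z [HZc [HZ0 [HZ HUZ]]]].
  destruct (damping_sum_small m d b CM (/ 2) Hd ltac:(lra)) as [lam [Hlam Hsm]].
  specialize (Hsm lam (Rle_refl _)).
  assert (Hvb : forall t, t <= T -> norm (v t) <= C * (T + 1)).
  { intros t Ht. destruct (Rle_dec t 0) as [Ht0 | Ht0].
    - rewrite Hv0 by exact Ht0.
      apply Rle_trans with 0; [right; exact (@norm_zero R_AbsRing H) | nra].
    - assert (W := HvL t t ltac:(lra) Ht).
      (* The step h = t reaches back to time 0, where [v] vanishes. *)
      assert (E : bdiff t v t = v t) by (unfold bdiff; rewrite (Hv0 (t - t)) by lra; hilbert_ring).
      rewrite E in W. nra. }
  assert (HUL : forall h t, 0 < h -> t <= T -> norm (bdiff h U t) <= C * (T + 1) * h).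
  { intros h t Hh Ht.
    replace (C * (T + 1) * h) with ((t - (t - h)) * (C * (T + 1))) by ring.
    apply (norm_RInt_le_const v (t - h) t); [lra | | apply (is_RInt_primitive (V := H)), Hvc].
    intros x Hx. apply Hvb. lra. }
  (* The Lipschitz constant of Phi + kappa U - v, term by term. *)
  set (C3 := LPhi + Rabs kappa * (C * (T + 1)) + C).
  assert (HC3 : 0 <= C3).
  { assert (W := Rabs_pos kappa). assert (W2 : 0 <= C * (T + 1)) by nra. unfold C3. nra. }
  assert (HZL : forall h t, 0 < h -> t <= T -> norm (bdiff h Z t) <= 2 * (C3 * h) * exp (lam * T)).
  { intros h t Hh Ht.
    apply Rle_trans with (2 * (C3 * h) * exp (lam * t)).
    - apply (volterra_bound m d b M CM Hd HM HCM HCM0 lam Hlam Hsm (bdiff h Z) (C3 * h) T); try assumption.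
      + intros s. apply (bdiff_continuous (V := H)), HZc.
      + intros s Hs. apply (bdiff_zero (V := H)); [lra | exact HZ0 | exact Hs].
      + apply Rmult_le_pos; lra.
      + intros s Hs. unfold bdiff at 2.
        rewrite (memory_minus m d b M Hd HM Z (fun s => Z (s - h)) s HZc)
          by (intros; apply (continuous_shift (V := H)), HZc).
        rewrite (memory_shift m d b M Z h s).
        match goal with |- norm ?x <= _ =>
          replace x with (minus (plus (bdiff h Phi s) (scal kappa (bdiff h U s))) (bdiff h v s)) end.
        * eapply Rle_trans; [apply norm_minus_le | ]. unfold C3.
          apply Rle_trans with ((LPhi * h + Rabs kappa * (C * (T + 1) * h)) + C * h); [ | right; ring].
          apply Rplus_le_compat; [ | apply HvL; assumption].
          eapply Rle_trans; [exact (@norm_triangle R_AbsRing H _ _) | ].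
          apply Rplus_le_compat; [apply HPhiLip; assumption | ].
          apply Rle_trans with (Rabs kappa * norm (bdiff h U s)).
          { right. apply norm_scal_eq. }
          apply Rmult_le_compat_l; [apply Rabs_pos | apply HUL; assumption].
        * assert (E1 := HZ s). assert (E2 := HZ (s - h)).
          rewrite Theta_le in E1 by lra. rewrite Theta_le in E2 by lra. unfold bdiff.
          apply inner_ext. intros w.
          assert (E1' := f_equal (fun x => inner x w) E1). assert (E2' := f_equal (fun x => inner x w) E2).
          simpl in E1', E2'. revert E1' E2'. inner_simpl. lra.
    - apply Rmult_le_compat_l; [apply Rmult_le_pos; [lra | apply Rmult_le_pos; lra] | ].
      destruct (Req_dec (lam * t) (lam * T)) as [E | E]; [rewrite E; lra | ].
      left. apply exp_increasing. nra. }
  set (C4 := 2 * C3 * exp (lam * T)).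
  assert (HC4 : 0 <= C4) by (assert (W := exp_pos (lam * T)); unfold C4; nra).
  exists C4. split; [exact HC4 | intros t Ht].
  (* Differentiability of Z is not known, but <z, K w> = <v, w> is the derivative of <U, w>, and
     increments of <U, w> are those of <Z, K w>. The range of K is dense, so such test vectors
     suffice. *)
  assert (Hw : forall w, Rabs (inner (z t) (K w)) <= C4 * norm (K w)).
  { intros w. rewrite <- Ksym, Hvz.
    apply (derive_bound_left (fun s => inner (U s) w) t _ _ 1); [apply derive_inner, U_derive | lra | ].
    intros h Hh. rewrite <- inner_minus_l, !HUZ by lra.
    rewrite <- (linear_minus _ _ _ HK), Ksym.
    eapply Rle_trans; [apply cauchy_schwarz | ].
    replace (C4 * norm (K w) * h) with (2 * (C3 * h) * exp (lam * T) * norm (K w)) by (unfold C4; ring).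
    apply Rmult_le_compat_r; [exact (norm_ge_0 (K w)) | ]. apply HZL; tauto. }
  apply (norm_le_of_dense (fun y => exists w, y = K w)); [ | exact HC4 | ].
  - intros y eps Heps. destruct (Kdense y eps Heps) as [w Hwy].
    exists (K w). split; [exists w; reflexivity | exact Hwy].
  - intros y [w ->]. eapply Rle_trans; [apply Rle_abs | apply Hw].
Qed.

End APriori.

(** ** Powers, cut-offs and the memory integral *)

(** [Rpower x p] is 1 for x <= 0; the value 0 makes the power continuous and monotone on the whole
    line for p > 0. *)
Definition pos_power (p x : R) : R := if Rle_dec x 0 then 0 else Rpower x p.

Lemma pos_power_neg (p x : R) : x <= 0 -> pos_power p x = 0.
Proof. intros Hx. unfold pos_power. destruct Rle_dec; [reflexivity | contradiction]. Qed.

Lemma pos_power_pos (p x : R) : 0 < x -> pos_power p x = Rpower x p.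
Proof. intros Hx. unfold pos_power. destruct Rle_dec; [lra | reflexivity]. Qed.

Lemma pos_power_ge_0 (p x : R) : 0 <= pos_power p x.
Proof. unfold pos_power. destruct Rle_dec; [lra | left; apply exp_pos]. Qed.

Lemma pos_power_mono (p x y : R) : 0 <= p -> x <= y -> pos_power p x <= pos_power p y.
Proof.
  intros Hp Hxy. destruct (Rle_dec x 0) as [Hx | Hx].
  - rewrite (pos_power_neg p x Hx). apply pos_power_ge_0.
  - rewrite !pos_power_pos by lra. apply Rle_Rpower_l; lra.
Qed.

Lemma pos_power_inv (p x : R) : p <> 0 -> 0 < x -> pos_power (/ p) (pos_power p x) = x.
Proof.
  intros Hp Hx. rewrite (pos_power_pos p x Hx), pos_power_pos by apply exp_pos.
  rewrite Rpower_mult, Rinv_r by exact Hp. apply Rpower_1, Hx.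
Qed.

Lemma Rpower_derive (p x : R) : 0 < x -> is_derive (fun s => Rpower s p) x (p * Rpower x (p - 1)).
Proof.
  intros Hx. apply is_derive_Reals. apply derivable_pt_lim_power, Hx.
Qed.

Lemma pos_power_continuous (p x : R) : 0 < p -> continuous (pos_power p) x.
Proof.
  intros Hp. destruct (Rtotal_order x 0) as [Hx | [Hx | Hx]].
  - apply (continuous_ext_loc _ (fun _ => 0)); [ | apply continuous_const].
    exists (mkposreal (- x) ltac:(lra)). intros y Hy. change (Rabs (y - x) < - x) in Hy.
    apply Rabs_lt_between in Hy. rewrite pos_power_neg by lra. reflexivity.
  - subst x. apply filterlim_locally. intros eps. assert (He := cond_pos eps).
    exists (mkposreal (Rpower eps (/ p)) (exp_pos _)). intros y Hy.
    change (Rabs (y - 0) < Rpower eps (/ p)) in Hy. rewrite Rminus_0_r in Hy.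
    change (Rabs (pos_power p y - pos_power p 0) < eps).
    rewrite (pos_power_neg p 0), Rminus_0_r by lra.
    rewrite Rabs_pos_eq by apply pos_power_ge_0.
    destruct (Rle_dec y 0) as [Hy0 | Hy0]; [rewrite pos_power_neg by exact Hy0; exact He | ].
    rewrite Rabs_pos_eq in Hy by lra. rewrite pos_power_pos by lra.
    apply Rlt_le_trans with (Rpower (Rpower eps (/ p)) p).
    + apply Rlt_Rpower_l; lra.
    + right. rewrite Rpower_mult, Rinv_l by lra. apply Rpower_1, He.
  - apply (continuous_ext_loc _ (fun s => Rpower s p)).
    + exists (mkposreal x Hx). intros y Hy. change (Rabs (y - x) < x) in Hy.
      apply Rabs_lt_between in Hy. rewrite pos_power_pos by lra. reflexivity.
    + apply (ex_derive_continuous (V := R_NormedModule)). eexists. apply Rpower_derive, Hx.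
Qed.

(** With length T^a the delays s^(1/a) run up to T, hence cover the full history of every t <= T. *)
Lemma pos_power_delay (a T : R) : 0 < a -> is_delay (pos_power (/ a)) (pos_power a T).
Proof.
  intros Ha. assert (Hi := Rinv_0_lt_compat a Ha). split.
  - apply pos_power_ge_0.
  - intros s. apply pos_power_continuous, Hi.
  - apply pos_power_ge_0.
  - intros s Hs. rewrite pos_power_pos by exact Hs. apply exp_pos.
Qed.

(** Extends a function known on (0, T] to a globally continuous one; [l] is meant to be its right
    limit at 0, which may differ from [f 0]. *)
Definition cutoff {V : Type} (f : R -> V) (l : V) (T t : R) : V :=
  if Rle_dec t 0 then l else f (Rmin t T).

Lemma cutoff_neg {V : Type} (f : R -> V) (l : V) (T t : R) : t <= 0 -> cutoff f l T t = l.
Proof. intros Ht. unfold cutoff. destruct Rle_dec; [reflexivity | contradiction]. Qed.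

Lemma cutoff_pos {V : Type} (f : R -> V) (l : V) (T t : R) : 0 < t <= T -> cutoff f l T t = f t.
Proof.
  intros Ht. unfold cutoff. destruct Rle_dec; [lra | ]. rewrite Rmin_left by lra. reflexivity.
Qed.

Lemma cutoff_continuous {H : HilbertSpace} (f : R -> H) (l : H) (T t : R) :
  0 < T -> filterlim f (at_right 0) (locally l) -> (forall s, 0 < s <= T -> continuous f s) ->
  continuous (cutoff f l T) t.
Proof.
  intros HT Hl Hf. apply continuous_norm_minus. intros eps.
  assert (Hz : forall x : H, norm (minus x x) < eps).
  { intros x. replace (minus x x) with (zero : H) by hilbert_ring.
    apply Rle_lt_trans with 0; [right; exact (@norm_zero R_AbsRing H) | apply cond_pos]. }
  destruct (Rtotal_order t 0) as [Ht | [Ht | Ht]].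
  - exists (mkposreal (- t) ltac:(lra)). intros s Hs. simpl in Hs. apply Rabs_lt_between in Hs.
    rewrite !cutoff_neg by lra. apply Hz.
  - subst t. destruct (proj1 (filterlim_norm_minus (at_right 0) _ f l) Hl eps) as [delta Hdelta].
    exists (mkposreal _ (Rmin_stable_in_posreal delta (mkposreal T HT))). intros s Hs. simpl in Hs.
    assert (H1 := Rlt_le_trans _ _ _ Hs (Rmin_l _ _)). assert (H2 := Rlt_le_trans _ _ _ Hs (Rmin_r _ _)).
    apply Rabs_lt_between in H2. rewrite (cutoff_neg f l T 0) by lra.
    destruct (Rle_dec s 0) as [Hs0 | Hs0]; [rewrite cutoff_neg by exact Hs0; apply Hz | ].
    rewrite cutoff_pos by lra. apply Hdelta; [exact H1 | lra].
  - assert (Hc : 0 < Rmin t T <= T) by (split; [apply Rmin_glb_lt; assumption | apply Rmin_r]).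
    destruct (proj1 (continuous_norm_minus f _) (Hf _ Hc) eps) as [delta Hdelta].
    exists (mkposreal _ (Rmin_stable_in_posreal delta (mkposreal t Ht))). intros s Hs. simpl in Hs.
    assert (H1 := Rlt_le_trans _ _ _ Hs (Rmin_l _ _)). assert (H2 := Rlt_le_trans _ _ _ Hs (Rmin_r _ _)).
    apply Rabs_lt_between in H2. unfold cutoff.
    destruct (Rle_dec s 0); [lra | ]. destruct (Rle_dec t 0); [lra | ].
    apply Hdelta. eapply Rle_lt_trans; [ | exact H1].
    unfold Rmin, Rabs. repeat destruct Rle_dec; repeat destruct Rcase_abs; lra.
Qed.

(** The substitution r = (t - s)^a has dr = - a (t - s)^(a-1) ds and so absorbs the kernel; the
    minus sign reflects the reversed orientation. *)
Lemma memory_kernel_RInt (a t x y : R) (q psi : R -> R) :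
  0 < a -> (forall s, continuous psi s) -> (forall s, 0 < s < t -> q s = psi s) ->
  0 < x -> x < y -> y < t ->
  is_RInt (fun s => omega a (t - s) * q s) x y
    (- (/ a * / Gamma a) * RInt (fun s => psi (t - pos_power (/ a) s))
        (pos_power a (t - x)) (pos_power a (t - y))).
Proof.
  intros Ha Hpsi Hq Hx Hxy Hy.
  set (chi := fun s => psi (t - pos_power (/ a) s)).
  assert (Hchi : forall s, continuous chi s).
  { intros s. apply (continuous_comp (fun s => t - pos_power (/ a) s) psi); [ | apply Hpsi].
    apply (continuous_minus (V := R_NormedModule)); [apply continuous_const | ].
    apply pos_power_continuous, Rinv_0_lt_compat, Ha. }
  rewrite !pos_power_pos by lra.
  assert (HD : forall s, s < t -> is_derive (fun s => Rpower (t - s) a) s (- (a * Rpower (t - s) (a - 1)))).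
  { intros s Hs.
    assert (E : is_derive (fun s => t - s) s (-1)) by (auto_derive; [trivial | ring]).
    assert (W := is_derive_comp (V := R_NormedModule) (fun r => Rpower r a) (fun s => t - s) s _ _
      (Rpower_derive a (t - s) ltac:(lra)) E).
    replace (- (a * Rpower (t - s) (a - 1))) with (scal (-1) (a * Rpower (t - s) (a - 1)))
      by (unfold scal; simpl; unfold mult; simpl; ring).
    exact W. }
  assert (W := is_RInt_comp (V := R_CompleteNormedModule) chi (fun s => Rpower (t - s) a)
    (fun s => - (a * Rpower (t - s) (a - 1))) x y).
  assert (W1 := W (fun s _ => Hchi _)). clear W.
  assert (HC : forall s, s < t -> continuous (fun s => - (a * Rpower (t - s) (a - 1))) s).
  { intros s Hs.
    apply (continuous_opp (V := R_NormedModule) (fun s => a * Rpower (t - s) (a - 1))).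
    apply (continuous_scal_r (K := R_AbsRing) (V := R_NormedModule) a (fun s => Rpower (t - s) (a - 1))).
    apply (continuous_comp (fun s => t - s) (fun r => Rpower r (a - 1))).
    - apply (continuous_minus (V := R_NormedModule)); [apply continuous_const | apply continuous_id].
    - apply (ex_derive_continuous (V := R_NormedModule) (fun r => Rpower r (a - 1))).
      eexists. apply Rpower_derive. lra. }
  rewrite Rmin_left, Rmax_right in W1 by lra.
  assert (W2 := W1 (fun s Hs => conj (HD s ltac:(lra)) (HC s ltac:(lra)))).
  assert (W3 := is_RInt_scal (V := R_NormedModule) _ _ _ (- (/ a * / Gamma a)) _ W2).
  apply (is_RInt_ext (V := R_NormedModule)) with (2 := W3).
  intros s Hs. rewrite Rmin_left, Rmax_right in Hs by lra.
  unfold scal; simpl; unfold mult; simpl. unfold chi, omega.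
  rewrite <- (pos_power_pos a (t - s)), pos_power_inv by lra.
  replace (t - (t - s)) with s by ring. rewrite Hq by lra.
  unfold Rdiv. set (r := Rpower (t - s) (a - 1)). set (G := / Gamma a).
  transitivity ((/ a * a) * (r * G * psi s)); [ring | rewrite Rinv_l by lra; ring].
Qed.

(** Over [x, y] the integral is c (Y x - Y y), where Y x, the primitive of the substituted integrand
    at (t - x)^a, is continuous up to both endpoints and Y t = 0. The improper integral can then
    only be c Y 0. *)
Lemma memory_kernel_limit (a t l : R) (q psi : R -> R) :
  0 < a -> 0 < t -> (forall s, continuous psi s) -> (forall s, 0 < s < t -> q s = psi s) ->
  is_RInt_gen (V := R_NormedModule) (fun s => omega a (t - s) * q s) (at_right 0) (at_left t) l ->
  l = / a * / Gamma a * RInt (fun s => psi (t - pos_power (/ a) s)) 0 (pos_power a t).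
Proof.
  intros Ha Ht Hpsi Hq Hl.
  set (chi := fun s => psi (t - pos_power (/ a) s)).
  assert (Hchi : forall s, continuous chi s).
  { intros s. apply (continuous_comp (fun s => t - pos_power (/ a) s) psi); [ | apply Hpsi].
    apply (continuous_minus (V := R_NormedModule)); [apply continuous_const | ].
    apply pos_power_continuous, Rinv_0_lt_compat, Ha. }
  set (X := fun s => RInt (V := R_CompleteNormedModule) chi 0 s).
  set (Y := fun x => X (pos_power a (t - x))).
  assert (HYc : forall x, continuous Y x).
  { intros x. apply (continuous_comp (fun x => pos_power a (t - x)) X).
    - apply (continuous_comp (fun x => t - x) (pos_power a)); [ | apply pos_power_continuous, Ha].
      apply (continuous_minus (V := R_NormedModule)); [apply continuous_const | apply continuous_id].
    - apply (ex_derive_continuous (V := R_NormedModule) X). eexists.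
      apply (is_derive_primitive (V := R_CompleteNormedModule)), Hchi. }
  assert (HY0 : Y 0 = RInt chi 0 (pos_power a t)) by (unfold Y; rewrite Rminus_0_r; reflexivity).
  assert (HYt : Y t = 0).
  { unfold Y. rewrite Rminus_diag, pos_power_neg by lra. exact (RInt_point (V := R_CompleteNormedModule) 0 chi). }
  set (c := / a * / Gamma a). transitivity (c * Y 0); [ | unfold c; f_equal; exact HY0]. apply cond_eq. intros eps Heps.
  set (e := eps / (4 * (Rabs c + 1))). assert (Hc := Rabs_pos c).
  assert (He : 0 < e) by (apply Rdiv_lt_0_compat; lra).
  assert (F1 : filter_prod (at_right 0) (at_left t) (fun ab => exists y,
    is_RInt (fun s => omega a (t - s) * q s) (fst ab) (snd ab) y /\ Rabs (y - l) < eps / 2)).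
  { apply (Hl (fun y => Rabs (y - l) < eps / 2)).
    exists (mkposreal (eps / 2) ltac:(lra)). intros y Hy. exact Hy. }
  assert (F2 : filter_prod (at_right 0) (at_left t) (fun ab =>
    0 < fst ab /\ fst ab < snd ab /\ snd ab < t /\ Rabs (Y (fst ab) - Y 0) < e /\ Rabs (Y (snd ab) - Y t) < e)).
  { destruct (proj1 (filterlim_locally Y (Y 0)) (HYc 0) (mkposreal _ He)) as [d1 H1].
    destruct (proj1 (filterlim_locally Y (Y t)) (HYc t) (mkposreal _ He)) as [d2 H2].
    apply Filter_prod with (Q := fun x => 0 < x < t / 2 /\ Rabs (Y x - Y 0) < e)
      (R := fun y => t / 2 < y < t /\ Rabs (Y y - Y t) < e).
    - exists (mkposreal _ (Rmin_stable_in_posreal d1 (mkposreal (t / 2) ltac:(lra)))).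
      intros x Hx Hx0. change (Rabs (x - 0) < Rmin d1 (t / 2)) in Hx.
      assert (A1 := Rlt_le_trans _ _ _ Hx (Rmin_l _ _)). assert (A2 := Rlt_le_trans _ _ _ Hx (Rmin_r _ _)).
      apply Rabs_lt_between in A2. split; [lra | exact (H1 x A1)].
    - exists (mkposreal _ (Rmin_stable_in_posreal d2 (mkposreal (t / 2) ltac:(lra)))).
      intros x Hx Hx0. change (Rabs (x - t) < Rmin d2 (t / 2)) in Hx.
      assert (A1 := Rlt_le_trans _ _ _ Hx (Rmin_l _ _)). assert (A2 := Rlt_le_trans _ _ _ Hx (Rmin_r _ _)).
      apply Rabs_lt_between in A2. split; [lra | exact (H2 x A1)].
    - intros x y [Hx Hx1] [Hy Hy1]. simpl. repeat split; try assumption; lra. }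
  (* One pair (x, y) at which both eventual properties hold is enough to compare [l] with c * Y
     0. *)
  destruct (filter_ex _ (filter_and _ _ F1 F2)) as [[x y] [[r [Hr Hrl]] [Hx [Hxy [Hy [HYx HYy]]]]]].
  simpl in *.
  assert (W := memory_kernel_RInt a t x y q psi Ha Hpsi Hq Hx Hxy Hy).
  assert (E : r = - c * RInt chi (pos_power a (t - x)) (pos_power a (t - y))).
  { rewrite <- (is_RInt_unique (V := R_CompleteNormedModule) _ _ _ _ Hr).
    exact (is_RInt_unique (V := R_CompleteNormedModule) _ _ _ _ W). }
  rewrite (is_RInt_unique (V := R_CompleteNormedModule) _ _ _ _
    (is_RInt_primitive (V := R_CompleteNormedModule) chi _ _ Hchi)) in E.
  change (r = - c * (Y y - Y x)) in E. rewrite HYt, Rminus_0_r in HYy.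
  replace (l - c * Y 0) with (- (r - l) + (c * (Y x - Y 0) - c * Y y)) by (rewrite E; ring).
  apply Rle_lt_trans with (Rabs (r - l) + (Rabs c * e + Rabs c * e)).
  - eapply Rle_trans; [apply Rabs_triang | ]. rewrite Rabs_Ropp. apply Rplus_le_compat_l.
    eapply Rle_trans; [apply Rabs_triang | ]. rewrite Rabs_Ropp, !Rabs_mult.
    apply Rplus_le_compat; apply Rmult_le_compat_l; lra.
  - assert (Q : (Rabs c + 1) * e = eps / 4) by (unfold e; field; lra). nra.
Qed.

Lemma is_RInt_gen_linear_comp {V W : NormedModule R_AbsRing} (L : V -> W) (f : R -> V)
  (Fa Fb : (R -> Prop) -> Prop) (FFa : Filter Fa) (FFb : Filter Fb) (l : V) :
  is_linear L -> is_RInt_gen f Fa Fb l -> is_RInt_gen (fun s => L (f s)) Fa Fb (L l).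
Proof.
  intros HL Hf P HP.
  assert (HLP : locally l (fun y => P (L y))) by exact (linear_cont L l HL P HP).
  apply (filter_imp (F := filter_prod Fa Fb)) with (2 := Hf _ HLP).
  intros ab [y [Hy HPy]]. exists (L y). split; [apply is_RInt_linear_comp; assumption | exact HPy].
Qed.

(** Since [phi] vanishes before time 0, the integral may run to T^a in place of t^a, so the delay
    integral has limits independent of [t]. The constant part [k], the contribution of the initial
    value, produces k t^a. *)
Lemma memory_integral_delay (a t T k l : R) (q phi : R -> R) :
  0 < a -> 0 < t <= T -> (forall s, continuous phi s) -> (forall s, s <= 0 -> phi s = 0) ->
  (forall s, 0 < s < t -> q s = k + phi s) ->
  is_RInt_gen (V := R_NormedModule) (fun s => omega a (t - s) * q s) (at_right 0) (at_left t) l ->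
  l = / a * / Gamma a * (k * pos_power a t
    + delay_int (V := R_CompleteNormedModule) (pos_power (/ a)) (pos_power a T) phi t).
Proof.
  intros Ha Ht Hphi Hphi0 Hq Hl.
  rewrite (memory_kernel_limit a t l q (fun s => k + phi s) Ha (proj1 Ht)) at 1; [ | | exact Hq | exact Hl].
  - f_equal. assert (Hdel := pos_power_delay a T Ha).
    assert (HI : forall u v, ex_RInt (fun s => phi (t - pos_power (/ a) s)) u v).
    { intros u v. apply (ex_RInt_continuous (V := R_CompleteNormedModule)). intros s _.
      apply (delay_integrand_continuous (V := R_CompleteNormedModule) _ _ Hdel). exact Hphi. }
    apply (is_RInt_unique (V := R_CompleteNormedModule)).
    apply (is_RInt_plus (V := R_NormedModule) (fun _ => k) (fun s => phi (t - pos_power (/ a) s))).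
    + replace (k * pos_power a t) with (scal (pos_power a t - 0) k).
      * apply (is_RInt_const (V := R_NormedModule)).
      * unfold scal; simpl; unfold mult; simpl. ring.
    + replace (delay_int (V := R_CompleteNormedModule) (pos_power (/ a)) (pos_power a T) phi t)
        with (RInt (V := R_CompleteNormedModule) (fun s => phi (t - pos_power (/ a) s)) 0 (pos_power a t)).
      * apply (RInt_correct (V := R_CompleteNormedModule)), HI.
      * unfold delay_int.
        rewrite <- (RInt_Chasles (V := R_CompleteNormedModule) _ 0 (pos_power a t) (pos_power a T)) by apply HI.
        rewrite (RInt_ext (V := R_CompleteNormedModule) _ (fun _ => 0) (pos_power a t) (pos_power a T)).
        -- rewrite (RInt_const (V := R_CompleteNormedModule)).
           rewrite (scal_zero_r (K := R_Ring) (V := R_ModuleSpace)). symmetry. apply Rplus_0_r.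
        -- intros s Hs. apply Hphi0.
           assert (Hmono := pos_power_mono a t T ltac:(lra) (proj2 Ht)).
           rewrite Rmin_left, Rmax_right in Hs by exact Hmono.
           assert (W := pos_power_mono (/ a) (pos_power a t) s
             (Rlt_le _ _ (Rinv_0_lt_compat a Ha)) ltac:(lra)).
           rewrite pos_power_inv in W by lra. lra.
  - intros s. apply (continuous_plus (V := R_NormedModule)); [apply continuous_const | apply Hphi].
Qed.

Lemma norm_increment_le {H : HilbertSpace} (g g' : R -> H) (rho rho' : R -> R) (s t : R) :
  s <= t -> (forall r, s <= r <= t -> is_derive g r (g' r)) ->
  (forall r, s <= r <= t -> is_derive rho r (rho' r)) ->
  (forall r, s <= r <= t -> norm (g' r) <= rho' r) ->
  norm (minus (g t) (g s)) <= rho t - rho s.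
Proof.
  intros Hst Hg Hrho Hle.
  assert (Hpos : 0 <= rho t - rho s).
  { assert (W := derive_compare (fun _ => 0) rho (fun _ => 0) rho' s t Hst
      (fun x _ => is_derive_const (V := R_NormedModule) 0 x) Hrho
      (fun x Hx => Rle_trans _ _ _ (norm_ge_0 (g' x)) (Hle x Hx))). lra. }
  apply norm_le_of_inner; [exact Hpos | intros w].
  assert (W := derive_compare (fun r => inner (g r) w) (fun r => norm w * rho r)
    (fun r => inner (g' r) w) (fun r => norm w * rho' r) s t Hst).
  rewrite inner_minus_l. rewrite (Rmult_comm _ (norm w)), Rmult_minus_distr_l. apply W.
  - intros x Hx. apply derive_inner, Hg, Hx.
  - intros x Hx. apply (is_derive_scal rho x (norm w)). apply Hrho, Hx.
  - intros x Hx. eapply Rle_trans; [apply inner_le_norm | ]. rewrite Rmult_comm.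
    apply Rmult_le_compat_l; [exact (norm_ge_0 w) | apply Hle, Hx].
Qed.

(** Cauchy criterion at 0+. The evolution equation holds for t > 0 only, so it sees this limit of
    the source, not its value at 0. *)
Lemma holder_right_limit {H : HilbertSpace} (g : R -> H) (C p T : R) :
  0 < p -> 0 < T -> 0 <= C ->
  (forall s t, 0 < s -> s <= t -> t <= T ->
     norm (minus (g t) (g s)) <= C * (pos_power p t - pos_power p s)) ->
  exists l, filterlim g (at_right 0) (locally l) /\
    forall t, 0 < t <= T -> norm (minus (g t) l) <= C * pos_power p t.
Proof.
  intros Hp HT HC Hg.
  assert (Hsmall : forall eps, 0 < eps -> exists delta : posreal, delta <= T /\
    forall t, 0 < t < delta -> C * pos_power p t < eps).
  { intros eps Heps. assert (He : 0 < eps / (C + 1)) by (apply Rdiv_lt_0_compat; lra).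
    destruct (proj1 (filterlim_locally _ _) (pos_power_continuous p 0 Hp) (mkposreal _ He)) as [delta Hdelta].
    exists (mkposreal _ (Rmin_stable_in_posreal delta (mkposreal T HT))). split; [apply Rmin_r | ].
    intros t Ht. simpl in Ht. assert (W := Rmin_l delta T).
    assert (Q : Rabs (pos_power p t - pos_power p 0) < eps / (C + 1)).
    { apply Hdelta. change (Rabs (t - 0) < delta). rewrite Rminus_0_r, Rabs_pos_eq; lra. }
    rewrite (pos_power_neg p 0), Rminus_0_r, Rabs_pos_eq in Q by (apply pos_power_ge_0 || lra).
    apply Rle_lt_trans with ((C + 1) * pos_power p t).
    - apply Rmult_le_compat_r; [apply pos_power_ge_0 | lra].
    - apply Rlt_le_trans with ((C + 1) * (eps / (C + 1))); [apply Rmult_lt_compat_l; lra | right; field; lra]. }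
  assert (Hlim : exists l : H, filterlim g (at_right 0) (locally l)).
  { apply (filterlim_locally_cauchy (U := H)). intros eps.
    destruct (Hsmall eps (cond_pos eps)) as [delta [HdT Hdelta]].
    exists (fun t => 0 < t < delta). split.
    - exists delta. intros t Ht Ht0. change (Rabs (t - 0) < delta) in Ht.
      apply Rabs_lt_between in Ht. lra.
    - assert (Hle : forall u v, 0 < u -> u <= v -> v < delta -> norm (minus (g v) (g u)) < eps).
      { intros u v Hu Huv Hv. eapply Rle_lt_trans; [apply Hg; lra | ].
        apply Rle_lt_trans with (C * pos_power p v); [ | apply Hdelta; lra].
        apply Rmult_le_compat_l; [exact HC | ]. assert (W := pos_power_ge_0 p u). lra. }
      intros u v Hu Hv. apply (@norm_compat1 R_AbsRing H).
      destruct (Rle_dec u v) as [Huv | Huv].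
      + apply Hle; lra.
      + apply Rle_lt_trans with (norm (minus (g u) (g v))); [right; apply norm_minus_sym | apply Hle; lra]. }
  destruct Hlim as [l Hl]. exists l. split; [exact Hl | intros t Ht].
  apply Rle_plus_epsilon. intros eps Heps.
  assert (F1 := proj1 (filterlim_norm_minus (at_right 0) _ g l) Hl (mkposreal _ Heps)).
  assert (F2 : at_right 0 (fun s => 0 < s < t)).
  { exists (mkposreal t (proj1 Ht)). intros s Hs Hs0. change (Rabs (s - 0) < t) in Hs.
    apply Rabs_lt_between in Hs. lra. }
  destruct (filter_ex _ (filter_and _ _ F1 F2)) as [s [Hs1 Hs2]]. simpl in Hs1.
  eapply Rle_trans; [apply (norm_minus_triangle _ (g s)) | ].
  assert (W := Hg s t ltac:(lra) ltac:(lra) ltac:(lra)). assert (W2 := pos_power_ge_0 p s).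
  assert (W3 : C * (pos_power p t - pos_power p s) <= C * pos_power p t) by (apply Rmult_le_compat_l; lra).
  lra.
Qed.

(** ** The right-hand side *)

Section Source.

Context {H : HilbertSpace} (f0 : H) (ft : R -> H) (rho : R -> R) (rT : R)
  (Hftc : forall t, continuous ft t) (Hrhoc : forall t, continuous rho t)
  (Hft0 : forall t, t <= 0 -> ft t = zero) (Hrho0 : forall t, t <= 0 -> rho t = 0)
  (Hrho : forall s t, s <= t -> norm (minus (ft t) (ft s)) <= rho t - rho s)
  (HrT : forall t, rho t <= rT).

(** The primitive of a right-hand side that jumps from 0 to [f0] at time 0 and then varies
    continuously by [ft]. *)
Definition source (t : R) : H := plus (scal (Rmax t 0) f0) (RInt ft 0 t).

(** The scalar counterpart of [source]: the jump is replaced by its norm and [ft] by [rho], which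
    bounds its variation. *)
Definition source_majorant (t : R) : R :=
  norm f0 * Rmax t 0 + RInt (V := R_CompleteNormedModule) rho 0 t.

Lemma Rmax_0_continuous t : continuous (fun s => Rmax s 0) t.
Proof.
  apply (continuous_ext (fun s => / 2 * (s + Rabs s))).
  - intros s. unfold Rmax, Rabs. destruct Rle_dec; destruct Rcase_abs; lra.
  - apply (continuous_scal_r (K := R_AbsRing) (V := R_NormedModule)).
    apply (continuous_plus (V := R_NormedModule)); [apply continuous_id | apply continuous_Rabs].
Qed.

Lemma source_continuous t : continuous source t.
Proof.
  apply (continuous_plus (V := H)).
  - apply (continuous_scal_l (V := H)). apply Rmax_0_continuous.
  - apply (ex_derive_continuous (V := H) (fun t => RInt ft 0 t)). eexists.
    apply (is_derive_primitive (V := H)), Hftc.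
Qed.

Lemma source_majorant_continuous t : continuous source_majorant t.
Proof.
  apply (continuous_plus (V := R_NormedModule)).
  - apply (continuous_scal_r (K := R_AbsRing) (V := R_NormedModule)). apply Rmax_0_continuous.
  - apply (ex_derive_continuous (V := R_NormedModule) (fun t => RInt (V := R_CompleteNormedModule) rho 0 t)).
    eexists. apply (is_derive_primitive (V := R_CompleteNormedModule)), Hrhoc.
Qed.

Lemma source_zero t : t <= 0 -> source t = zero.
Proof.
  intros Ht. unfold source. rewrite Rmax_right by exact Ht.
  rewrite (primitive_zero (V := H) ft t Hft0 Ht). hilbert_ring.
Qed.

Lemma source_majorant_zero t : t <= 0 -> source_majorant t = 0.
Proof.
  intros Ht. unfold source_majorant. rewrite Rmax_right by exact Ht.
  rewrite (primitive_zero (V := R_CompleteNormedModule) rho t Hrho0 Ht).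
  change (norm f0 * 0 + 0 = 0). ring.
Qed.

Lemma source_derive t : 0 < t -> is_derive source t (plus f0 (ft t)).
Proof.
  intros Ht. apply (is_derive_plus (V := H)).
  - assert (E : is_derive (fun s => Rmax s 0) t 1).
    { apply (is_derive_ext_loc (fun s => s)); [ | apply (is_derive_id (K := R_AbsRing))].
      exists (mkposreal t Ht). intros s Hs. change (Rabs (s - t) < t) in Hs.
      apply Rabs_lt_between in Hs. rewrite Rmax_left by lra. reflexivity. }
    assert (W := is_derive_linear_comp (V := R_NormedModule) (W := H) (fun a : R => scal a f0) _ t 1
      (is_linear_scal_l (V := H) f0) E). simpl in W.
    replace (scal 1 f0) with f0 in W by (symmetry; exact (@scal_one R_Ring H f0)). exact W.
  - apply (is_derive_primitive (V := H)), Hftc.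
Qed.

Lemma bdiff_Rmax_0 h t : 0 < h -> 0 <= bdiff (G := R_AbelianGroup) h (fun s => Rmax s 0) t <= h.
Proof.
  intros Hh. change (0 <= Rmax t 0 - Rmax (t - h) 0 <= h).
  unfold Rmax. repeat destruct Rle_dec; lra.
Qed.

Lemma norm_ft_le t : norm (ft t) <= rT.
Proof.
  assert (HrT0 : 0 <= rT) by (rewrite <- (Hrho0 0) by lra; apply HrT).
  destruct (Rle_dec t 0) as [Ht | Ht].
  - rewrite Hft0 by exact Ht. apply Rle_trans with 0; [right; exact (@norm_zero R_AbsRing H) | exact HrT0].
  - assert (W := Hrho 0 t ltac:(lra)). rewrite (Hrho0 0), (Hft0 0) in W by lra.
    match type of W with norm ?x <= _ => replace x with (ft t) in W by hilbert_ring end.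
    assert (W2 := HrT t). lra.
Qed.

Lemma source_lipschitz h t : 0 < h -> norm (bdiff h source t) <= (norm f0 + rT) * h.
Proof.
  intros Hh. assert (E : bdiff h source t = plus (scal (bdiff (G := R_AbelianGroup) h (fun s => Rmax s 0) t) f0)
    (bdiff h (fun t => RInt ft 0 t) t)).
  { unfold bdiff, source.
    change (minus (Rmax t 0) (Rmax (t - h) 0)) with (Rmax t 0 - Rmax (t - h) 0). hilbert_ring. }
  rewrite E. eapply Rle_trans; [exact (@norm_triangle R_AbsRing H _ _) | ].
  rewrite Rmult_plus_distr_r. apply Rplus_le_compat.
  - apply Rle_trans with (Rabs (bdiff (G := R_AbelianGroup) h (fun s => Rmax s 0) t) * norm f0);
      [right; apply norm_scal_eq | ].
    assert (W := bdiff_Rmax_0 h t Hh). rewrite Rabs_pos_eq by lra. rewrite Rmult_comm.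
    apply Rmult_le_compat_l; [exact (norm_ge_0 f0) | lra].
  - replace (rT * h) with ((t - (t - h)) * rT) by ring.
    apply (norm_RInt_le_const ft (t - h) t); [lra | | apply (is_RInt_primitive (V := H)), Hftc].
    intros x _. apply norm_ft_le.
Qed.

Lemma source_majorant_lipschitz h t : 0 < h ->
  bdiff (G := R_AbelianGroup) h source_majorant t <= (norm f0 + rT) * h.
Proof.
  intros Hh.
  change (norm f0 * Rmax t 0 + RInt (V := R_CompleteNormedModule) rho 0 t -
    (norm f0 * Rmax (t - h) 0 + RInt (V := R_CompleteNormedModule) rho 0 (t - h)) <= (norm f0 + rT) * h).
  assert (W := bdiff_Rmax_0 h t Hh). change (0 <= Rmax t 0 - Rmax (t - h) 0 <= h) in W.
  assert (N := norm_ge_0 f0).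
  assert (W2 := derive_compare (fun t => RInt (V := R_CompleteNormedModule) rho 0 t) (fun s => rT * s)
    rho (fun _ => rT) (t - h) t ltac:(lra)
    (fun x _ => is_derive_primitive (V := R_CompleteNormedModule) rho x Hrhoc)
    (fun x _ => ltac:(auto_derive; [trivial | ring])) (fun x _ => HrT x)). simpl in W2.
  nra.
Qed.

(** Max(t, 0) is convex, so its second difference [pp] is nonnegative and |pp f0| = pp |f0|. The
    other part is the integral of D_h ft over [t - k, t], and |D_h ft| <= D_h rho. *)
Lemma source_second_difference h k t : 0 < h -> 0 < k ->
  norm (bdiff k (bdiff h source) t) <=
    bdiff (G := R_AbelianGroup) k (bdiff (G := R_AbelianGroup) h source_majorant) t.
Proof.
  intros Hh Hk.
  set (pp := Rmax t 0 - Rmax (t - h) 0 - (Rmax (t - k) 0 - Rmax (t - k - h) 0)).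
  assert (Hpp : 0 <= pp) by (unfold pp, Rmax; repeat destruct Rle_dec; lra).
  set (I := fun t => RInt ft 0 t).
  set (J := fun t => RInt (V := R_CompleteNormedModule) rho 0 t).
  assert (E : bdiff k (bdiff h source) t = plus (scal pp f0) (bdiff k (bdiff h I) t)).
  { unfold bdiff, source, pp. fold (I t) (I (t - h)) (I (t - k)) (I (t - k - h)). hilbert_ring. }
  assert (E2 : bdiff (G := R_AbelianGroup) k (bdiff (G := R_AbelianGroup) h source_majorant) t =
    pp * norm f0 + bdiff (G := R_AbelianGroup) k (bdiff (G := R_AbelianGroup) h J) t).
  { change (norm f0 * Rmax t 0 + J t - (norm f0 * Rmax (t - h) 0 + J (t - h)) -
      (norm f0 * Rmax (t - k) 0 + J (t - k) - (norm f0 * Rmax (t - k - h) 0 + J (t - k - h))) =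
      pp * norm f0 + (J t - J (t - h) - (J (t - k) - J (t - k - h)))). unfold pp. ring. }
  rewrite E, E2. eapply Rle_trans; [exact (@norm_triangle R_AbsRing H _ _) | ].
  apply Rplus_le_compat.
  - apply Rle_trans with (Rabs pp * norm f0); [right; apply norm_scal_eq | ].
    rewrite Rabs_pos_eq by exact Hpp. lra.
  - apply (norm_RInt_le (bdiff h ft) (bdiff (G := R_AbelianGroup) h rho) (t - k) t); [lra | | | ].
    + intros x _. apply (Hrho (x - h) x). lra.
    + apply (is_RInt_derive (V := H) (bdiff h I) (bdiff h ft)).
      * intros x _. apply (bdiff_derive (V := H)). intros y. apply (is_derive_primitive (V := H)), Hftc.
      * intros x _. apply (bdiff_continuous (V := H)), Hftc.
    + apply (is_RInt_derive (V := R_CompleteNormedModule) (bdiff (G := R_AbelianGroup) h J)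
        (bdiff (G := R_AbelianGroup) h rho)).
      * intros x _. apply (bdiff_derive (V := R_NormedModule)). intros y.
        apply (is_derive_primitive (V := R_CompleteNormedModule)), Hrhoc.
      * intros x _. apply (bdiff_continuous (V := R_NormedModule)), Hrhoc.
Qed.

End Source.

(** ** The operators *)

Lemma finite_choice (m : nat) (Q : nat -> R -> Prop) :
  (forall j, (1 <= j <= m)%nat -> exists C, Q j C) ->
  exists C : nat -> R, forall j, (1 <= j <= m)%nat -> Q j (C j).
Proof.
  induction m as [ | m IH]; intros HQ.
  - exists (fun _ => 0). intros j Hj. lia.
  - destruct IH as [C HC]; [intros j Hj; apply HQ; lia | ].
    destruct (HQ (S m)) as [c Hc]; [lia | ].
    exists (fun j => if Nat.eq_dec j (S m) then c else C j). intros j Hj.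
    destruct (Nat.eq_dec j (S m)) as [-> | Hne]; [exact Hc | apply HC; lia].
Qed.

Lemma self_adjoint_symmetric {H : HilbertSpace} (A : operator H) (x y : H) :
  self_adjoint A -> dom A x -> dom A y -> inner (A x) y = inner x (A y).
Proof.
  intros [_ [_ HA]] Hx Hy. exact (proj2 (HA y (A y)) (conj Hy eq_refl) x Hx).
Qed.

Section Inverse.

Context {H : HilbertSpace} (A : operator H) (K : H -> H)
  (HAsa : self_adjoint A) (HApos : positive_definite A)
  (HKr : forall y, dom A (K y) /\ A (K y) = y) (HKl : forall x, dom A x -> K (A x) = x).

Lemma inverse_symmetric x y : inner (K x) y = inner x (K y).
Proof.
  rewrite <- (proj2 (HKr y)) at 1. rewrite <- (proj2 (HKr x)) at 2.
  symmetry. apply self_adjoint_symmetric; [exact HAsa | apply HKr | apply HKr].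
Qed.

Lemma inverse_nonneg x : 0 <= inner x (K x).
Proof.
  rewrite <- (proj2 (HKr x)) at 1.
  destruct (Req_dec (norm (K x)) 0) as [E | E].
  - apply norm_eq_zero in E. rewrite E. inner_simpl. apply Rle_refl.
  - left. apply HApos; [apply HKr | ]. intros E2. apply E. rewrite E2. exact (@norm_zero R_AbsRing H).
Qed.

Lemma inverse_dense x eps : 0 < eps -> exists y, norm (minus (K y) x) < eps.
Proof.
  intros Heps. destruct (proj1 (proj2 HAsa) x eps Heps) as [y [Hy Hyx]].
  exists (A y). rewrite (HKl y Hy). exact Hyx.
Qed.

(** The case theta = 0, q = 2 makes B K bounded, by testing on the dense domain of [A]. The case
    theta = q = 1 is the form bound, as the square of |K x|_1 is <x, K x>. *)
Lemma dominated_composition (B : operator H) (HBA : dominates A B) :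
  exists C, 0 <= C /\ (forall x, norm (B (K x)) <= C * norm x) /\
    forall x y, Rabs (inner (B (K x)) (K y)) <= C * sqrt (inner x (K x)) * sqrt (inner y (K y)).
Proof.
  destruct HBA as [C [HC HBC]]. exists C. split; [lra | split].
  - intros x. apply (norm_le_of_dense (dom A)).
    + intros y eps Heps. apply (proj1 (proj2 HAsa) y eps Heps).
    + apply Rmult_le_pos; [lra | exact (norm_ge_0 x)].
    + intros w Hw. eapply Rle_trans; [apply Rle_abs | ].
      assert (W := HBC 0%nat 2%nat eq_refl (K x) w (proj1 (HKr x)) Hw).
      simpl in W. rewrite (proj2 (HKr x)) in W. exact W.
  - intros x y. assert (W := HBC 1%nat 1%nat eq_refl (K x) (K y) (proj1 (HKr x)) (proj1 (HKr y))).
    simpl in W. rewrite (proj2 (HKr x)), (proj2 (HKr y)) in W. exact W.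
Qed.

Lemma composition_linear (B : operator H) (C : R) (HK : is_linear K) (HBsa : self_adjoint B)
  (HBdom : forall x, dom A x -> dom B x) :
  0 <= C -> (forall x, norm (B (K x)) <= C * norm x) -> is_linear (fun x => B (K x)).
Proof.
  intros HC HB. destruct HBsa as [[_ [Hp Hs]] _]. split.
  - intros x y. rewrite (linear_plus _ HK). apply Hp; apply HBdom, HKr.
  - intros a x. rewrite (linear_scal _ HK). apply Hs, HBdom, HKr.
  - exists (C + 1). split; [lra | intros x]. eapply Rle_trans; [apply HB | ].
    apply Rmult_le_compat_r; [exact (norm_ge_0 x) | lra].
Qed.

Lemma composition_symmetric (B : operator H) (HBsa : self_adjoint B)
  (HBdom : forall x, dom A x -> dom B x) x y :
  inner (K (B (K x))) y = inner (K x) (B (K y)).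
Proof.
  rewrite inverse_symmetric. apply self_adjoint_symmetric; [exact HBsa | | ]; apply HBdom, HKr.
Qed.

End Inverse.

(** * Reduction of the evolution equation to the a priori bounds *)

Lemma zero_of_zero_derivative (r : R -> R) (T : R) :
  (forall t, continuous r t) -> (forall t, t <= 0 -> r t = 0) ->
  (forall t, 0 < t < T -> is_derive r t 0) -> forall t, t <= T -> r t = 0.
Proof.
  intros Hc H0 Hd t Ht. destruct (Rle_dec t 0) as [Ht0 | Ht0]; [apply H0, Ht0 | ].
  (* The derivative is needed only inside (0, t), so t = T is covered although functions frozen
     after T may have a corner there. *)
  destruct (MVT_gen r 0 t (fun _ => 0)) as [c [_ E]].
  - intros x Hx. rewrite Rmin_left, Rmax_right in Hx by lra. apply Hd. lra.
  - intros x _. apply continuity_pt_filterlim, Hc.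
  - rewrite (H0 0) in E by lra. lra.
Qed.

Lemma delay_int_scal (d : R -> R) (b c : R) (Hd : is_delay d b) (f : R -> R) (t : R) :
  (forall x, continuous f x) ->
  delay_int (V := R_CompleteNormedModule) d b (fun s => c * f s) t
  = c * delay_int (V := R_CompleteNormedModule) d b f t.
Proof.
  intros Hf. apply (is_RInt_unique (V := R_CompleteNormedModule)).
  apply (is_RInt_scal (V := R_NormedModule)).
  apply (is_RInt_delay (V := R_CompleteNormedModule)); assumption.
Qed.

Theorem theorem1
  (H : HilbertSpace) (m : nat) (kappa : R) (alphas : nat -> R) (alpha T : R)
  (A : operator H) (B : nat -> operator H) (E : R -> H -> H)
  (u0 : H) (g g' g'' : R -> H) (dE : R -> H) (v v' : R -> H)
  (hm : (1 <= m)%nat)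
  (hkappa : 0 <= kappa)
  (halphas : forall j, (1 <= j <= m)%nat -> 0 < alphas j < 1)
  (halpha : is_min_of m alphas alpha)
  (hT : 0 < T)
  (hA_sa : self_adjoint A)
  (hA_pos : positive_definite A)
  (hA_inv : has_compact_inverse A)
  (hB_sa : forall j, (1 <= j <= m)%nat -> self_adjoint (B j))
  (hB_dom : forall j, (1 <= j <= m)%nat -> forall x, dom A x -> dom (B j) x)
  (hB_le : forall j, (1 <= j <= m)%nat -> dominates A (B j))
  (hE : semigroup_exp_minus A E)
  (hu0_dom : dom A u0)
  (hu0 : u0 <> zero)
  (hv : is_solution m kappa alphas A B g u0 v v')
  (hg' : forall t, 0 < t <= T -> is_derive g t (g' t))
  (hg'' : forall t, 0 < t <= T -> is_derive g' t (g'' t))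
  (hdE : forall t, 0 < t <= T ->
     is_derive (fun s => E s (minus (A u0) (g 0))) t (dE t))
  (hbound : exists C0 : R, 0 < C0 /\
     forall t, 0 < t <= T ->
       norm (minus (A u0) (g 0)) + norm (g t) <= C0 /\
       norm (dE t) + norm (g' t) + t * norm (g'' t)
         <= C0 * Rpower t (alpha - 1)) :
  exists C : R, 0 < C /\
    forall t, 0 < t <= T ->
      norm (v' t) + norm (A (v t)) <= C * norm u0.
Proof.
  destruct hA_inv as [K [HK [_ [HKr HKl]]]].
  destruct halpha as [[ja [Hja Eja]] _].
  assert (Halpha : 0 < alpha) by (rewrite Eja; apply halphas, Hja).
  clear ja Hja Eja.
  assert (Ksym := inverse_symmetric A K hA_sa HKr).
  assert (Kpos := inverse_nonneg A K hA_pos HKr).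
  assert (Kdense := inverse_dense A K hA_sa HKl).
  destruct hbound as [C0 [HC0 Hbound]].
  destruct hv as [_ [Hvlim Hv]].
  destruct (finite_choice m (fun j C => 0 <= C /\ (forall x, norm (B j (K x)) <= C * norm x) /\
    forall x y, Rabs (inner (B j (K x)) (K y)) <= C * sqrt (inner x (K x)) * sqrt (inner y (K y))))
    as [CB HCB].
  { intros j Hj. apply (dominated_composition A K hA_sa HKr). apply hB_le, Hj. }
  (* [c j] is used only as a constant: nothing about the value of [Gamma] is needed. *)
  set (a := alphas). set (c := fun j => / a j * / Gamma (a j)).
  set (d := fun j => pos_power (/ a j)). set (b := fun j => pos_power (a j) T).
  assert (Ha : forall j, (1 <= j <= m)%nat -> 0 < a j) by (intros j Hj; apply halphas, Hj).
  assert (Hd : forall j, (1 <= j <= m)%nat -> is_delay (d j) (b j)).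
  { intros j Hj. apply pos_power_delay, Ha, Hj. }
  set (M0 := fun j x => B j (K x)).
  assert (HM0 : forall j, (1 <= j <= m)%nat -> is_linear (M0 j)).
  { intros j Hj. apply (composition_linear A K HKr (B j) (CB j) HK); auto; apply HCB, Hj. }
  assert (KM0 : forall j, (1 <= j <= m)%nat -> forall x y, inner (K (M0 j x)) y = inner (K x) (M0 j y)).
  { intros j Hj. apply (composition_symmetric A K hA_sa HKr); auto. }
  set (M := fun j x => scal (c j) (M0 j x)).
  set (CM := fun j => Rabs (c j) * CB j).
  assert (HM : forall j, (1 <= j <= m)%nat -> is_linear (M j)).
  { intros j Hj. apply (is_linear_comp (V := H) (W := H) (M0 j) (fun x => scal (c j) x)); [apply HM0, Hj | ].
    apply (is_linear_scal_r (V := H)). exact Rmult_comm. }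
  assert (HCM0 : forall j, (1 <= j <= m)%nat -> 0 <= CM j).
  { intros j Hj. apply Rmult_le_pos; [apply Rabs_pos | apply HCB, Hj]. }
  assert (HCM : forall j, (1 <= j <= m)%nat -> forall x, norm (M j x) <= CM j * norm x).
  { intros j Hj x. unfold M. rewrite norm_scal_eq. unfold CM. rewrite Rmult_assoc.
    apply Rmult_le_compat_l; [apply Rabs_pos | apply HCB, Hj]. }
  assert (KM : forall j, (1 <= j <= m)%nat -> forall x y, inner (K (M j x)) y = inner (K x) (M j y)).
  { intros j Hj x y. unfold M. rewrite (linear_scal _ HK). inner_simpl. rewrite KM0 by exact Hj. reflexivity. }
  assert (HCE : forall j, (1 <= j <= m)%nat -> forall x y,
    Rabs (inner (M j x) (K y)) <= CM j * sqrt (inner x (K x)) * sqrt (inner y (K y))).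
  { intros j Hj x y. unfold M, CM. inner_simpl. rewrite Rabs_mult, !Rmult_assoc.
    apply Rmult_le_compat_l; [apply Rabs_pos | ]. rewrite <- Rmult_assoc. apply HCB, Hj. }
  assert (Hvc : forall s, 0 < s <= T -> continuous v s).
  { intros s Hs. apply (ex_derive_continuous (V := H)). exists (v' s). apply Hv. lra. }
  (* The [u] of the overview, made globally continuous. Its companion [z] is A applied to it for all
     times, so K z = vh holds without restriction. *)
  set (vh := fun t => minus (cutoff v u0 T t) u0).
  set (z := fun t => minus (cutoff (fun s => A (v s)) (A u0) T t) (A u0)).
  assert (Hvhc : forall t, continuous vh t).
  { intros t. apply (continuous_minus (V := H)); [ | apply continuous_const].
    apply cutoff_continuous; assumption. }
  assert (Hvh0 : forall t, t <= 0 -> vh t = zero).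
  { intros t Ht. unfold vh. rewrite cutoff_neg by exact Ht. hilbert_ring. }
  assert (Hvz : forall t, K (z t) = vh t).
  { intros t. unfold z, vh. rewrite (linear_minus _ _ _ HK), (HKl u0 hu0_dom). f_equal.
    unfold cutoff. destruct Rle_dec as [Ht | Ht]; [apply HKl, hu0_dom | ].
    apply HKl. apply Hv. apply Rmin_glb_lt; lra. }
  (* Integrating |g'| <= C0 r^(alpha-1) from s to t gives the factor C0 / alpha. *)
  assert (Hgh : forall s t, 0 < s -> s <= t -> t <= T ->
    norm (minus (g t) (g s)) <= C0 / alpha * (pos_power alpha t - pos_power alpha s)).
  { intros s t Hs Hst Ht. rewrite !pos_power_pos, Rmult_minus_distr_l by lra.
    apply (norm_increment_le g g' (fun r => C0 / alpha * Rpower r alpha)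
      (fun r => C0 * Rpower r (alpha - 1)) s t Hst).
    - intros r Hr. apply hg'. lra.
    - intros r Hr.
      replace (C0 * Rpower r (alpha - 1)) with (C0 / alpha * (alpha * Rpower r (alpha - 1))) by (field; lra).
      apply (is_derive_scal (fun r => Rpower r alpha) r (C0 / alpha)). apply Rpower_derive. lra.
    - intros r Hr. destruct (Hbound r ltac:(lra)) as [_ W].
      assert (W1 := norm_ge_0 (dE r)). assert (W2 := norm_ge_0 (g'' r)).
      assert (W3 : 0 <= r * norm (g'' r)) by (apply Rmult_le_pos; [lra | exact W2]).
      lra. }
  assert (HC0a : 0 <= C0 / alpha) by (left; apply Rdiv_lt_0_compat; assumption).
  destruct (holder_right_limit g (C0 / alpha) alpha T Halpha hT HC0a Hgh) as [g0 [Hg0 Hg0h]].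
  assert (Hgc : forall s, 0 < s <= T -> continuous g s).
  { intros s Hs. apply (ex_derive_continuous (V := H)). exists (g' s). apply hg', Hs. }
  (* For 0 < t <= T, c_j tau (a_j) t = t^(a_j) / (a_j Gamma(a_j)) is the coefficient with which the
     constant state u0 enters the memory. *)
  set (tau := fun p t => pos_power p (Rmin t T)).
  assert (Htau0 : forall p t, t <= 0 -> tau p t = 0).
  { intros p t Ht. apply pos_power_neg. apply Rle_trans with t; [apply Rmin_l | exact Ht]. }
  assert (Htaumono : forall p s t, 0 < p -> s <= t -> tau p s <= tau p t).
  { intros p s t Hp Hst. apply pos_power_mono; [lra | ].
    unfold Rmin. repeat destruct Rle_dec; lra. }
  assert (Htauc : forall p, 0 < p -> forall t, continuous (tau p) t).
  { intros p Hp t. apply (continuous_comp (fun t => Rmin t T) (pos_power p)).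
    - apply Rmin_continuous.
    - apply pos_power_continuous, Hp. }
  (* On (0, T], f0 + ft is the right-hand side of the equation for v - u0: g - A u0 + kappa u0 minus
     the memory of u0. [f0] is its limit at 0+, built from the limit [g0] of g, and [ft] starts from
     zero. *)
  set (f0 := plus (minus g0 (A u0)) (scal kappa u0)).
  set (ft := fun t => minus (minus (cutoff g g0 T t) g0)
    (sum_n_m (fun j => scal (c j * tau (a j) t) (B j u0)) 1 m)).
  (* A nondecreasing function dominating the variation of [ft]: the first term for g, the others for
     the powers multiplying B_j u0. It is finite because alpha and all a_j are positive. *)
  set (rho := fun t => C0 / alpha * tau alpha t
    + sum_n_m (fun j => Rabs (c j) * norm (B j u0) * tau (a j) t) 1 m).
  assert (Hftc : forall t, continuous ft t).
  { intros t. apply (continuous_minus (V := H)).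
    - apply (continuous_minus (V := H)); [apply cutoff_continuous; assumption | apply continuous_const].
    - apply (continuous_sum_n_m (V := H)). intros j Hj. apply (continuous_scal_l (V := H)).
      apply (continuous_scal_r (K := R_AbsRing) (V := R_NormedModule)), Htauc, Ha, Hj. }
  assert (Hrhoc : forall t, continuous rho t).
  { intros t. apply (continuous_plus (V := R_NormedModule)).
    - apply (continuous_scal_r (K := R_AbsRing) (V := R_NormedModule)), Htauc, Halpha.
    - apply (continuous_sum_n_m (V := R_NormedModule)). intros j Hj.
      apply (continuous_scal_r (K := R_AbsRing) (V := R_NormedModule)), Htauc, Ha, Hj. }
  assert (Hft0 : forall t, t <= 0 -> ft t = zero).
  { intros t Ht. unfold ft. rewrite cutoff_neg by exact Ht.
    rewrite (sum_n_m_ext_loc _ (fun _ => zero)).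
    - rewrite sum_n_m_const_zero. hilbert_ring.
    - intros j Hj. rewrite Htau0 by exact Ht. hilbert_ring. }
  assert (Hrho0 : forall t, t <= 0 -> rho t = 0).
  { intros t Ht. unfold rho. rewrite Htau0 by exact Ht. rewrite (sum_n_m_ext_loc _ (fun _ => zero)).
    - rewrite (sum_n_m_const_zero (G := R_AbelianMonoid)). change (C0 / alpha * 0 + 0 = 0). ring.
    - intros j Hj. rewrite Htau0 by exact Ht. apply Rmult_0_r. }
  assert (Hgx : forall s t, s <= t -> norm (minus (cutoff g g0 T t) (cutoff g g0 T s)) <=
    C0 / alpha * (tau alpha t - tau alpha s)).
  { intros s t Hst. destruct (Rle_dec t 0) as [Ht | Ht].
    - rewrite !cutoff_neg, !Htau0 by lra.
      match goal with |- norm ?x <= _ => replace x with (zero : H) by hilbert_ring end.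
      apply Rle_trans with 0; [right; exact (@norm_zero R_AbsRing H) | lra].
    - assert (HtT : 0 < Rmin t T <= T) by (split; [apply Rmin_glb_lt; lra | apply Rmin_r]).
      replace (cutoff g g0 T t) with (g (Rmin t T)) by (unfold cutoff; destruct Rle_dec; [lra | reflexivity]).
      destruct (Rle_dec s 0) as [Hs | Hs].
      + rewrite cutoff_neg, (Htau0 alpha s), Rminus_0_r by exact Hs. apply Hg0h, HtT.
      + replace (cutoff g g0 T s) with (g (Rmin s T)) by (unfold cutoff; destruct Rle_dec; [lra | reflexivity]).
        apply Hgh; [apply Rmin_glb_lt; lra | | apply Rmin_r].
        unfold Rmin. repeat destruct Rle_dec; lra. }
  assert (Hrho : forall s t, s <= t -> norm (minus (ft t) (ft s)) <= rho t - rho s).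
  { intros s t Hst.
    assert (Eft : minus (ft t) (ft s) = minus (minus (cutoff g g0 T t) (cutoff g g0 T s))
      (sum_n_m (fun j => minus (scal (c j * tau (a j) t) (B j u0)) (scal (c j * tau (a j) s) (B j u0))) 1 m)).
    { transitivity (minus (minus (cutoff g g0 T t) (cutoff g g0 T s))
        (minus (sum_n_m (fun j => scal (c j * tau (a j) t) (B j u0)) 1 m)
          (sum_n_m (fun j => scal (c j * tau (a j) s) (B j u0)) 1 m))).
      - unfold ft. hilbert_ring.
      - f_equal. symmetry. exact (sum_n_m_minus _ _ 1 m). }
    rewrite Eft. eapply Rle_trans; [apply norm_minus_le | ].
    assert (E2 : rho t - rho s = C0 / alpha * (tau alpha t - tau alpha s) +
      sum_n_m (fun j => Rabs (c j) * norm (B j u0) * (tau (a j) t - tau (a j) s)) 1 m).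
    { unfold rho.
      assert (E3 : sum_n_m (fun j => Rabs (c j) * norm (B j u0) * tau (a j) t) 1 m =
        sum_n_m (fun j => Rabs (c j) * norm (B j u0) * (tau (a j) t - tau (a j) s)) 1 m +
        sum_n_m (fun j => Rabs (c j) * norm (B j u0) * tau (a j) s) 1 m).
      { etransitivity; [ | apply (sum_n_m_plus (G := R_AbelianMonoid))].
        apply sum_n_m_ext_loc. intros j _. unfold plus; simpl. ring. }
      rewrite E3. ring. }
    rewrite E2. apply Rplus_le_compat; [apply Hgx, Hst | ].
    apply norm_sum_n_m_le. intros j Hj.
    replace (minus (scal (c j * tau (a j) t) (B j u0)) (scal (c j * tau (a j) s) (B j u0)))
      with (scal (c j * (tau (a j) t - tau (a j) s)) (B j u0)) by hilbert_ring.
    rewrite norm_scal_eq, Rabs_mult. assert (W := Htaumono (a j) s t (Ha j Hj) Hst).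
    rewrite (Rabs_pos_eq (tau (a j) t - tau (a j) s)) by lra. right. ring. }
  assert (HrT : forall t, rho t <= rho T).
  { intros t. unfold rho. apply Rplus_le_compat.
    - apply Rmult_le_compat_l; [exact HC0a | ]. unfold tau. apply pos_power_mono; [lra | ].
      rewrite (Rmin_left T T) by lra. apply Rmin_r.
    - apply sum_n_m_le_loc. intros j Hj. apply Rmult_le_compat_l.
      + apply Rmult_le_pos; [apply Rabs_pos | exact (norm_ge_0 (B j u0))].
      + unfold tau. apply pos_power_mono; [left; apply Ha, Hj | ].
        rewrite (Rmin_left T T) by lra. apply Rmin_r. }
  set (Phi := source f0 ft). set (P := source_majorant f0 rho). set (L := norm f0 + rho T).
  assert (HL : 0 <= L).
  { apply Rplus_le_le_0_compat; [exact (norm_ge_0 f0) | ]. rewrite <- (Hrho0 0) by lra. apply HrT. }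
  assert (HPhic : forall t, continuous Phi t) by (intros t; apply source_continuous, Hftc).
  assert (HPhi0 : forall t, t <= 0 -> Phi t = zero) by (intros t; apply source_zero, Hft0).
  set (U := fun t => RInt vh 0 t).
  set (ell := fun j t => K (M j (z t))).
  assert (HUd : forall t, is_derive U t (vh t)) by (intros t; apply (is_derive_primitive (V := H)), Hvhc).
  assert (HUc : forall t, continuous U t).
  { intros t. apply (ex_derive_continuous (V := H)). exists (vh t). apply HUd. }
  assert (Hellc : forall j, (1 <= j <= m)%nat -> forall t, continuous (ell j) t).
  { intros j Hj. apply (ell_continuous m K M CM HM HK HCM0 HCM KM vh z Hvz Hvhc j Hj). }
  assert (Hell0c : forall j, (1 <= j <= m)%nat -> forall t, continuous (fun t => K (M0 j (z t))) t).
  { intros j Hj. apply (ell_continuous m K M0 CB HM0 HK (fun j Hj => proj1 (HCB j Hj))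
      (fun j Hj => proj1 (proj2 (HCB j Hj))) KM0 vh z Hvz Hvhc j Hj). }
  set (Lam := fun j t => RInt (ell j) 0 t).
  assert (HLamd : forall j, (1 <= j <= m)%nat -> forall t, is_derive (Lam j) t (ell j t)).
  { intros j Hj t. apply (is_derive_primitive (V := H)), Hellc, Hj. }
  assert (HLamc : forall j, (1 <= j <= m)%nat -> forall t, continuous (Lam j) t).
  { intros j Hj t. apply (ex_derive_continuous (V := H)). exists (ell j t). apply HLamd, Hj. }
  assert (Hell0 : forall j, (1 <= j <= m)%nat -> forall t, t <= 0 -> ell j t = zero).
  { intros j Hj t Ht. unfold ell. apply inner_ext. intros w.
    rewrite KM, Hvz, Hvh0 by assumption. inner_simpl. reflexivity. }
  assert (Hint : forall t, t <= T ->
    plus (plus (K (vh t)) (U t)) (sum_n_m (fun j => delay_int (d j) (b j) (Lam j) t) 1 m)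
      = K (plus (Phi t) (scal kappa (U t)))).
  { intros t Ht. apply inner_ext. intros w.
    set (S := fun (F : nat -> R -> H) t => sum_n_m (fun j =>
      delay_int (V := R_CompleteNormedModule) (d j) (b j) (fun s => inner (F j s) w) t) 1 m).
    (* The defect of the integrated identity, tested with w. Its derivative on (0, T) is the defect
       of the equation paired with K w, which is zero; working with scalars avoids integrating A
       v. *)
    set (r := fun t => inner (vh t) (K w) + inner (U t) w + S Lam t
      - inner (Phi t) (K w) - kappa * inner (U t) (K w)).
    assert (Hic : forall (f : R -> H) y, (forall s, continuous f s) ->
      forall s, continuous (fun s => inner (f s) y : R) s).
    { intros f y Hf s. apply continuous_inner; [apply Hf | apply continuous_const]. }
    assert (Hr : r t = 0).
    { apply (zero_of_zero_derivative r T); [ | | | exact Ht].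
      - intros s. unfold r. apply (continuous_minus (V := R_NormedModule)).
        + apply (continuous_minus (V := R_NormedModule)).
          * apply (continuous_plus (V := R_NormedModule)).
            -- apply (continuous_plus (V := R_NormedModule)); apply Hic; assumption.
            -- apply (continuous_sum_n_m (V := R_NormedModule)). intros j Hj.
               apply (delay_int_continuous (V := R_CompleteNormedModule)); [apply Hd, Hj | ].
               apply Hic, HLamc, Hj.
          * apply Hic; assumption.
        + apply (continuous_scal_r (K := R_AbsRing) (V := R_NormedModule)). apply Hic; assumption.
      - intros s Hs. unfold r.
        assert (ES : S Lam s = 0).
        { unfold S. rewrite (sum_n_m_ext_loc _ (fun _ => zero)).
          - exact (sum_n_m_const_zero (G := R_AbelianMonoid) 1 m).
          - intros j Hj. apply (delay_int_zero (V := R_CompleteNormedModule)); [apply Hd, Hj | ].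
            intros x Hx. unfold Lam. rewrite (primitive_zero (V := H) (ell j) x (Hell0 j Hj)) by lra.
            apply inner_zero_l. }
        rewrite ES. unfold U. rewrite (primitive_zero (V := H) vh s Hvh0 Hs), Hvh0, HPhi0 by exact Hs.
        inner_simpl. ring.
      - intros s Hs. unfold r.
        destruct (Hv s (proj1 Hs)) as [Hvd [Hvdom [I [HI Heq]]]].
        assert (Hvhs : vh s = minus (v s) u0) by (unfold vh; rewrite cutoff_pos by lra; reflexivity).
        assert (Hvhd : is_derive vh s (v' s)).
        { apply (is_derive_ext_loc (fun s => minus (v s) u0)).
          - assert (Hpos : 0 < Rmin s (T - s)) by (apply Rmin_glb_lt; lra).
            exists (mkposreal _ Hpos). intros x Hx. change (Rabs (x - s) < Rmin s (T - s)) in Hx.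
            assert (A1 := Rlt_le_trans _ _ _ Hx (Rmin_l _ _)). assert (A2 := Rlt_le_trans _ _ _ Hx (Rmin_r _ _)).
            apply Rabs_lt_between in A1. apply Rabs_lt_between in A2.
            unfold vh. rewrite cutoff_pos by lra. reflexivity.
          - replace (v' s) with (minus (v' s) zero) by hilbert_ring.
            apply (is_derive_minus (V := H)); [exact Hvd | exact (is_derive_const (V := H) u0 s)]. }
        assert (HSd : is_derive (S Lam) s (S ell s)).
        { apply (is_derive_sum_n_m
            (fun j s => delay_int (V := R_CompleteNormedModule) (d j) (b j) (fun s => inner (Lam j s) w) s)
            (fun j s => delay_int (V := R_CompleteNormedModule) (d j) (b j) (fun s => inner (ell j s) w) s)).
          intros j Hj. apply delay_int_derive; [apply Hd, Hj | | ].
          - intros x. apply derive_inner, HLamd, Hj.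
          - apply Hic, Hellc, Hj. }
        (* Paired with K w, the integrand B_j v becomes a constant plus <K B_j K z, w>, which is
           continuous, so the improper integral can be rewritten as a delay integral. *)
        assert (HIj : forall j, (1 <= j <= m)%nat -> inner (I j) (K w) =
          c j * tau (a j) s * inner (B j u0) (K w)
          + delay_int (V := R_CompleteNormedModule) (d j) (b j) (fun s => inner (ell j s) w) s).
        { intros j Hj.
          rewrite (memory_integral_delay (a j) s T (inner (B j u0) (K w)) (inner (I j) (K w))
            (fun r => inner (B j (v r)) (K w)) (fun r => inner (K (M0 j (z r))) w) (Ha j Hj) ltac:(lra)).
          - assert (E1 : delay_int (V := R_CompleteNormedModule) (d j) (b j) (fun s => inner (ell j s) w) s
              = c j * delay_int (V := R_CompleteNormedModule) (d j) (b j) (fun r => inner (K (M0 j (z r))) w) s).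
            { rewrite <- delay_int_scal; [ | apply Hd, Hj | apply Hic, Hell0c, Hj].
              apply (delay_int_ext (V := R_CompleteNormedModule)); [apply Hd, Hj | ].
              intros x _. unfold ell, M. rewrite (linear_scal _ HK). apply inner_scal_l. }
            rewrite E1. unfold tau. rewrite Rmin_left by lra. unfold c, d, b. ring.
          - apply Hic, Hell0c, Hj.
          - intros x Hx. rewrite KM0, Hvz, Hvh0 by assumption. inner_simpl. reflexivity.
          - intros x Hx. rewrite Ksym. unfold M0.
            replace (K (z x)) with (minus (v x) u0)
              by (rewrite Hvz; unfold vh; rewrite cutoff_pos by lra; reflexivity).
            assert (Hdv : dom A (v x)) by (apply Hv; lra).
            assert (HBl : B j (minus (v x) u0) = minus (B j (v x)) (B j u0)).
            { assert (W := linear_minus _ (A (v x)) (A u0) (HM0 j Hj)). unfold M0 in W.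
              rewrite (linear_minus _ _ _ HK), !HKl in W by assumption. exact W. }
            rewrite HBl. inner_simpl. ring.
          - apply (is_RInt_gen_ext (V := R_NormedModule)
              (fun r => inner (scal (omega (a j) (s - r)) (B j (v r))) (K w))).
            + apply filter_forall. intros ab x _. apply inner_scal_l.
            + exact (is_RInt_gen_linear_comp (V := H) (W := R_NormedModule) (fun x => inner x (K w)) _ _ _ _ _ _
                (is_linear_inner_l (K w)) (HI j Hj)). }
        assert (HIs : inner (sum_n_m I 1 m) (K w) =
          inner (sum_n_m (fun j => scal (c j * tau (a j) s) (B j u0)) 1 m) (K w) + S ell s).
        { inner_sums. unfold S.
          etransitivity; [ | apply (sum_n_m_plus (G := R_AbelianMonoid))].
          apply sum_n_m_ext_loc. intros j Hj. rewrite (HIj j Hj). unfold plus; simpl.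
          inner_simpl. reflexivity. }
        assert (HAv : inner (A (v s)) (K w) = inner (v s) w) by (rewrite <- Ksym, HKl by exact Hvdom; reflexivity).
        assert (HAu : inner (A u0) (K w) = inner u0 w) by (rewrite <- Ksym, HKl by exact hu0_dom; reflexivity).
        assert (E0 : 0 = inner (v' s) (K w) + inner (vh s) w + S ell s
          - inner (plus f0 (ft s)) (K w) - kappa * inner (vh s) (K w)).
        { assert (E1 := f_equal (fun x => inner x (K w)) Heq). simpl in E1. revert E1.
          unfold f0, ft. rewrite cutoff_pos, Hvhs by lra. inner_simpl. rewrite HIs, HAv, HAu.
          set (X := inner (sum_n_m (fun j => scal (c j * tau (a j) s) (B j u0)) 1 m) (K w)).
          lra. }
        rewrite E0.
        apply (is_derive_minus (V := R_NormedModule)).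
        + apply (is_derive_minus (V := R_NormedModule)).
          * apply (is_derive_plus (V := R_NormedModule)); [ | exact HSd].
            apply (is_derive_plus (V := R_NormedModule)); apply derive_inner; [exact Hvhd | apply HUd].
          * apply derive_inner. apply source_derive; [exact Hftc | lra].
        + apply (is_derive_scal (fun t => inner (U t) (K w)) s kappa). apply derive_inner, HUd. }
    assert (HSL : inner (sum_n_m (fun j => delay_int (d j) (b j) (Lam j) t) 1 m) w = S Lam t).
    { inner_sums. apply sum_n_m_ext_loc. intros j Hj. symmetry.
      apply (delay_int_linear (V := H) (W := R_CompleteNormedModule) (fun x => inner x w) (d j) (b j) (Hd j Hj)).
      - apply is_linear_inner_l.
      - apply HLamc, Hj. }
    rewrite Ksym. inner_simpl. rewrite HSL, Ksym. unfold r in Hr. lra. }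
  assert (HPhiLip : forall h t, 0 < h -> t <= T -> norm (bdiff h Phi t) <= L * h).
  { intros h t Hh _. apply (source_lipschitz f0 ft rho (rho T)); assumption. }
  assert (HPLip : forall h t, 0 < h -> bdiff (G := R_AbelianGroup) h P t <= L * h).
  { intros h t Hh. apply source_majorant_lipschitz; assumption. }
  assert (HPhiP : forall h k t, 0 < h -> 0 < k -> t <= T -> norm (bdiff k (bdiff h Phi) t) <=
    bdiff (G := R_AbelianGroup) k (bdiff (G := R_AbelianGroup) h P) t).
  { intros h k t Hh Hk _. apply (source_second_difference f0 ft rho); assumption. }
  assert (HPc : forall t, continuous P t) by (intros t; apply source_majorant_continuous, Hrhoc).
  assert (HP0 : forall t, t <= 0 -> P t = 0) by (intros t; apply source_majorant_zero, Hrho0).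
  (* [CM] serves twice because the constant of domination is common to the norm bound and the form
     bound. *)
  destruct (v_lipschitz m d b K M CM CM Hd HM HK Kpos HCM0 HCM KM HCM0 HCE kappa T (Rlt_le _ _ hT)
    vh z Phi P L Hvz Hvhc Hvh0 HPhic HPhi0 HPc HP0 HL HPLip HPhiP Hint) as [C1 [HC1 Hlip]].
  destruct (z_bounded m d b K M CM CM Hd HM HK Ksym Kpos Kdense HCM0 HCM KM HCM0 HCE kappa T (Rlt_le _ _ hT)
    vh z Phi P L L Hvz Hvhc Hvh0 HPhic HPhi0 HL HPhiLip HPc HP0 HL HPLip HPhiP Hint) as [C2 [HC2 Hz]].
  assert (Hu0n : 0 < norm u0).
  { destruct (norm_ge_0 u0) as [W | W]; [exact W | ].
    exfalso. apply hu0. exact (@norm_eq_zero R_AbsRing H u0 (eq_sym W)). }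
  assert (HnA := norm_ge_0 (A u0)).
  (* C1 bounds v' and C2 bounds A v - A u0, uniformly in t; dividing by |u0| gives the required
     form, and the summand 1 makes the constant positive. *)
  exists ((C1 + (C2 + norm (A u0)) + 1) / norm u0). split.
  { apply Rdiv_lt_0_compat; [lra | exact Hu0n]. }
  intros t Ht.
  replace ((C1 + (C2 + norm (A u0)) + 1) / norm u0 * norm u0) with (C1 + (C2 + norm (A u0)) + 1)
    by (field; lra).
  assert (B1 : norm (v' t) <= C1).
  { apply (norm_derive_bound_left v t _ _ t HC1); [apply Hv; lra | lra | ].
    intros h Hh. replace (minus (v t) (v (t - h))) with (bdiff h vh t).
    - apply Hlip; lra.
    - unfold bdiff, vh. rewrite !cutoff_pos by lra. hilbert_ring. }
  assert (B2 : norm (A (v t)) <= C2 + norm (A u0)).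
  { eapply Rle_trans; [apply (norm_le_minus _ (A u0)) | ]. apply Rplus_le_compat_r.
    replace (minus (A (v t)) (A u0)) with (z t) by (unfold z; rewrite cutoff_pos by lra; reflexivity).
    apply Hz. lra. }
  lra.
Qed.
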